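(* For any $\varepsilon>0$, $p_1>1$, $p_2>1$ and $r$ with $1/p_1+1/p_2=1/r$, there exists a constant $C$ independent of $m,M_1,M_2,L_1,L_2$ such that the following holds. Let $L_1,L_2$ be positive integers, $M_1,M_2$ integers and $m$ a nonnegative integer, and suppose that for all $j$, $$2^{L_2j+M_2}\ge 2^{L_1j+M_1+m}.$$ Then $$\big\|\Pi_{L_1,L_2,M_1,M_2,m}(f_1,f_2)\big\|_r\le C2^{\varepsilon m}\|f_1\|_{p_1}\|f_2\|_{p_2}$$ for all $f_1\in L^{p_1}(\mathbb R)$ and $f_2\in L^{p_2}(\mathbb R)$.
   Context: All functions are on $\mathbb R$; $\widehat f(\xi)=\int f(x)e^{-2\pi i x\xi}\,dx$; $\|\cdot\|_r$ is the $L^r(\mathbb R)$ (quasi-)norm. Let $\Phi_1$ be a fixed Schwartz function whose Fourier transform is a standard (smooth) bump function supported on $[1/2,2]$. For $\ell\in\{1,2\}$, $j\in\mathbb Z$ and a nonnegative integer $m$, define $\Phi_{\ell,j,m}$ by $$\widehat\Phi_{\ell,j,m}(\xi)=e^{2\pi i 2^m\,\xi/2^{L_\ell j+M_\ell}}\;\widehat\Phi_1\Big(\frac{\xi}{2^{L_\ell j+M_\ell}}\Big),$$ and set $f_{\ell,j,m}=f_\ell*\Phi_{\ell,j,m}$. The paraproduct is $$\Pi_{L_1,L_2,M_1,M_2,m}(f_1,f_2)(x)=\sum_{j\in\mathbb Z}\ \prod_{\ell=1}^2 f_{\ell,j,m}(x).$$ In the hypothesis, $j$ ranges over the integers. *)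

(* Defs.v *)
From HB Require Import structures.
From mathcomp Require Import all_boot all_order all_algebra.
From mathcomp Require Import all_classical all_reals all_analysis.
From mathcomp Require Import complex.

Set Implicit Arguments.
Unset Strict Implicit.
Unset Printing Implicit Defensive.

Import Order.TTheory GRing.Theory Num.Theory.
Import numFieldNormedType.Exports.

Local Open Scope classical_set_scope.
Local Open Scope complex_scope.
Local Open Scope ring_scope.

Section Paraproduct.
Context {R : realType}.

Local Notation mu := (@lebesgue_measure R).

(* [R[i]] is neither a normed space over [R] nor a measurable type in the
   libraries, so integrals, derivatives, limits and measurability of
   complex-valued functions are taken on real and imaginary parts. *)

Definition cintegral (f : R -> R[i]) : R[i] :=
  (\int[mu]_x complex.Re (f x))%R +i* (\int[mu]_x complex.Im (f x))%R.

Definition cmeasurable (f : R -> R[i]) : Prop :=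
  measurable_fun setT (fun x => complex.Re (f x)) /\
  measurable_fun setT (fun x => complex.Im (f x)).

(* A quasi-norm when [0 < p < 1]; it takes values in [\bar R]. *)
Definition cLnorm (p : R) (f : R -> R[i]) : \bar R :=
  Lnorm mu p%:E (fun x => (Normc.normc (f x))%:E).

Definition in_Lp (p : R) (f : R -> R[i]) : Prop :=
  cmeasurable f /\ (cLnorm p f < +oo)%E.

Definition csmooth (f : R -> R[i]) : Prop :=
  forall (n : nat) (x : R),
    derivable (derive1n n (fun y => complex.Re (f y))) x 1 /\
    derivable (derive1n n (fun y => complex.Im (f y))) x 1.

Definition cderiven (n : nat) (f : R -> R[i]) (x : R) : R[i] :=
  derive1n n (fun y => complex.Re (f y)) x
    +i* derive1n n (fun y => complex.Im (f y)) x.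

Definition schwartz (f : R -> R[i]) : Prop :=
  csmooth f /\
  forall a b : nat, exists K : R,
    forall x : R, `|x| ^+ a * Normc.normc (cderiven b f x) <= K.

Definition expi2pi (t : R) : R[i] :=
  cos (2 * pi * t) +i* sin (2 * pi * t).

Definition fourier (f : R -> R[i]) (xi : R) : R[i] :=
  cintegral (fun x => f x * expi2pi (- (x * xi))).

Definition inv_fourier (g : R -> R[i]) (x : R) : R[i] :=
  cintegral (fun xi => g xi * expi2pi (x * xi)).

Definition convolution (f g : R -> R[i]) (x : R) : R[i] :=
  cintegral (fun y => f y * g (x - y)).

(* [`[a, b]] is closed, so it then contains the closed support of [phi]. *)
Definition bump_on (a b : R) (phi : R -> R[i]) : Prop :=
  csmooth phi /\ [set xi | phi xi != 0] `<=` `[a, b].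

Definition dyadic (L M j : int) : R := 2 ^ (L * j + M).

Definition Phi_hat (Phi1 : R -> R[i]) (L M j : int) (m : nat) (xi : R) : R[i] :=
  expi2pi (2 ^+ m * xi / dyadic L M j) * fourier Phi1 (xi / dyadic L M j).

(* The function whose Fourier transform is [Phi_hat]. *)
Definition Phi (Phi1 : R -> R[i]) (L M j : int) (m : nat) : R -> R[i] :=
  inv_fourier (Phi_hat Phi1 L M j m).

Definition piece (Phi1 : R -> R[i]) (L M : int) (m : nat) (f : R -> R[i])
    (j : int) : R -> R[i] :=
  convolution f (Phi Phi1 L M j m).

(* A series indexed by the integers converges when both of its halves do;
   [Negz n] is the integer [- n.+1]. *)
Definition zseries_cvg (u : int -> R) : Prop :=
  cvgn (series (fun n => u (Posz n))) /\ cvgn (series (fun n => u (Negz n))).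

Definition zseries (u : int -> R) : R :=
  limn (series (fun n => u (Posz n))) + limn (series (fun n => u (Negz n))).

Definition czseries_cvg (u : int -> R[i]) : Prop :=
  zseries_cvg (fun j => complex.Re (u j)) /\
  zseries_cvg (fun j => complex.Im (u j)).

Definition czseries (u : int -> R[i]) : R[i] :=
  zseries (fun j => complex.Re (u j)) +i* zseries (fun j => complex.Im (u j)).

Definition paraproduct_term (Phi1 : R -> R[i]) (L1 L2 M1 M2 : int) (m : nat)
    (f1 f2 : R -> R[i]) (x : R) (j : int) : R[i] :=
  piece Phi1 L1 M1 m f1 j x * piece Phi1 L2 M2 m f2 j x.

Definition paraproduct (Phi1 : R -> R[i]) (L1 L2 M1 M2 : int) (m : nat)
    (f1 f2 : R -> R[i]) (x : R) : R[i] :=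
  czseries (paraproduct_term Phi1 L1 L2 M1 M2 m f1 f2 x).

End Paraproduct.

(* Main.v *)
(** The piece [f_(l,j,m)] is the convolution of [f_l] with the kernel
    [2^k Psi (2^k x + 2^m)], where [k = L_l j + M_l] and [Psi], the inverse
    Fourier transform of a bump supported on [[1/2, 2]], has rapid decay and
    mean zero.  By Cauchy-Schwarz in [j] the paraproduct is at most [S_1 S_2],
    with [S_l] the square function of the [f_(l,j,m)].  Hence Hoelder's
    inequality reduces everything to [||S f||_p <= C (m + 1) ||f||_p] for
    [1 < p < oo], because [(m + 1)^2 <= C 2^(eps m)].

    The operator [f |-> (f_j)_j] is a vector-valued Calderon-Zygmund operator.
    Since [L_l > 0] the scales [k] are distinct, and almost orthogonality bounds
    it on [L^2] independently of the translation [2^m].  In Hoermander's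
    condition at scale [2^N] a kernel with [k + N <= 0] is small because it is
    smooth, one with [k + N > m] because its tail is small, and only the [m]
    kernels in between contribute their full [L^1] norm: the constant is
    [O(m + 1)].  A stopping-time decomposition gives the weak type (1, 1)
    bound, interpolation gives [1 < p < 2], and duality with the synthesis
    operator [(g_j)_j |-> sum_j g_j * K_j], to which the same argument
    applies, gives [p > 2]. *)

Require Import Defs.
From HB Require Import structures.
From mathcomp Require Import all_boot all_order all_algebra.
From mathcomp Require Import all_classical all_reals all_analysis.
From mathcomp Require Import measurable_realfun complex.
From mathcomp Require Import ring lra zify.

Set Implicit Arguments.
Unset Strict Implicit.
Unset Printing Implicit Defensive.

Import Order.TTheory GRing.Theory Num.Theory.
Import numFieldNormedType.Exports.

Local Open Scope classical_set_scope.
Local Open Scope ring_scope.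

(** * Integrals and convolutions of real functions *)

(** The [L^2] bounds rest on three real-variable facts about the profile: it has mean zero, a finite
    first moment, and an [L^1] modulus of continuity. Two dilates then interact with a gain equal to
    the ratio of their scales, and Schur's test sums the interactions. The Fourier side serves only
    to identify the kernels and to verify these facts. Operators act between finitely many scales,
    with constants independent of their number. All scales enter at the end through monotone
    convergence, which also gives the almost everywhere convergence of the series. The estimates are
    proved for bounded functions of bounded support, a class that survives cutting by indicators and
    in which all integrals are finite, so that terms may be absorbed; Fatou's lemma carries them to
    [L^p]. The obstacle in the weak type bound is the set where no average ever exceeds the
    threshold. The bisection is therefore finite and [g] is replaced by its mean on every final
    interval, selected or not. Finitely many kernels oscillate little in [L^1] under tiny
    translations, so on the shortest intervals the error is controlled on the whole line. *)

Ltac meas :=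
  first [match goal with H : ?P |- ?P => exact H end |
  lazymatch goal with
  | |- measurable_fun _ (fun x => x) => exact: measurable_id
  | |- measurable_fun _ (fun x => (@?f x)%:E) => apply/measurable_EFinP; meas
  | |- measurable_fun _ (fun x => @?f x + - @?g x) =>
      first [apply: (@measurable_funB _ _ _ _ f g); meas]
  | |- measurable_fun _ (fun x => @?f x + @?g x) =>
      first [apply: (@measurable_funD _ _ _ _ f g); meas]
  | |- measurable_fun _ (fun x => @?f x * @?g x) =>
      first [apply: (@measurable_funM _ _ _ _ f g); meas]
  | |- measurable_fun _ (fun x => - @?f x) =>
      first [apply: (measurableT_comp (@oppr_measurable _ setT)); meas]
  | |- measurable_fun _ (fun x => `| @?f x |) =>
      first [apply: (measurableT_comp (@normr_measurable _ setT)); meas]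
  | |- measurable_fun _ (fun x => (@?f x) ^+ ?n) =>
      first [apply: (@measurable_funX _ _ _ _ f n); meas]
  | |- measurable_fun _ (fun x => \sum_(i <- @?s x) _) => (apply: measurable_sum => ?; meas)
  | |- measurable_fun _ (fun x => x.1) => exact: measurable_fst
  | |- measurable_fun _ (fun x => x.2) => exact: measurable_snd
  | |- measurable_fun _ (fun x => \1_(?A) x) => exact: measurable_indic
  | H : measurable_fun setT ?g |- measurable_fun _ (fun x => ?g (@?f x)) =>
      first [exact: H | apply: (@measurableT_comp _ _ _ _ _ _ g _ f); [exact: H|meas]]
  | H : forall i, measurable_fun setT (?g i) |- measurable_fun _ (fun x => ?g ?i (@?f x)) =>
      first [exact: H | apply: (@measurableT_comp _ _ _ _ _ _ (g i) _ f); [exact: H|meas]]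
  | |- measurable_fun _ (fun x => ?c) => exact: measurable_cst
  | |- _ => done
  end |
  match goal with H : forall _, measurable_fun _ _ |- _ => exact (H _) end |
  assumption].

Section Integral.
Context {R : realType}.
Local Notation mu := (@lebesgue_measure R).
Implicit Types f g : R -> R.

Definition nint f : \bar R := (\int[mu]_x (f x)%:E)%E.

(* The integral of a nonnegative function is a supremum over the simple
   functions below it, so that no measurability is needed. *)
Lemma ge0_le_integral_nomeas (f g : R -> \bar R) :
  (forall x, 0 <= f x)%E -> (forall x, f x <= g x)%E ->
  (\int[mu]_x f x <= \int[mu]_x g x)%E.
Proof.
move=> f0 fg; have g0 x : (0 <= g x)%E by apply: le_trans (fg x).
rewrite !ge0_integralTE//; apply: ub_ereal_sup => _ [h hf <-].
by apply: ereal_sup_ubound; exists h => //= x; apply: le_trans (hf x) (fg x).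
Qed.

Lemma nint_le f g : (forall x, 0 <= f x) -> (forall x, f x <= g x) ->
  (nint f <= nint g)%E.
Proof. by move=> f0 fg; apply: ge0_le_integral_nomeas => x; rewrite lee_fin. Qed.

Lemma nint_ge0 f : (forall x, 0 <= f x) -> (0 <= nint f)%E.
Proof. by move=> f0; apply: integral_ge0 => x _; rewrite lee_fin. Qed.

Lemma eq_nint f g : f =1 g -> nint f = nint g.
Proof. by move=> fg; apply: eq_integral => x _; rewrite fg. Qed.

Lemma nintD f g : measurable_fun setT f -> measurable_fun setT g ->
  (forall x, 0 <= f x) -> (forall x, 0 <= g x) ->
  nint (fun x => f x + g x) = (nint f + nint g)%E.
Proof.
move=> mf mg f0 g0; rewrite /nint -ge0_integralD//.
- by move=> x _; rewrite lee_fin.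
- exact/measurable_EFinP.
- by move=> x _; rewrite lee_fin.
- exact/measurable_EFinP.
Qed.

Lemma nintZ k f : measurable_fun setT f -> (forall x, 0 <= f x) -> 0 <= k ->
  nint (fun x => k * f x) = (k%:E * nint f)%E.
Proof.
move=> mf f0 k0; rewrite /nint -ge0_integralZl//.
- exact/measurable_EFinP.
- by move=> x _; rewrite lee_fin.
Qed.

Lemma nint_sum (I : Type) (s : seq I) (f : I -> R -> R) :
  (forall i, measurable_fun setT (f i)) -> (forall i x, 0 <= f i x) ->
  nint (fun x => \sum_(i <- s) f i x) = (\sum_(i <- s) nint (f i))%E.
Proof.
move=> mf f0; rewrite /nint -ge0_integral_sum//.
- by apply: eq_integral => x _; rewrite sumEFin.
- by move=> i; apply/measurable_EFinP; exact: mf.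
- by move=> i x _; rewrite lee_fin.
Qed.

Lemma integrable_nint f : measurable_fun setT f ->
  (nint (fun x => `|f x|)%R < +oo)%E -> mu.-integrable setT (EFin \o f).
Proof.
by move=> mf fy; apply/integrableP; split; [exact/measurable_EFinP|exact: fy].
Qed.

Lemma nint_integrable f : mu.-integrable setT (EFin \o f) ->
  measurable_fun setT f /\ (nint (fun x => `|f x|)%R < +oo)%E.
Proof.
by move=> /integrableP[mf fy]; split; [exact/measurable_EFinP|exact: fy].
Qed.

Lemma le_normr_Rint f : measurable_fun setT f ->
  ((`|\int[mu]_x f x|%R)%:E <= nint (fun x => `|f x|)%R)%E.
Proof.
move=> mf.
have [fy|] := boolP (nint (fun x => `|f x|)%R < +oo)%E; last first.
  by rewrite -leNgt leye_eq => /eqP ->; rewrite leey.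
have fi := integrable_nint mf fy.
apply: (@le_trans _ _ (\int[mu]_x `|f x|)%R%:E).
  by rewrite lee_fin; exact: le_normr_Rintegral.
rewrite /Rintegral fineK// ge0_fin_numE//.
by apply: integral_ge0 => x _; rewrite lee_fin.
Qed.

Lemma nint_fine f : (forall x, 0 <= f x) -> (nint f < +oo)%E ->
  nint f = (\int[mu]_x f x)%:E.
Proof. by move=> f0 fy; rewrite /Rintegral fineK// ge0_fin_numE// nint_ge0. Qed.

Lemma nint_tonelli (f : R * R -> R) :
  measurable_fun setT f -> (forall z, 0 <= f z) ->
  (\int[mu]_x nint (fun y => f (x, y)) = \int[mu]_y nint (fun x => f (x, y)))%E.
Proof.
move=> mf f0; apply: (@fubini_tonelli _ _ _ _ _ mu mu (EFin \o f)) => //.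
  exact/measurable_EFinP.
Qed.

Lemma nint_affine (G : R -> R) (a b : R) : 0 < a -> continuous G ->
  (forall x, 0 <= G x) ->
  nint (fun x => G (a * x + b)) = ((a^-1)%:E * nint G)%E.
Proof.
move=> a0 cG G0.
have d1 : (fun x : R => a * x + b)^`()%classic = cst a.
  apply/funext => x; rewrite derive1E.
  have h : is_derive x 1 ((a *: id : R -> R) + cst b) (a *: 1 + 0) by apply: is_deriveD.
  by rewrite (_ : (fun _ => _) = (a *: id : R -> R) + cst b)// derive_val addr0 /= /GRing.scale /= mulr1.
have H := @increasing_ge0_integration_by_substitutionT R (fun x => a * x + b) G.
rewrite [in RHS]/nint H//.
- rewrite d1 /= -/(nint _) [X in (_ * X)%E](@eq_nint _ (fun x => a * G (a * x + b))); last first.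
    by move=> x; rewrite /= mulrC.
  have mG : measurable_fun setT G by exact: continuous_measurable_fun.
  rewrite nintZ ?ltW//; last by meas.
  by rewrite muleA -EFinM mulVf ?gt_eqF// mul1e.
- by move=> x y xy; rewrite ltrD2r ltr_pM2l.
- by rewrite d1; move=> x; exact: cvg_cst.
- by rewrite d1; exact: is_cvg_cst.
- by rewrite d1; exact: is_cvg_cst.
- apply/cvgrNyPle => A; near=> x.
  by rewrite -lerBrDr mulrC -ler_pdivlMr//; near: x; exact: nbhs_ninfty_le.
- apply/cvgryPge => A; near=> x.
  by rewrite -lerBlDr mulrC -ler_pdivrMr//; near: x; exact: nbhs_pinfty_ge.
Unshelve. all: by end_near. Qed.

Lemma nint_shift (G : R -> R) (b : R) : continuous G ->
  (forall x, 0 <= G x) -> nint (fun x => G (x + b)) = nint G.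
Proof.
move=> cG G0; have := nint_affine b ltr01 cG G0.
by rewrite invr1 mul1e => <-; apply: eq_nint => x; rewrite mul1r.
Qed.

(** The pushforward of Lebesgue measure under [x |-> c - x] gives every half-open interval its
    length, so it is Lebesgue measure by uniqueness. *)
Lemma nint_reflect (G : R -> R) (c : R) : measurable_fun setT G ->
  (forall x, 0 <= G x) -> nint (fun x => G (c - x)) = nint G.
Proof.
move=> mG G0.
pose phi : measurableTypeR R -> measurableTypeR R := fun x => c - x.
have mphi : measurable_fun setT phi by rewrite /phi; meas.
have pe A : measurable A -> pushforward mu phi A = mu A.
  move=> mA; apply/esym/lebesgue_measure_unique => //= _ [[a b]] _ <-.
  rewrite /pushforward /= (_ : _ @^-1` _ = [set` `[c - b, c - a[]); last first.
    apply/seteqP; split=> x /=; rewrite /phi !in_itv/= => /andP[? ?];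
      by apply/andP; split; lra.
  by rewrite !lebesgue_measure_itv/= !lte_fin ltrD2l ltrN2 -!EFinB (_ : c - a - (c - b) = b - a)//; ring.
have E := @ge0_integral_pushforward _ _ _ _ R phi mphi mu setT (EFin \o G) measurableT.
rewrite /nint -[LHS]E//=.
- by apply: eq_measure_integral => A mA _; exact: pe.
- exact/measurable_EFinP.
- by move=> x _; rewrite lee_fin.
Qed.

Lemma measurable_powRf (r : R) g : measurable_fun setT g -> measurable_fun setT (fun x => g x `^ r).
Proof. by move=> mg; apply: (measurableT_comp (measurable_powR r)). Qed.

(** Every truncation of the proof, in height, in space or of the input function, is removed by this
    form of Fatou's lemma: a bound uniform in [n] suffices. *)
Lemma nint_fatou (f : nat -> R -> R) (g : R -> R) (C : \bar R) :
  (forall n, measurable_fun setT (f n)) -> (forall n x, 0 <= f n x) ->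
  (forall x, f n x @[n --> \oo] --> g x) ->
  (forall n, nint (f n) <= C)%E -> (nint g <= C)%E.
Proof.
move=> mf f0 fg fC.
have mf' n : measurable_fun setT (fun x => (f n x)%:E) by exact/measurable_EFinP.
have f0' n (x : R) : setT x -> (0 <= (f n x)%:E)%E by rewrite lee_fin.
have := @fatou _ _ _ mu setT measurableT (fun n x => (f n x)%:E) mf' f0'.
rewrite (_ : (\int[mu]_x _)%E = nint g); last first.
  apply: eq_integral => x _.
  have cv : ((f n x)%:E @[n --> \oo] --> (g x)%:E)%E by apply: cvg_EFin; [exact: nearW|exact: fg].
  by rewrite is_cvg_limn_einfE; [exact/cvg_lim | apply/cvg_ex; eexists; exact: cv].
move=> /le_trans; apply.
rewrite limn_einf_lim; apply: lime_le.
  exact: is_cvg_einfs.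
apply: nearW => n; apply: ereal_inf_le.
exists (nint (f n)) => //.
by exists n => //=.
Qed.
End Integral.

Section Convolution.
Context {R : realType}.
Local Notation mu := (@lebesgue_measure R).
Implicit Types f g K : R -> R.

Definition conv g K (x : R) : R := \int[mu]_y (g y * K (x - y)).

Definition L1 g := measurable_fun setT g /\ (nint (fun x => `|g x|)%R < +oo)%E.

Definition bounded_by (B : R) g := forall x, `|g x| <= B.

Definition L1Linf g := L1 g /\ exists B, bounded_by B g.

(** Continuity serves the changes of variables and makes [conv g K] continuous, hence measurable;
    boundedness makes the convolution of an integrable function with [K] exist at every point. *)
Definition kernel K := continuous K /\ L1Linf K.

(** The working class: stable under sums and under multiplication by bounded measurable functions,
    and contained in every [L^p]. A single [M] bounds both the values and the support. *)
Definition bounded_supp g :=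
  measurable_fun setT g /\
  exists M : R, forall x, `|g x| <= M /\ (M < `|x| -> g x = 0).

Lemma nint_indic_itv (a b : R) : a <= b -> nint (\1_(`[a, b])) = (b - a)%:E.
Proof.
move=> ab; rewrite /nint integral_indic//= setIT lebesgue_measure_itv/=.
by case: ifPn => //; rewrite lte_fin -leNgt => ba; rewrite (@le_anti _ _ a b) ?ab ?ba // subrr.
Qed.

Lemma bounded_supp_L1Linf g : bounded_supp g -> L1Linf g.
Proof.
move=> [mg [M gM]].
have M0 : 0 <= M by apply: le_trans (gM 0).1.
split; last by exists M => x; exact: (gM x).1.
split=> //.
apply: (@le_lt_trans _ _ (nint (fun x => M * \1_(`[-M, M]) x)%R)).
  apply: nint_le => // x; have [xM|xM] := leP `|x| M.
    rewrite indicE mem_set ?mulr1; first exact: (gM x).1.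
    by rewrite /= in_itv/= -ler_norml.
  by rewrite (gM x).2// normr0 mulr_ge0.
rewrite nintZ//.
  by rewrite nint_indic_itv ?ge0_cp// ?ltry -?EFinM ?ltry// lerNl (le_trans _ M0)// oppr_le0.
Qed.

Lemma bounded_by_ge0 B g : bounded_by B g -> 0 <= B.
Proof. by move=> gB; exact: le_trans (gB 0). Qed.

Lemma kernel_meas K : kernel K -> measurable_fun setT K.
Proof. by move=> [_ [[]]]. Qed.

Lemma L1_conv_integrand g K B (x : R) : L1 g -> measurable_fun setT K ->
  bounded_by B K -> L1 (fun y => g y * K (x - y)).
Proof.
move=> [mg gy] mK KB; have B0 := bounded_by_ge0 KB; split; first by meas.
apply: (@le_lt_trans _ _ (nint (fun y => B * `|g y|)%R)).
  by apply: nint_le => // y; rewrite normrM mulrC ler_wpM2r.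
rewrite nintZ//; last by meas.
by rewrite lte_mul_pinfty.
Qed.

Lemma L1_integrable g : L1 g <-> mu.-integrable setT (EFin \o g).
Proof. by split=> [[mg gy]|/nint_integrable//]; exact: integrable_nint. Qed.

Lemma nint_L1 f : L1 f -> (forall x, 0 <= f x) -> nint f = (\int[mu]_x f x)%:E.
Proof.
move=> [mf fy] f0; apply: nint_fine => //.
by apply: le_lt_trans fy; apply: nint_le => // x; exact: ler_norm.
Qed.

Lemma L1D f g : L1 f -> L1 g -> L1 (fun x => f x + g x).
Proof.
move=> fL gL; apply/L1_integrable.
by apply: (@integrableD _ _ _ mu setT measurableT (EFin \o f) (EFin \o g));
  exact/L1_integrable.
Qed.

Lemma L1Z (k : R) f : L1 f -> L1 (fun x => k * f x).
Proof.
move=> fL; apply/L1_integrable.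
by apply: (@integrableZl _ _ _ mu setT measurableT k (EFin \o f)); exact/L1_integrable.
Qed.

Lemma L1_sum (I : Type) (s : seq I) (F : I -> R -> R) :
  (forall i, L1 (F i)) -> L1 (fun x => \sum_(i <- s) F i x).
Proof.
move=> FL; elim: s => [|i s IH].
  under [X in L1 X]eq_fun do rewrite big_nil.
  by split; [meas|rewrite /nint; under eq_integral do rewrite normr0; rewrite integral0].
by under [X in L1 X]eq_fun do rewrite big_cons; exact: L1D.
Qed.

Lemma Rint_sum (I : Type) (s : seq I) (F : I -> R -> R) :
  (forall i, L1 (F i)) ->
  \int[mu]_x (\sum_(i <- s) F i x) = \sum_(i <- s) \int[mu]_x F i x.
Proof.
move=> FL.
elim: s => [|i s IH].
  under eq_Rintegral do rewrite big_nil.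
  by rewrite Rintegral_cst ?mul0r// big_nil.
under eq_Rintegral do rewrite big_cons.
by rewrite RintegralD ?big_cons ?IH//; apply/L1_integrable => //; exact: L1_sum.
Qed.

Lemma conv_sum (I : Type) (s : seq I) (F : I -> R -> R) K B x :
  (forall i, L1 (F i)) -> measurable_fun setT K -> bounded_by B K ->
  conv (fun y => \sum_(i <- s) F i y) K x = \sum_(i <- s) conv (F i) K x.
Proof.
move=> FL mK KB; rewrite /conv -Rint_sum; last first.
  by move=> i; exact: (L1_conv_integrand _ (FL i) mK KB).
by apply: eq_Rintegral => y _; rewrite mulr_suml.
Qed.

Lemma convD f g K B x : L1 f -> L1 g -> measurable_fun setT K -> bounded_by B K ->
  conv (fun y => f y + g y) K x = conv f K x + conv g K x.
Proof.
move=> fL gL mK KB; rewrite /conv -RintegralD//; last 2 first.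
- by apply/L1_integrable; exact: (L1_conv_integrand _ fL mK KB).
- by apply/L1_integrable; exact: (L1_conv_integrand _ gL mK KB).
by apply: eq_Rintegral => y _; rewrite mulrDl.
Qed.

Lemma le_conv g K x : measurable_fun setT g -> measurable_fun setT K ->
  ((`|conv g K x|%R)%:E <= nint (fun y => `|g y| * `|K (x - y)|)%R)%E.
Proof.
move=> mg mK; apply: (le_trans (le_normr_Rint _)); first by meas.
by under eq_nint do rewrite normrM.
Qed.

Lemma conv_continuous g K B : L1 g -> continuous K -> bounded_by B K ->
  continuous (conv g K).
Proof.
move=> gL cK KB x; have mK : measurable_fun setT K by exact: continuous_measurable_fun.
have B0 := bounded_by_ge0 KB.
have := @continuity_under_integral R _ _ mu (fun x y => g y * K (x - y)) setT measurableT
  (x - 1) (x + 1) _ _ (fun y => B * `|g y|) _ _.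
apply.
- by move=> z _; apply/L1_integrable; exact: (L1_conv_integrand _ gL mK KB).
- apply: aeW => y _ z _; apply: cvgM; first exact: cvg_cst.
  apply: (@continuous_comp _ _ _ (fun z => z - y) K); last exact: cK.
  by apply: cvgB; [exact: cvg_id|exact: cvg_cst].
- apply/L1_integrable; split; first by case: gL => ? _; meas.
  have mB : measurable_fun setT (fun y => `|g y|) by case: gL => mg _; meas.
  case: gL => mg gy; under eq_nint do rewrite normrM normr_id (ger0_norm B0).
  by rewrite nintZ// lte_mul_pinfty.
- by move=> z _; apply: aeW => y _; rewrite normrM mulrC ler_wpM2r.
- by rewrite inE /= in_itv/=; apply/andP; split; lra.
Qed.

Lemma conv_bounded g K B : L1 g -> measurable_fun setT K -> bounded_by B K ->
  exists B', bounded_by B' (conv g K).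
Proof.
move=> [mg gy] mK KB; have B0 := bounded_by_ge0 KB.
exists (fine (B%:E * nint (fun y => `|g y|)%R)%E) => x.
rewrite -lee_fin fineK; last first.
  by rewrite ge0_fin_numE ?mule_ge0 ?nint_ge0// lte_mul_pinfty// nint_ge0.
apply: (le_trans (le_conv x mg mK)); rewrite -nintZ//; last by meas.
by apply: nint_le => y; rewrite ?mulr_ge0// mulrC ler_wpM2r.
Qed.

Lemma young1 g K : L1 g -> kernel K ->
  (nint (fun x => `|conv g K x|)%R <= nint (fun x => `|g x|)%R * nint (fun x => `|K x|)%R)%E.
Proof.
move=> [mg gy] kK; have mK := kernel_meas kK; case: kK => cK [[_ Ky] [B KB]].
apply: (@le_trans _ _ (\int[mu]_x nint (fun y => `|g y| * `|K (x - y)|)%R)%E).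
  apply: ge0_le_integral_nomeas => x; first by rewrite lee_fin.
  exact: le_conv.
rewrite (@nint_tonelli _ (fun z => `|g z.2| * `|K (z.1 - z.2)|)%R)//; last by meas.
rewrite muleC -ge0_integralZl//=; last 2 first.
- by apply/measurable_EFinP; meas.
- exact: nint_ge0.
apply: ge0_le_integral_nomeas => y; first by apply: nint_ge0 => x; rewrite mulr_ge0.
rewrite nintZ//; last by meas.
rewrite muleC lee_wpmul2r ?lee_fin//.
by rewrite (nint_shift (G := fun x => `|K x|))// => x; apply: cvg_norm; exact: cK.
Qed.

Lemma conv_L1Linf g K : L1 g -> kernel K -> L1Linf (conv g K).
Proof.
move=> gL kK; have mK := kernel_meas kK; have := kK => -[cK [[_ Ky] [B KB]]].
split; last exact: (conv_bounded gL mK KB).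
split.
  by apply: continuous_measurable_fun; exact: (conv_continuous gL cK KB).
apply: (le_lt_trans (young1 gL kK)).
by case: gL => _ gy; rewrite lte_mul_pinfty// ?ge0_fin_numE ?nint_ge0.
Qed.

(** Fubini's theorem moves the kernel from [g] to [H]: since [H] is bounded, [H x * g y * a (x - y)]
    is dominated by an integrable function on the plane. This is the transposition behind every
    duality argument below. *)
Lemma conv_dual g (H : R -> R) a B : L1 g -> measurable_fun setT H -> bounded_by B H -> kernel a ->
  \int[mu]_x (H x * conv g a x) = \int[mu]_y (g y * \int[mu]_x (H x * a (x - y))).
Proof.
move=> gL mH HB ka; have ma := kernel_meas ka; have := ka => -[ca [[_ ay] [A aA]]].
have [mg gy] := gL; have B0 := bounded_by_ge0 HB; have A0 := bounded_by_ge0 aA.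
pose F (z : R * R) := H z.1 * (g z.2 * a (z.1 - z.2)).
have mF : measurable_fun setT F by rewrite /F; meas.
have L1a y : L1 (fun x => a (x - y)).
  split; first by meas.
  by rewrite (nint_shift (G := fun x => `|a x|))// => x; apply: cvg_norm; exact: ca.
have iF : (mu \x mu)%E.-integrable setT (EFin \o F).
  apply/integrable12ltyP; first exact/measurable_EFinP.
  have mF' : measurable_fun setT (fun z => `|F z|) by meas.
  have -> : (\int[mu]_x \int[mu]_y `|(EFin \o F) (x, y)| = \int[mu]_x nint (fun y => `|F (x, y)|)%R)%E by [].
  rewrite (nint_tonelli mF')//.
  apply: (@le_lt_trans _ _ (\int[mu]_y (B * `|g y|)%:E * nint (fun x => `|a x|)%R)%E).
    rewrite -ge0_integralZr//=; last 3 first.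
    - by apply/measurable_EFinP; meas.
    - by move=> y _; rewrite lee_fin mulr_ge0.
    - exact: nint_ge0.
    apply: ge0_le_integral_nomeas => y; first by apply: nint_ge0 => x.
    have -> : nint (fun x => `|a x|)%R = nint (fun x => `|a (x - y)|)%R.
      by rewrite (nint_shift (G := fun x => `|a x|))// => x; apply: cvg_norm; exact: ca.
    have [may _] := L1a y.
    rewrite -nintZ ?mulr_ge0//; last by meas.
    apply: nint_le => // x; rewrite /F /= normrM normrM mulrA ler_wpM2r//.
    by rewrite ler_wpM2r.
  rewrite -/(nint _) nintZ//; last by meas.
  rewrite lte_mul_pinfty// ?ge0_fin_numE ?mule_ge0 ?nint_ge0//.
  by rewrite lte_mul_pinfty.
have := @Fubini _ _ _ _ _ mu mu (EFin \o F) iF.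
have EL x : (\int[mu]_y (EFin \o F) (x, y))%E = (H x * conv g a x)%:E.
  rewrite /conv -RintegralZl//; last first.
    by apply/L1_integrable; exact: (L1_conv_integrand _ gL ma aA).
  rewrite /Rintegral fineK//; apply: integrable_fin_num => //.
  apply: (@integrableZl _ _ _ mu setT measurableT (H x) (EFin \o (fun y => g y * a (x - y)))).
  by apply/L1_integrable; exact: (L1_conv_integrand _ gL ma aA).
have ER y : (\int[mu]_x (EFin \o F) (x, y))%E = (g y * \int[mu]_x (H x * a (x - y)))%:E.
  have iH : mu.-integrable setT (EFin \o (fun x => H x * a (x - y))).
    apply/L1_integrable; split; first by have [? _] := L1a y; meas.
    have [may ayy] := L1a y.
    apply: (@le_lt_trans _ _ (nint (fun x => B * `|a (x - y)|)%R)).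
      by apply: nint_le => // x; rewrite normrM ler_wpM2r.
    by rewrite nintZ ?lte_mul_pinfty//; meas.
  rewrite -RintegralZl// /Rintegral fineK.
    by congr (integral _ _ _); apply/funext => x; rewrite /F /= mulrCA.
  apply: integrable_fin_num => //.
  exact: (@integrableZl _ _ _ mu setT measurableT (g y) _ iH).
under eq_integral do rewrite EL.
under [in X in _ = X -> _]eq_integral do rewrite ER.
by rewrite /Rintegral => ->.
Qed.

End Convolution.

(** * Vector-valued Calderon-Zygmund operators *)

Section EuclideanNorm.
Context {R : realType} {I : finType}.
Implicit Types u v : I -> R.

Definition vnorm u : R := Num.sqrt (\sum_i u i ^+ 2).

Lemma sumsq_ge0 u : 0 <= \sum_i u i ^+ 2.
Proof. by apply: sumr_ge0 => i _; exact: sqr_ge0. Qed.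

Lemma vnorm_ge0 u : 0 <= vnorm u.
Proof. exact: sqrtr_ge0. Qed.

Lemma sqr_vnorm u : vnorm u ^+ 2 = \sum_i u i ^+ 2.
Proof. by rewrite sqr_sqrtr// sumsq_ge0. Qed.

Lemma ler_vnorm u i : `|u i| <= vnorm u.
Proof.
rewrite -sqrtr_sqr ler_wsqrtr// (bigD1 i)//= lerDl.
by apply: sumr_ge0 => j _; exact: sqr_ge0.
Qed.

Lemma vnorm_le_sum u : vnorm u <= \sum_i `|u i|.
Proof.
have s0 : 0 <= \sum_i `|u i| by exact: sumr_ge0.
rewrite -(ger0_norm s0) -sqrtr_sqr ler_wsqrtr// expr2 mulr_suml ler_sum// => i _.
rewrite -normr_id -real_normK ?num_real// expr2 normr_id ler_wpM2l//.
by rewrite (bigD1 i)//= lerDl sumr_ge0.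
Qed.

(** Once both vectors are normalized, the claim is the sum of [s * t <= (s ^+ 2 + t ^+ 2) / 2] over
    the coordinates; the zero vectors are treated apart. *)
Lemma vnorm_cs u v : \sum_i u i * v i <= vnorm u * vnorm v.
Proof.
have [u0|u0] := eqVneq (vnorm u) 0.
  rewrite u0 mul0r big1// => i _; have := ler_vnorm u i.
  by rewrite u0 normr_le0 => /eqP ->; rewrite mul0r.
have [v0|v0] := eqVneq (vnorm v) 0.
  rewrite v0 mulr0 big1// => i _; have := ler_vnorm v i.
  by rewrite v0 normr_le0 => /eqP ->; rewrite mulr0.
have U : 0 < vnorm u by rewrite lt_def u0 vnorm_ge0.
have V : 0 < vnorm v by rewrite lt_def v0 vnorm_ge0.
apply: (@le_trans _ _ (\sum_i (vnorm u * vnorm v) *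
    (((vnorm u)^-2 * u i ^+ 2 + (vnorm v)^-2 * v i ^+ 2) / 2))).
  apply: ler_sum => i _.
  have h := sqr_ge0 (u i / vnorm u - v i / vnorm v).
  rewrite -subr_ge0 (_ : _ - _ = (vnorm u * vnorm v) *
    ((u i / vnorm u - v i / vnorm v) ^+ 2 / 2)).
    by apply: mulr_ge0; [apply: mulr_ge0; exact: vnorm_ge0|exact: divr_ge0].
  by field; rewrite u0 v0.
rewrite -mulr_sumr -mulr_suml big_split/= -!mulr_sumr -!sqr_vnorm !mulVf ?expf_neq0//.
by rewrite divff ?pnatr_eq0// mulr1.
Qed.

Lemma vnormD u v : vnorm (fun i => u i + v i) <= vnorm u + vnorm v.
Proof.
rewrite -(@ler_pXn2r _ 2%N)// ?nnegrE ?addr_ge0 ?vnorm_ge0//.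
rewrite sqrrD !sqr_vnorm.
under eq_bigr do rewrite sqrrD.
rewrite 2!big_split/= lerD2r lerD2l -mulrnAl.
rewrite sumrMnl mulrnAl ler_pMn2r//; exact: vnorm_cs.
Qed.

Lemma measurable_vnorm d (X : measurableType d) (f : I -> X -> R) :
  (forall i, measurable_fun setT (f i)) ->
  measurable_fun setT (fun x => vnorm (f ^~ x)).
Proof.
move=> mf.
apply: (measurableT_comp (continuous_measurable_fun (@sqrt_continuous R))).
by apply: measurable_sum => i; apply: measurable_funX.
Qed.

End EuclideanNorm.

(** * Stopping-time intervals by finite bisection *)

Section StoppingTime.
Context {R : realType}.
Local Notation mu := (@lebesgue_measure R).

(** Half-open, so that the two halves partition the interval exactly and their indicators add up.
    Centre and half-length are the data that the Hoermander condition asks for. *)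
Definition ivl (c h : R) : set R := `[c - h, c + h[%classic.

Lemma indic_ivl_half (c h x : R) : 0 <= h ->
  \1_(ivl (c - h / 2) (h / 2)) x + \1_(ivl (c + h / 2) (h / 2)) x = \1_(ivl c h) x :> R.
Proof.
move=> h0; rewrite !indicE -natrD; congr (_%:R).
have E c' h' : (x \in ivl c' h') = (c' - h' <= x) && (x < c' + h').
  by apply/idP/idP; rewrite inE /ivl/= in_itv.
rewrite !E.
have -> : c - h / 2 - h / 2 = c - h by lra.
have -> : c - h / 2 + h / 2 = c by lra.
have -> : c + h / 2 - h / 2 = c by lra.
have -> : c + h / 2 + h / 2 = c + h by lra.
have [xc|xc] := ltP x c; last first.
  have -> : c - h <= x by lra.
  by rewrite andbF.
have -> : x < c + h by lra.
by rewrite andbT addn0.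
Qed.

Lemma measurable_ivl c h : measurable (ivl c h).
Proof. exact: measurable_itv. Qed.

(* Bisect [ivl c h] until the average of [G] exceeds [lam], but at most [n]
   times. *)
Lemma stopping_intervals (G : R -> R) (lam : R) :
  (forall x, 0 <= G x) -> measurable_fun setT G ->
  forall n c h, 0 < h ->
  (nint (fun x => G x * \1_(ivl c h) x)%R <= (2 * lam * (2 * h))%:E)%E ->
  exists s : seq (R * R),
    (forall x, \sum_(p <- s) \1_(ivl p.1 p.2) x = \1_(ivl c h) x :> R) /\
    forall p, p \in s ->
    [/\ exists k : nat, p.2 = h / 2 ^+ k,
        (nint (fun x => G x * \1_(ivl p.1 p.2) x)%R <= (2 * lam * (2 * p.2))%:E)%E &
        p.2 = h / 2 ^+ n \/
        ((lam * (2 * p.2))%:E < nint (fun x => G x * \1_(ivl p.1 p.2) x)%R)%E].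
Proof.
move=> G0 mG; elim=> [|n IH] c h h0 Gh.
  exists [:: (c, h)]; split=> [x|p]; first by rewrite big_seq1.
  rewrite inE => /eqP ->/=; split=> //; first by exists 0%N; rewrite expr0 divr1.
  by left; rewrite expr0 divr1.
have [big|small] := ltP (lam * (2 * h))%:E (nint (fun x => G x * \1_(ivl c h) x)%R).
  exists [:: (c, h)]; split=> [x|p]; first by rewrite big_seq1.
  rewrite inE => /eqP ->/=; split=> //; first by exists 0%N; rewrite expr0 divr1.
  by right.
have h20 : 0 < h / 2 by rewrite divr_gt0.
have mI c' h' : measurable_fun setT (\1_(ivl c' h') : R -> R).
  by apply: measurable_indic; exact: measurable_ivl.
(* A parent with mean at most [lam] has halves with mean at most [2 * lam]: the mass cannot grow
   while the length halves. This is the factor 2 in the upper bound. *)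
have half c' : (forall x, \1_(ivl c' (h / 2)) x <= \1_(ivl c h) x :> R) ->
    (nint (fun x => G x * \1_(ivl c' (h / 2)) x)%R <= (2 * lam * (2 * (h / 2)))%:E)%E.
  move=> le; apply: (@le_trans _ _ (nint (fun x => G x * \1_(ivl c h) x)%R)).
    by apply: nint_le => x; rewrite ?mulr_ge0// ler_wpM2l.
  by apply: (le_trans small); rewrite lee_fin; lra.
have [|s1 [s1c s1p]] := IH (c - h / 2) (h / 2) h20.
  by apply: half => x; rewrite -(indic_ivl_half c x (ltW h0)) lerDl.
have [|s2 [s2c s2p]] := IH (c + h / 2) (h / 2) h20.
  by apply: half => x; rewrite -(indic_ivl_half c x (ltW h0)) lerDr.
have e k : h / 2 / 2 ^+ k = h / 2 ^+ k.+1.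
  by rewrite exprS invfM mulrA.
exists (s1 ++ s2); split=> [x|p].
  by rewrite big_cat/= s1c s2c indic_ivl_half// ltW.
have up q : [/\ exists k : nat, q.2 = h / 2 / 2 ^+ k,
     (nint (fun x => G x * \1_(ivl q.1 q.2) x)%R <= (2 * lam * (2 * q.2))%:E)%E &
     q.2 = h / 2 / 2 ^+ n \/
     ((lam * (2 * q.2))%:E < nint (fun x => G x * \1_(ivl q.1 q.2) x)%R)%E] ->
   [/\ exists k : nat, q.2 = h / 2 ^+ k,
     (nint (fun x => G x * \1_(ivl q.1 q.2) x)%R <= (2 * lam * (2 * q.2))%:E)%E &
     q.2 = h / 2 ^+ n.+1 \/
     ((lam * (2 * q.2))%:E < nint (fun x => G x * \1_(ivl q.1 q.2) x)%R)%E].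
  by move=> [[k qk] ? qn]; split=> //; [exists k.+1; rewrite qk e|rewrite -e].
by rewrite mem_cat => /orP[/s1p|/s2p]; exact: up.
Qed.

End StoppingTime.

Section BoundedSupp.
Context {R : realType}.
Local Notation mu := (@lebesgue_measure R).
Implicit Types f g : R -> R.

Lemma bounded_suppD f g : bounded_supp f -> bounded_supp g -> bounded_supp (fun x => f x + g x).
Proof.
move=> [mf [M fM]] [mg [N gN]]; split; first by meas.
have M0 : 0 <= M := le_trans (normr_ge0 _) (fM 0).1.
have N0 : 0 <= N := le_trans (normr_ge0 _) (gN 0).1.
exists (M + N) => x; split.
  by apply: (le_trans (ler_normD _ _)); rewrite lerD ?(fM x).1 ?(gN x).1.
by move=> MN; rewrite (fM x).2 ?(gN x).2 ?addr0//; lra.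
Qed.

Lemma bounded_suppZ k f : bounded_supp f -> bounded_supp (fun x => k * f x).
Proof.
move=> [mf [M fM]]; split; first by meas.
have M0 : 0 <= M := le_trans (normr_ge0 _) (fM 0).1.
exists (`|k| * M + M) => x; split.
  by rewrite normrM (@le_trans _ _ (`|k| * M))// ?ler_wpM2l ?(fM x).1// lerDl.
move=> MN; rewrite (fM x).2 ?mulr0//; apply: le_lt_trans MN.
by rewrite lerDr mulr_ge0.
Qed.

Lemma bounded_suppM f g : bounded_supp f -> measurable_fun setT g ->
  (exists B, bounded_by B g) -> bounded_supp (fun x => f x * g x).
Proof.
move=> [mf [M fM]] mg [B gB]; split; first by meas.
have M0 : 0 <= M := le_trans (normr_ge0 _) (fM 0).1.
have B0 : 0 <= B := le_trans (normr_ge0 _) (gB 0).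
exists (M * B + M) => x; split.
  by rewrite normrM (@le_trans _ _ (M * B)) ?lerDl// ler_pM// ?(fM x).1.
move=> MN; rewrite (fM x).2 ?mul0r//; apply: le_lt_trans MN.
by rewrite lerDr mulr_ge0.
Qed.

Lemma bounded_supp_indic_ivl (c h : R) : bounded_supp (\1_(ivl c h)).
Proof.
split; first by apply: measurable_indic; exact: measurable_ivl.
exists (`|c| + `|h| + 1) => x; split.
  by rewrite indicE; case: (_ \in _); rewrite ?normr1 ?normr0; have := normr_ge0 c; have := normr_ge0 h; lra.
move=> lt; rewrite indicE; case: (boolP (x \in _)) => //.
rewrite inE /ivl/= in_itv/= => /andP[a b]; exfalso.
have := ler_norm c; have := ler_norm (- c); have := ler_norm h; have := ler_norm (- h).
rewrite !normrN; move: lt; have [x0|x0] := ger0P x; lra.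
Qed.

Lemma bounded_supp_sum (T : Type) (s : seq T) (F : T -> R -> R) :
  (forall i, bounded_supp (F i)) -> bounded_supp (fun x => \sum_(i <- s) F i x).
Proof.
move=> H; elim: s => [|i s IH].
  under [X in bounded_supp X]eq_fun do rewrite big_nil.
  split; first by meas.
  by exists 0 => x; rewrite normr0.
under [X in bounded_supp X]eq_fun do rewrite big_cons.
exact: bounded_suppD.
Qed.

End BoundedSupp.

(** * The weak type (1, 1) bound *)

Section WeakType.
Context {R : realType} {I J : finType}.
Local Notation mu := (@lebesgue_measure R).
Variable K : J -> I -> R -> R.

Definition tconv (g : I -> R -> R) (j : J) (x : R) : R := \sum_i conv (g i) (K j i) x.

(** The entries are summed in absolute value, which dominates the operator norm of the matrix. For
    dilates at lacunary scales this larger quantity is already under control, and it treats the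
    analysis operator (one column) and the synthesis operator (one row) alike. *)
Definition osc (c y x : R) : R := \sum_(q : J * I) `|K q.1 q.2 (x - y) - K q.1 q.2 (x - c)|.

Lemma conv_mean_zero (g k : R -> R) (c x B : R) : L1 g -> measurable_fun setT k ->
  bounded_by B k -> \int[mu]_y g y = 0 ->
  conv g k x = \int[mu]_y (g y * (k (x - y) - k (x - c))).
Proof.
move=> gL mk kB g0.
under [RHS]eq_Rintegral do rewrite mulrBr.
rewrite RintegralB//; last 2 first.
- by apply/L1_integrable; exact: (L1_conv_integrand _ gL mk kB).
- apply/L1_integrable; have := L1_conv_integrand 0 gL (measurable_cst (k (x - c))).
  by move=> /(_ `|k (x - c)|); apply => y.
rewrite RintegralZr//; last exact/L1_integrable.
by rewrite g0 mul0r subr0.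
Qed.

Hypothesis kK : forall j i, kernel (K j i).

Let mK j i : measurable_fun setT (K j i). Proof. exact: kernel_meas. Qed.

Lemma osc_ge0 c y x : 0 <= osc c y x.
Proof. exact: sumr_ge0. Qed.

Lemma measurable_osc c : measurable_fun setT (fun z : R * R => osc c z.2 z.1).
Proof.
rewrite /osc; apply: measurable_sum => q.
have mq := mK q.1 q.2; by meas.
Qed.

Lemma le_sum_conv (b : I -> R -> R) (beta : R -> R) (c x : R) :
  (forall i, L1 (b i)) -> (forall i, \int[mu]_y b i y = 0) ->
  (forall i y, `|b i y| <= beta y) -> measurable_fun setT beta -> (forall y, 0 <= beta y) ->
  ((\sum_(q : J * I) `|conv (b q.2) (K q.1 q.2) x|)%R%:E <=
   nint (fun y => beta y * osc c y x)%R)%E.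
Proof.
move=> bL b0 bb mbeta beta0.
rewrite -sumEFin /osc; under eq_nint do rewrite mulr_sumr.
rewrite nint_sum; last 2 first.
- by move=> q; have mq := mK q.1 q.2; meas.
- by move=> q y; rewrite mulr_ge0.
apply: lee_sum => q _.
have [_ [_ [B KB]]] := kK q.1 q.2; have mq := mK q.1 q.2.
have [mb _] := bL q.2.
rewrite (conv_mean_zero c x (bL q.2) mq KB (b0 _)).
apply: (le_trans (le_normr_Rint _)); first by meas.
by apply: nint_le => y //; rewrite normrM ler_wpM2r.
Qed.

(** Mean zero lets [K (x - y)] be replaced by [K (x - y) - K (x - c)]. After Tonelli, each [y] in
    the support of [beta] contributes [beta y] times an oscillation integral off [E], which is at
    most [B1]. *)
Lemma bad_interval (b : I -> R -> R) (beta : R -> R) (E : set R) (c h B1 : R) :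
  measurable E -> (forall i, L1 (b i)) -> (forall i, \int[mu]_y b i y = 0) ->
  (forall i y, `|b i y| <= beta y) -> measurable_fun setT beta -> (forall y, 0 <= beta y) ->
  (forall y, h < `|y - c| -> beta y = 0) -> 0 <= B1 ->
  (forall y, `|y - c| <= h ->
     (nint (fun x => \1_(~` E) x * osc c y x)%R <= B1%:E)%E) ->
  (nint (fun x => \1_(~` E) x * \sum_(q : J * I) `|conv (b q.2) (K q.1 q.2) x|)%R
   <= B1%:E * nint beta)%E.
Proof.
move=> mE bL b0 bb mbeta beta0 betac B10 H.
have mI : measurable_fun setT (\1_(~` E) : R -> R).
  by apply: measurable_indic; exact: measurableC.
have I0 x : 0 <= \1_(~` E) x :> R by rewrite indicE.
pose F (z : R * R) := \1_(~` E) z.1 * (beta z.2 * osc c z.2 z.1).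
have mo := measurable_osc c.
have mF : measurable_fun setT F.
  rewrite /F; apply: measurable_funM.
    apply: (measurableT_comp mI); meas.
  by apply: measurable_funM => //; meas.
have F0 z : 0 <= F z by rewrite /F !mulr_ge0// osc_ge0.
apply: (@le_trans _ _ (\int[mu]_x nint (fun y => F (x, y)))%E).
  apply: ge0_le_integral_nomeas => x.
    by rewrite lee_fin mulr_ge0// sumr_ge0.
  have moy : measurable_fun setT (osc c ^~ x).
    by rewrite /osc; apply: measurable_sum => q; have mq := mK q.1 q.2; meas.
  rewrite /F /= nintZ//; last 2 first.
  - by meas.
  - by move=> y; rewrite mulr_ge0// osc_ge0.
  by rewrite EFinM lee_wpmul2l ?lee_fin//; exact: le_sum_conv.
rewrite nint_tonelli// -nintZ//; apply: ge0_le_integral_nomeas => y.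
  exact: nint_ge0.
have mox : measurable_fun setT (osc c y).
  by rewrite /osc; apply: measurable_sum => q; have mq := mK q.1 q.2; meas.
rewrite /F /=.
have [yc|yc] := leP `|y - c| h; last first.
  rewrite (betac _ yc) mulr0 /nint.
  by under eq_integral do rewrite mul0r mulr0; rewrite integral0.
under eq_nint do rewrite mulrCA.
rewrite nintZ//; last 2 first.
- by meas.
- by move=> x; rewrite mulr_ge0// osc_ge0.
rewrite mulrC EFinM lee_wpmul2l ?lee_fin//; exact: H.
Qed.

(** Minkowski's inequality for the integral [v] of a vector-valued function: pairing [v] with itself
    and applying Cauchy-Schwarz under the integral gives
    [vnorm v ^+ 2 <= vnorm v * \int vnorm f]. *)
Lemma sum_sqr_Rint (f : I -> R -> R) : (forall i, L1 (f i)) ->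
  L1 (fun x => vnorm (f ^~ x)) ->
  \sum_i (\int[mu]_x f i x) ^+ 2 <= (\int[mu]_x vnorm (f ^~ x)) ^+ 2.
Proof.
move=> fL vL.
pose v i := \int[mu]_x f i x; rewrite -/v.
have E : vnorm v ^+ 2 <= vnorm v * \int[mu]_x vnorm (f ^~ x).
  rewrite sqr_vnorm -RintegralZl//; last exact/L1_integrable.
  have -> : \sum_i v i ^+ 2 = \int[mu]_x \sum_i v i * f i x.
    rewrite Rint_sum; last by move=> i; exact: L1Z.
    apply: eq_bigr => i _; rewrite RintegralZl//; exact/L1_integrable.
  apply: le_Rintegral => //.
  - apply/L1_integrable.
    by apply: L1_sum => i; exact: L1Z.
  - by apply/L1_integrable; exact: L1Z.
  - by move=> x _; exact: vnorm_cs.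
rewrite -sqr_vnorm.
have [v0|v0] := eqVneq (vnorm v) 0; first by rewrite v0 expr0n/= sqr_ge0.
have V : 0 < vnorm v by rewrite lt_def v0 vnorm_ge0.
have E' : vnorm v <= \int[mu]_x vnorm (f ^~ x) by rewrite -(ler_pM2l V) -expr2.
by rewrite lerXn2r// nnegrE ?(le_trans _ E') ?vnorm_ge0.
Qed.


Lemma bounded_supp_dom (f F : R -> R) : measurable_fun setT f ->
  (forall x, `|f x| <= `|F x|) -> bounded_supp F -> bounded_supp f.
Proof.
move=> mf fF [mF [M FM]]; split=> //; exists M => x; split.
  exact: le_trans (fF x) (FM x).1.
move=> Mx; apply/eqP; rewrite -normr_le0; apply: le_trans (fF x) _.
by rewrite (FM x).2// normr0.
Qed.

Lemma bounded_supp_vnorm (g : I -> R -> R) : (forall i, bounded_supp (g i)) ->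
  bounded_supp (fun x => vnorm (g ^~ x)).
Proof.
move=> gb; have mg i : measurable_fun setT (g i) by case: (gb i).
apply: (@bounded_supp_dom _ (fun x => \sum_i `|g i x|)).
- exact: measurable_vnorm.
- move=> x; rewrite ger0_norm ?vnorm_ge0// ger0_norm ?sumr_ge0//.
  exact: vnorm_le_sum.
- apply: bounded_supp_sum => i; apply: bounded_supp_dom (gb i).
    by have := mg i => ?; meas.
  by move=> x; rewrite normr_id.
Qed.

Lemma bounded_supp_L1 (f : R -> R) : bounded_supp f -> L1 f.
Proof. by move=> /bounded_supp_L1Linf[]. Qed.

(** Jensen's inequality for weights of total mass at most one, read off from the nonnegative
    weighted variance of [c] about its weighted sum [m]. The weights will be the indicators of
    disjoint intervals at a point. *)
Lemma sqr_weighted_sum (T : Type) (s : seq T) (c w : T -> R) :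
  (forall p, 0 <= w p) -> \sum_(p <- s) w p <= 1 ->
  (\sum_(p <- s) c p * w p) ^+ 2 <= \sum_(p <- s) c p ^+ 2 * w p.
Proof.
move=> w0 w1.
have E (m : R) : \sum_(p <- s) (c p - m) ^+ 2 * w p =
    \sum_(p <- s) c p ^+ 2 * w p - 2 * m * (\sum_(p <- s) c p * w p) +
    m ^+ 2 * \sum_(p <- s) w p.
  by rewrite !mulr_sumr -sumrB -big_split/=; apply: eq_bigr => p _; ring.
set m := \sum_(p <- s) c p * w p.
have : 0 <= \sum_(p <- s) (c p - m) ^+ 2 * w p.
  by apply: sumr_ge0 => p _; rewrite mulr_ge0 ?sqr_ge0.
rewrite E -/m.
have : m ^+ 2 * \sum_(p <- s) w p <= m ^+ 2 by rewrite ler_piMr ?sqr_ge0.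
by rewrite !expr2; lra.
Qed.

Lemma indic_ge0 (A : set R) (x : R) : 0 <= \1_A x :> R.
Proof. by rewrite indicE. Qed.

Lemma nint_indic_ivl (c h : R) : 0 <= h -> nint (\1_(ivl c h)) = (2 * h)%:E.
Proof.
move=> h0; rewrite /nint integral_indic//; last exact: measurable_ivl.
transitivity (@lebesgue_measure R [set` `[c - h, c + h[]); first by rewrite setIT.
rewrite lebesgue_measure_itv/= lte_fin.
case: ifPn => [_|]; first by rewrite -EFinB; congr (_%:E); ring.
rewrite -leNgt => h1; congr (_%:E); lra.
Qed.

Lemma Rint_indic_ivl (c h : R) : 0 <= h -> \int[mu]_x (\1_(ivl c h) x) = 2 * h.
Proof.
move=> h0; have := nint_indic_ivl c h0.
by rewrite /Rintegral -/(nint _) => ->.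
Qed.

(** In the constant, [B2] comes from Chebyshev's inequality for the good part, whose squared [L^2]
    norm is at most [2 * lam] times the [L^1] norm of [g]; [1] from the doubled intervals that are
    cut out; [B1] from the bad part outside them. *)
Lemma weak_type (B1 B2 lam : R) (g : I -> R -> R) :
  0 <= B1 -> 0 <= B2 -> 0 < lam ->
  (forall f : I -> R -> R, (forall i, bounded_supp (f i)) ->
    (nint (fun x => \sum_j (tconv f j x) ^+ 2)%R <=
     B2%:E * nint (fun x => \sum_i (f i x) ^+ 2)%R)%E) ->
  (forall (N : int) (c y : R), `|y - c| <= 2 ^ N ->
    (nint (fun x => \1_(~` `[c - 2 * 2 ^ N, c + 2 * 2 ^ N]) x * osc c y x)%R <= B1%:E)%E) ->
  (exists2 delta : R, 0 < delta & forall c y : R, `|y - c| <= delta ->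
    (nint (osc c y) <= B1%:E)%E) ->
  (forall i, bounded_supp (g i)) ->
  (nint (fun x => lam * \1_[set x | 2 * lam < vnorm (tconv g ^~ x)] x)%R <=
   (2 * (B2 + 1 + B1))%:E * nint (fun x => vnorm (g ^~ x)))%E.
Proof.
move=> B10 B20 lam0 H2 H1 [delta delta0 H0] gb.
pose G x := vnorm (g ^~ x).
have Gb : bounded_supp G by exact: bounded_supp_vnorm.
have GL : L1 G by exact: bounded_supp_L1.
have G0 x : 0 <= G x by exact: vnorm_ge0.
have mG : measurable_fun setT G by case: GL.
have [_ [M GM]] := Gb.
pose Gt := \int[mu]_x G x.
have Gt0 : 0 <= Gt by apply: Rintegral_ge0.
(* The initial interval has half-length [2 ^+ N]: large enough to contain the support of [G] and to
   make the mean of [G] over it at most [lam / 2]. A power of two keeps all later half-lengths among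
   the dyadic scales of the Hoermander condition. *)
have [N hN] : exists N : nat, `|M| + Gt / lam < 2 ^+ N.
  by exists (Num.bound (`|M| + Gt / lam)); exact: upper_nthrootP.
pose h0 : R := 2 ^+ N.
have h00 : 0 < h0 by exact: exprn_gt0.
have Mh0 : M < h0.
  apply: le_lt_trans hN; apply: (le_trans (ler_norm M)).
  by rewrite lerDl divr_ge0// ltW.
have Gh0 : Gt <= lam * h0.
  by rewrite mulrC -ler_pdivrMr//; apply/ltW/(le_lt_trans _ hN); rewrite lerDr.
(* The depth of the bisection is chosen so that the shortest intervals have half-length at most
   [delta]. *)
have [n hn] : exists n : nat, h0 / delta < 2 ^+ n.
  by exists (Num.bound (h0 / delta)); exact: upper_nthrootP.
have hnd : h0 / 2 ^+ n <= delta.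
  by rewrite ler_pdivrMr ?exprn_gt0// mulrC -ler_pdivrMr// ltW.
have G1 x : G x * \1_(ivl 0 h0) x = G x.
  have [->|Gx] := eqVneq (G x) 0; first by rewrite mul0r.
  rewrite indicE mem_set ?mulr1// /ivl/= in_itv/= sub0r add0r.
  have xM : `|x| <= M by rewrite leNgt; apply: contra Gx => /(GM x).2 ->.
  move: xM; rewrite ler_norml => /andP[? ?]; apply/andP; split; lra.
have nG : nint G = Gt%:E by exact: nint_L1.
have [|s [sc sp]] := @stopping_intervals R G lam G0 mG n 0 h0 h00.
  rewrite (eq_nint G1) nG lee_fin; apply: (le_trans Gh0).
  have : 0 < lam * h0 by exact: mulr_gt0.
  by lra.
pose w (p : R * R) : R -> R := \1_(ivl p.1 p.2).
have mw p : measurable_fun setT (w p).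
  by apply: measurable_indic; exact: measurable_ivl.
have w0 p x : 0 <= w p x by rewrite /w indicE.
have wb p : bounded_supp (w p) by exact: bounded_supp_indic_ivl.
have w1 p : exists B, bounded_by B (w p).
  by exists 1 => x; rewrite /w indicE; case: (_ \in _); rewrite ?normr1 ?normr0.
have gwb i p : bounded_supp (fun y => g i y * w p y) by exact: bounded_suppM.
have Gwb p : bounded_supp (fun y => G y * w p y) by exact: bounded_suppM.
pose a p := \int[mu]_y (G y * w p y).
have a0 p : 0 <= a p by apply: Rintegral_ge0 => x _; rewrite mulr_ge0.
have na p : nint (fun y => G y * w p y)%R = (a p)%:E.
  by apply: nint_L1; [exact: bounded_supp_L1|move=> x; rewrite mulr_ge0].
have hp p : p \in s -> 0 < p.2.
  by move=> /sp[[k ->] _ _]; rewrite divr_gt0// exprn_gt0.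
have ap p : p \in s -> a p <= 2 * lam * (2 * p.2).
  by move=> /sp[_ + _]; rewrite -/(w p) na lee_fin.
(* [good] replaces [g] by its mean on each interval of [s], and [b p] is the
   rest.  On the intervals of the last generation the mean of [G] may be small
   and nothing is excised; the small-oscillation hypothesis takes over. *)
pose c p i := (2 * p.2)^-1 * \int[mu]_y (g i y * w p y).
pose b p i y := g i y * w p y + - c p i * w p y.
pose good i y := \sum_(p <- s) c p i * w p y.
pose beta p y := G y * w p y + a p / (2 * p.2) * w p y.
pose E p : set R := if p.2 == h0 / 2 ^+ n then set0 else `[p.1 - 2 * p.2, p.1 + 2 * p.2]%classic.
have mE p : measurable (E p) by rewrite /E; case: ifP.
have bb p i : bounded_supp (b p i).
  by apply: bounded_suppD => //; exact: bounded_suppZ.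
have goodb i : bounded_supp (good i).
  by apply: bounded_supp_sum => p; exact: bounded_suppZ.
have gdec i y : g i y = good i y + \sum_(p <- s) b p i y.
  rewrite -big_split/=.
  under eq_bigr do rewrite /b addrCA -mulrDl subrr mul0r addr0.
  rewrite -mulr_sumr sc.
  have [->|gx] := eqVneq (g i y) 0; first by rewrite mul0r.
  have := G1 y; rewrite -[RHS]mulr1 => /mulfI ->; first by rewrite mulr1.
  apply: contraNneq gx => Gy; rewrite -normr_le0 -Gy; exact: (ler_vnorm (g ^~ y)).
pose S p x := \sum_(q : J * I) `|conv (b p q.2) (K q.1 q.2) x|.
have mconv f j i : bounded_supp f -> measurable_fun setT (conv f (K j i)).
  move=> fb; have [cK [_ [B KB]]] := kK j i.
  by apply: continuous_measurable_fun; apply: (conv_continuous _ cK KB); exact: bounded_supp_L1.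
have mS p : measurable_fun setT (S p).
  by apply: measurable_sum => q; have := mconv (b p q.2) q.1 q.2 (bb _ _) => ?; meas.
have S0 p x : 0 <= S p x by exact: sumr_ge0.
have mt f j : (forall i, bounded_supp (f i)) -> measurable_fun setT (tconv f j).
  by move=> fb; apply: measurable_sum => i; exact: mconv.
have tdec j x : tconv g j x = tconv good j x + \sum_(p <- s) \sum_i conv (b p i) (K j i) x.
  rewrite exchange_big -big_split/=; apply: eq_bigr => i _.
  have [_ [_ [B KB]]] := kK j i.
  rewrite -(conv_sum s x _ (mK j i) KB); last by move=> p; exact: bounded_supp_L1.
  rewrite -(convD x _ _ (mK j i) KB); last 2 first.
  - exact: bounded_supp_L1.
  - by apply: L1_sum => p; exact: bounded_supp_L1.
  by congr (conv _ _ _); apply/funext => y; exact: gdec.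
have F1 p : p \in s ->
    (nint (fun x => \1_(~` E p) x * S p x)%R <= (B1 * (2 * a p))%:E)%E.
  move=> ps; have h := hp p ps; have h2 : 0 < 2 * p.2 by rewrite mulr_gt0.
  have nbeta : nint (beta p) = (2 * a p)%:E.
    rewrite /beta nintD; last 4 first.
    - by have [? _] := Gwb p.
    - by have := mw p => ?; meas.
    - by move=> x; rewrite mulr_ge0.
    - by move=> x; rewrite mulr_ge0// divr_ge0// ltW.
    rewrite na nintZ//; last by rewrite divr_ge0// ltW.
    rewrite nint_indic_ivl ?ltW// -EFinM -EFinD divfK ?lt0r_neq0//.
    by congr (_%:E); ring.
  rewrite EFinM -nbeta; apply: (@bad_interval _ _ (E p) p.1 p.2) => //.
  - by move=> i; exact: bounded_supp_L1.
  - move=> i; rewrite RintegralD//; last 2 first.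
    + by apply/L1_integrable; exact: bounded_supp_L1.
    + by apply/L1_integrable; apply: L1Z; exact: bounded_supp_L1.
    rewrite RintegralZl//; last by apply/L1_integrable; exact: bounded_supp_L1.
    rewrite Rint_indic_ivl ?ltW// /c mulNr mulrAC mulVf ?lt0r_neq0//.
    by rewrite mul1r subrr.
  - move=> i y; apply: (le_trans (ler_normD _ _)); rewrite /beta lerD//.
      by rewrite normrM (ger0_norm (w0 _ _)) ler_wpM2r// (ler_vnorm (g ^~ y)).
    rewrite normrM (ger0_norm (w0 _ _)) ler_wpM2r// normrN /c normrM mulrC.
    have h3 : 0 <= (2 * p.2)^-1 by rewrite invr_ge0 ltW.
    rewrite (ger0_norm h3); apply: ler_wpM2r => //.
    apply: (le_trans (le_normr_Rintegral _ _)) => //.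
      by apply/L1_integrable; exact: bounded_supp_L1.
    apply: le_Rintegral => //.
    + by apply: integrable_norm; apply/L1_integrable; exact: bounded_supp_L1.
    + by apply/L1_integrable; exact: bounded_supp_L1.
    + move=> x _; rewrite normrM (ger0_norm (w0 _ _)) ler_wpM2r//.
      exact: (ler_vnorm (g ^~ x)).
  - rewrite /beta; apply: measurable_funD; first by have [? _] := Gwb p.
    by have := mw p => ?; meas.
  - by move=> y; rewrite addr_ge0// mulr_ge0// divr_ge0// ltW.
  - move=> y yp; suff wy : w p y = 0 by rewrite /beta wy !mulr0 addr0.
    rewrite /w indicE; case: (boolP (y \in _)) => //.
    rewrite inE /ivl/= in_itv/= => /andP[y1 y2]; exfalso.
    by move: yp; rewrite ltNge ler_distl => /negP; apply; rewrite y1 ltW.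
  - move=> y yp; rewrite /E; case: ifP => [/eqP p2|_].
      under eq_nint do rewrite setC0 indicT mul1r.
      by apply: H0; apply: (le_trans yp); rewrite p2.
    have [[k p2] _ _] := sp p ps.
    have -> : p.2 = 2 ^ (N%:Z - k%:Z) by rewrite p2 expfzDr// -exprnP -exprnN.
    apply: H1; move: yp; rewrite p2 => /le_trans; apply.
    by rewrite expfzDr// -exprnP -exprnN.
have F2 p : p \in s -> (nint (fun x => lam * \1_(E p) x)%R <= (2 * a p)%:E)%E.
  move=> ps; have h := hp p ps; rewrite nintZ//; last exact: ltW.
  rewrite /E; case: ifPn => [_|p2].
    rewrite (eq_nint (g := fun=> 0%R)); last by move=> x; rewrite indic0.
    by rewrite /nint integral0 mule0 lee_fin mulr_ge0.
  have [_ _ []] := sp p ps; first by move/eqP; rewrite (negbTE p2).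
  rewrite -/(w p) na lte_fin nint_indic_itv => [lt|]; last by lra.
  by rewrite -EFinM lee_fin; lra.
have sa : \sum_(p <- s) a p = Gt.
  rewrite /a -Rint_sum; last by move=> p; exact: bounded_supp_L1.
  by apply: eq_Rintegral => x _; rewrite -mulr_sumr sc G1.
have F3 : (nint (fun x => \sum_i good i x ^+ 2)%R <= (2 * lam * Gt)%:E)%E.
  (* By Minkowski the vector of means has norm at most [a p / (2 * p.2)]; one of the two factors
     [a p] in its square is then absorbed by the stopping bound [ap]. *)
  have cs p : p \in s -> \sum_i c p i ^+ 2 * (2 * p.2) <= 2 * lam * a p.
    move=> ps; have h := hp p ps; have h2 : 0 < 2 * p.2 by rewrite mulr_gt0.
    rewrite -mulr_suml.
    apply: (@le_trans _ _ ((2 * p.2)^-1 * a p ^+ 2)).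
      rewrite (_ : \sum_i _ = (2 * p.2)^-1 ^+ 2 * \sum_i (\int[mu]_y (g i y * w p y)) ^+ 2).
        rewrite mulrAC (_ : (2 * p.2)^-1 ^+ 2 * (2 * p.2) = (2 * p.2)^-1); last first.
          by rewrite expr2 -mulrA mulVf ?mulr1// lt0r_neq0.
        apply: ler_wpM2l; first by rewrite invr_ge0 ltW.
        have E1 : (fun y => vnorm (fun i => g i y * w p y)) = (fun y => G y * w p y).
          apply/funext => y; rewrite /G /vnorm.
          under eq_bigr do rewrite exprMn.
          by rewrite -mulr_suml sqrtrM ?sumsq_ge0// sqrtr_sqr ger0_norm.
        have := @sum_sqr_Rint (fun i y => g i y * w p y); rewrite E1 -/(a p).
        by apply=> [i|]; exact: bounded_supp_L1.
      by rewrite mulr_sumr; apply: eq_bigr => i _; rewrite exprMn.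
    rewrite expr2 mulrA ler_wpM2r// mulrC ler_pdivrMr//.
    by rewrite (le_trans (ap p ps)).
  have mgd i : measurable_fun setT (good i) by case: (goodb i).
  apply: (@le_trans _ _ (nint (fun x => \sum_(p <- s) (\sum_i c p i ^+ 2) * w p x)%R)).
    apply: nint_le => x; first exact: sumsq_ge0.
    under [leRHS]eq_bigr do rewrite mulr_suml.
    rewrite exchange_big; apply: ler_sum => i _.
    by apply: sqr_weighted_sum => //; rewrite sc indicE; case: (_ \in _).
  rewrite nint_sum//; last 2 first.
  - by move=> p; have := mw p => ?; meas.
  - by move=> p x; rewrite mulr_ge0// sumsq_ge0.
  rewrite -sa mulr_sumr -sumEFin big_seq [leRHS]big_seq; apply: lee_sum => p ps.
  rewrite nintZ ?sumsq_ge0// nint_indic_ivl; last exact/ltW/hp.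
  rewrite -EFinM lee_fin mulr_suml.
  exact: cs.
(* Chebyshev's inequality in pointwise form. Where the left side is nonzero, either the good part
   exceeds [lam], or [x] lies in some [E p], or the bad sum exceeds [lam] with [x] outside all of
   them. *)
have pt x : lam * \1_[set x | 2 * lam < vnorm (tconv g ^~ x)] x <=
    lam^-1 * (\sum_j (tconv good j x) ^+ 2) +
    \sum_(p <- s) (lam * \1_(E p) x + \1_(~` E p) x * S p x).
  have sum0 (F : R * R -> R) : (forall p, 0 <= F p) -> 0 <= \sum_(p <- s) F p.
    by move=> F0; exact: sumr_ge0.
  have lam2 : 0 <= lam^-1 * \sum_j tconv good j x ^+ 2.
    by rewrite mulr_ge0 ?sumsq_ge0// invr_ge0 ltW.
  have T0 p : 0 <= lam * \1_(E p) x + \1_(~` E p) x * S p x.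
    by rewrite addr_ge0// mulr_ge0// ?indic_ge0// ltW.
  rewrite indicE; case: (boolP (x \in _)); last by rewrite mulr0 addr_ge0// sum0.
  rewrite inE/= mulr1 => big.
  have [gl|gl] := ltP lam (vnorm (tconv good ^~ x)).
    rewrite -[leLHS]addr0 lerD ?sum0// -sqr_vnorm mulrC ler_pdivlMr// -expr2.
    by rewrite lerXn2r// ?nnegrE ?vnorm_ge0// ltW.
  rewrite -[leLHS]add0r lerD//.
  have [/hasP[p ps /asboolP xE]|/hasPn nE] := boolP (has (fun p => `[< E p x >]) s).
    rewrite (big_rem p ps)/= -[leLHS]addr0; apply: lerD; last by apply: sumr_ge0 => *; exact: T0.
    by rewrite indicE mem_set// mulr1 lerDl mulr_ge0 ?indic_ge0.
  have bd : lam < \sum_(p <- s) S p x.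
    have := vnormD (tconv good ^~ x) (fun j => \sum_(p <- s) \sum_i conv (b p i) (K j i) x).
    have -> : (fun j => tconv good j x + \sum_(p <- s) \sum_i conv (b p i) (K j i) x) = tconv g ^~ x.
      by apply/funext => j; rewrite tdec.
    move=> tri.
    have : vnorm (fun j => \sum_(p <- s) \sum_i conv (b p i) (K j i) x) <= \sum_(p <- s) S p x.
      apply: (le_trans (vnorm_le_sum _)).
      apply: (@le_trans _ _ (\sum_j \sum_(p <- s) \sum_i `|conv (b p i) (K j i) x|)).
        apply: ler_sum => j _; apply: (le_trans (ler_norm_sum _ _ _)).
        by apply: ler_sum => p _; exact: ler_norm_sum.
      rewrite exchange_big/=; apply: ler_sum => p _.
      by rewrite pair_bigA.
    lra.
  apply/ltW/(lt_le_trans bd); rewrite big_seq [leRHS]big_seq; apply: ler_sum => p ps.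
  rewrite (_ : \1_(~` E p) x = 1) ?mul1r ?lerDr ?mulr_ge0 ?indic_ge0 ?ltW//.
  rewrite indicE mem_set//= => xE; have := nE p ps.
  by move=> /asboolP.
have mIE p : measurable_fun setT (\1_(E p) : R -> R) by exact: measurable_indic.
have mIC p : measurable_fun setT (\1_(~` E p) : R -> R).
  by apply: measurable_indic; exact: measurableC.
have T0 p x : 0 <= lam * \1_(E p) x + \1_(~` E p) x * S p x.
  by rewrite addr_ge0// mulr_ge0// ?ltW// indicE.
apply: (le_trans (nint_le _ pt)).
  by move=> x; rewrite mulr_ge0 ?indic_ge0// ltW.
have mtg j := mt good j goodb.
rewrite nintD; last 4 first.
- by meas.
- by meas.
- by move=> x; rewrite mulr_ge0 ?invr_ge0 ?(ltW lam0)// sumsq_ge0.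
- by move=> x; apply: sumr_ge0.
rewrite nintZ ?invr_ge0 ?(ltW lam0)//; last 2 first.
- by meas.
- by move=> x; exact: sumsq_ge0.
rewrite [X in (_ + X)%E]nint_sum; last 2 first.
- by move=> p; meas.
- exact: T0.
rewrite -/G nG -EFinM.
have -> : 2 * (B2 + 1 + B1) * Gt = lam^-1 * (B2 * (2 * lam * Gt)) +
    \sum_(p <- s) (2 * a p + B1 * (2 * a p)).
  rewrite big_split/= -!mulr_sumr sa; field; exact: lt0r_neq0.
rewrite EFinD leeD//.
  rewrite EFinM lee_wpmul2l ?lee_fin ?invr_ge0 ?(ltW lam0)//.
  by apply: (le_trans (H2 _ goodb)); rewrite EFinM lee_wpmul2l ?lee_fin.
rewrite -sumEFin big_seq [leRHS]big_seq; apply: lee_sum => p ps.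
rewrite nintD; last 4 first.
- by meas.
- by meas.
- by move=> x; rewrite mulr_ge0 ?indic_ge0// ltW.
- by move=> x; rewrite mulr_ge0 ?indic_ge0.
by rewrite EFinD leeD ?F1 ?F2.
Qed.

End WeakType.

(** * Geometric sums over dyadic levels *)

Section Geometric.
Context {R : realType}.
Implicit Types (t G r : R).

Lemma le_powR r (x y : R) : 0 <= r -> 0 <= x -> x <= y -> x `^ r <= y `^ r.
Proof. by move=> r0 x0 xy; apply: ge0_ler_powR; rewrite ?nnegrE// (le_trans x0). Qed.

(** The sum of the series of [2 ^ (- r k)] over [k >= 0]; it is used through the fixed-point
    equation in [geom_cst_spec]. *)
Definition geom_cst r : R := (1 - (2 `^ r)^-1)^-1.

Lemma geom_cst_spec r : 0 < r -> 0 < geom_cst r /\ geom_cst r = 1 + (2 `^ r)^-1 * geom_cst r.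
Proof.
move=> r0; have h : 1 < (2 : R) `^ r.
  have := @gt0_ltr_powR R r r0 1 2; rewrite powR1; apply; rewrite ?nnegrE// ?ltr1n//.
have h1 : (2 `^ r : R)^-1 < 1 by rewrite invf_lt1// (lt_trans ltr01).
have h2 : 1 - (2 `^ r)^-1 != 0 :> R by rewrite subr_eq0 gt_eqF.
have h3 : (2 `^ r) != 0 :> R by rewrite gt_eqF// (lt_trans ltr01).
split; first by rewrite invr_gt0 subr_gt0.
rewrite /geom_cst; field; rewrite h3 /=.
by rewrite subr_eq0 gt_eqF.
Qed.

Lemma powR_double r u : 0 <= u -> (2 * u) `^ r = 2 `^ r * u `^ r.
Proof. by move=> u0; rewrite powRM. Qed.

Lemma geom_sum_up r G n t : 0 < r -> 0 < G -> 0 < t ->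
  \sum_(i < n) ((t * 2 ^+ i) `^ r)^-1 * (G <= t * 2 ^+ i)%R%:R <= geom_cst r * (G `^ r)^-1.
Proof.
move=> r0 G0; have [c0 cE] := geom_cst_spec r0.
(* With [Num.max G t] in place of [G] the bound survives the removal of the first term, which turns
   [t] into [2 * t]; the fixed-point equation of [geom_cst] absorbs that term. *)
suff H : forall t, 0 < t ->
    \sum_(i < n) ((t * 2 ^+ i) `^ r)^-1 * (G <= t * 2 ^+ i)%R%:R <=
    geom_cst r * ((Num.max G t) `^ r)^-1.
  move=> t0; apply: (le_trans (H t t0)); rewrite ler_pM2l//.
  rewrite lef_pV2 ?posrE ?powR_gt0 ?lt_max ?G0//.
  by apply: le_powR; rewrite ?(ltW r0) ?(ltW G0)// le_max lexx.
elim: n => [|n IH] {}t t0.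
  by rewrite big_ord0; apply: mulr_ge0; [exact: ltW|rewrite invr_ge0 powR_ge0].
rewrite big_ord_recl expr0 mulr1.
have -> : \sum_(i < n) ((t * 2 ^+ lift ord0 i) `^ r)^-1 * (G <= t * 2 ^+ lift ord0 i)%R%:R =
    \sum_(i < n) (((2 * t) * 2 ^+ i) `^ r)^-1 * (G <= (2 * t) * 2 ^+ i)%R%:R.
  by apply: eq_bigr => i _; rewrite /= exprS mulrCA mulrA.
have t20 : 0 < 2 * t by rewrite mulr_gt0.
have := IH _ t20; have [Gt|Gt] := leP G t => S.
  rewrite mulr1; move: S; rewrite max_r; last by lra.
  rewrite (powR_double r (ltW t0)) invfM => S.
  by rewrite [leRHS](_ : _ = (t `^ r)^-1 + geom_cst r * ((2 `^ r)^-1 * (t `^ r)^-1)) ?lerD2l// {1}cE; ring.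
rewrite mulr0 add0r; apply: (le_trans S).
rewrite ler_pM2l// lef_pV2 ?posrE ?powR_gt0 ?lt_max ?G0//.
by apply: le_powR; rewrite ?(ltW r0) ?(ltW G0)// le_max lexx.
Qed.

Lemma geom_sum_down r G n t : 0 < r -> 0 < G -> 0 < t ->
  \sum_(i < n) (t * 2 ^+ i) `^ r * (t * 2 ^+ i < G)%R%:R <= geom_cst r * G `^ r.
Proof.
move=> r0 G0 t0; have [c0 cE] := geom_cst_spec r0.
pose d := (2 `^ r)^-1 * geom_cst r; have d0 : 0 < d by rewrite mulr_gt0// invr_gt0 powR_gt0.
have dE : d * 2 `^ r = geom_cst r by rewrite /d mulrAC mulVf ?mul1r// gt_eqF ?powR_gt0.
suff H : \sum_(i < n) (t * 2 ^+ i) `^ r * (t * 2 ^+ i < G)%R%:R <=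
    d * (Num.min (2 * G) (t * 2 ^+ n)) `^ r.
  apply: (le_trans H); rewrite (_ : geom_cst r * G `^ r = d * (2 * G) `^ r); last first.
    by rewrite powR_double ?(ltW G0)// mulrA dE.
  apply: ler_wpM2l; first exact: ltW.
  apply: le_powR; first exact: ltW.
    by rewrite le_min !mulr_ge0 ?exprn_ge0 ?(ltW G0) ?(ltW t0).
  by rewrite ge_min lexx.
have e2 k : 0 < t * 2 ^+ k by rewrite mulr_gt0// exprn_gt0.
elim: n => [|n IH].
  by rewrite big_ord0; apply: mulr_ge0; [exact: ltW|exact: powR_ge0].
rewrite big_ord_recr/=; have := e2 n; set u := t * 2 ^+ n => u0.
have -> : t * 2 ^+ n.+1 = 2 * u by rewrite exprS mulrCA.
have [uG|uG] := ltP u G.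
  rewrite mulr1 min_r; last by lra.
  apply: (@le_trans _ _ (d * u `^ r + u `^ r)).
    rewrite lerD2r; apply: (le_trans IH); rewrite ler_pM2l//.
    apply: le_powR; first exact: ltW.
      by rewrite le_min (ltW u0) mulr_ge0// ltW.
    by rewrite ge_min lexx orbT.
  by rewrite powR_double ?(ltW u0)// mulrA dE cE -/d mulrDl mul1r addrC.
rewrite mulr0 addr0; apply: (le_trans IH); rewrite ler_pM2l//.
apply: le_powR; first exact: ltW.
  by rewrite le_min (ltW u0) mulr_ge0// ltW.
by rewrite -/u le_min !ge_min lexx/=; apply/orP; right; lra.
Qed.

Lemma dyadic_level (t h : R) n : t < h -> h <= t * 2 ^+ n ->
  exists2 i : 'I_n, t * 2 ^+ i < h & h <= 2 * (t * 2 ^+ i).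
Proof.
move=> th; elim: n => [|n IH]; first by rewrite expr0 mulr1 leNgt th.
rewrite exprS mulrCA => hn.
have [/IH[i ti hi]|nh] := leP h (t * 2 ^+ n).
  by exists (widen_ord (leqnSn n) i).
by exists ord_max.
Qed.

End Geometric.

(** * Interpolation between the weak type (1, 1) and the [L^2] bound *)

Section StrongType.
Context {R : realType} {I J : finType}.
Local Notation mu := (@lebesgue_measure R).
Variable K : J -> I -> R -> R.

(* The three quantitative hypotheses are the [L^2] bound, Hoermander's
   condition at dyadic scales, and a smallness condition at tiny scales that
   makes up for stopping the bisection after finitely many steps. *)
Definition calderon_zygmund (B1 B2 : R) : Prop :=
  [/\ forall j i, kernel (K j i),
      0 <= B1 /\ 0 <= B2,
      forall f : I -> R -> R, (forall i, bounded_supp (f i)) ->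
        (nint (fun x => \sum_j (tconv K f j x) ^+ 2)%R <=
         B2%:E * nint (fun x => \sum_i (f i x) ^+ 2)%R)%E,
      forall (N : int) (c y : R), `|y - c| <= 2 ^ N ->
        (nint (fun x => \1_(~` `[c - 2 * 2 ^ N, c + 2 * 2 ^ N]) x * osc K c y x)%R
         <= B1%:E)%E &
      exists2 delta : R, 0 < delta & forall c y : R, `|y - c| <= delta ->
        (nint (osc K c y) <= B1%:E)%E].

Variables B1 B2 : R.
Hypothesis cz : calderon_zygmund B1 B2.
Variable g : I -> R -> R.
Hypothesis gb : forall i, bounded_supp (g i).

Let G x := vnorm (g ^~ x).
Let h x := vnorm (tconv K g ^~ x).
Let W := B2 + 1 + B1.

Let mconv f j i : bounded_supp f -> measurable_fun setT (conv f (K j i)).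
Proof.
case: cz => kK _ _ _ _ fb; have [cK [_ [B KB]]] := kK j i.
apply: continuous_measurable_fun; apply: (conv_continuous _ cK KB).
exact: bounded_supp_L1.
Qed.

Lemma measurable_tconv f j : (forall i, bounded_supp (f i)) ->
  measurable_fun setT (tconv K f j).
Proof. by move=> fb; apply: measurable_sum => i; exact: mconv. Qed.

Lemma measurable_set_gt (f : R -> R) (a : R) : measurable_fun setT f ->
  measurable [set x | a < f x].
Proof.
move=> mf; rewrite -preimage_itvoy -[X in measurable X]setTI.
by apply: mf => //; exact: measurable_itv.
Qed.

Lemma tconvD (f1 f2 : I -> R -> R) j x :
  (forall i, bounded_supp (f1 i)) -> (forall i, bounded_supp (f2 i)) ->
  tconv K (fun i y => f1 i y + f2 i y) j x = tconv K f1 j x + tconv K f2 j x.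
Proof.
case: cz => kK _ _ _ _ b1 b2; rewrite /tconv -big_split/=; apply: eq_bigr => i _.
have [_ [_ [B KB]]] := kK j i.
by apply: (convD x _ _ _ KB); [exact: bounded_supp_L1|exact: bounded_supp_L1|exact: kernel_meas].
Qed.

Let mG : measurable_fun setT G.
Proof. by apply: measurable_vnorm => i; case: (gb i). Qed.

Let mh : measurable_fun setT h.
Proof. by apply: measurable_vnorm => j; exact: measurable_tconv. Qed.

Let lo (lam x : R) : R := (G x <= lam)%R%:R.
Let hi (lam x : R) : R := (lam < G x)%R%:R.

Let hiE lam : hi lam = \1_[set x | lam < G x].
Proof.
apply/funext => x; rewrite /hi indicE; congr ((nat_of_bool _)%:R).
by apply/idP/idP; rewrite inE.
Qed.

Let loE lam x : lo lam x = 1 - hi lam x.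
Proof. by rewrite /lo /hi; case: ltP; rewrite ?subrr ?subr0. Qed.

Let mhi lam : measurable_fun setT (hi lam).
Proof. by rewrite hiE; apply: measurable_indic; exact: measurable_set_gt. Qed.

Let mlo lam : measurable_fun setT (lo lam).
Proof.
rewrite (_ : lo lam = fun x => 1 - hi lam x); last by apply/funext => x; rewrite loE.
by have := mhi lam => ?; meas.
Qed.

Let b1of (b : bool) : `|b%:R : R| <= 1.
Proof. by case: b; rewrite ?normr1 ?normr0. Qed.

(** Where [h] exceeds [4 * lam], the image of the part of [g] below height [lam] or that of the part
    above exceeds [2 * lam]. Chebyshev with the [L^2] bound handles the low part and [weak_type] the
    high part. *)
Lemma weak_type_split (lam : R) : 0 < lam ->
  (nint (fun x => \1_[set x | 4 * lam < h x] x)%R <=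
   nint (fun x => W * ((lam ^+ 2)^-1 * (G x ^+ 2 * lo lam x) +
                       2 * (lam^-1 * (G x * hi lam x))))%R)%E.
Proof.
move=> lam0; case: (cz) => kK [B10 B20] H2 H1 H0.
pose g1 i x := g i x * lo lam x; pose g2 i x := g i x * hi lam x.
have b1 i : bounded_supp (g1 i).
  by apply: bounded_suppM => //; exists 1 => x; exact: b1of.
have b2 i : bounded_supp (g2 i).
  by apply: bounded_suppM => //; exists 1 => x; exact: b1of.
have gE : g = fun i y => g1 i y + g2 i y.
  by apply/funext => i; apply/funext => y; rewrite /g1 /g2 loE; ring.
have m1 j := measurable_tconv j b1.
have m2 j := measurable_tconv j b2.
pose h1 x := vnorm (tconv K g1 ^~ x); pose h2 x := vnorm (tconv K g2 ^~ x).
have mh2 : measurable_fun setT h2 by exact: measurable_vnorm.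
have mI2 : measurable_fun setT (\1_[set x | 2 * lam < h2 x] : R -> R).
  by apply: measurable_indic; exact: measurable_set_gt.
have l2 : 0 <= (4 * lam ^+ 2)^-1 by rewrite invr_ge0 mulr_ge0 ?sqr_ge0.
have iT (A : set R) (x : R) : 0 <= \1_A x :> R by exact: indic_ge0.
apply: (@le_trans _ _ (nint (fun x => (4 * lam ^+ 2)^-1 * (\sum_j (tconv K g1 j x) ^+ 2) +
    \1_[set x | 2 * lam < h2 x] x)%R)).
  apply: nint_le => x; first exact: indic_ge0.
  rewrite indicE; case: (boolP (x \in _)); last first.
    by rewrite addr_ge0// mulr_ge0 ?sumsq_ge0.
  rewrite inE/= => hx.
  have [h2x|h2x] := ltP (2 * lam) (h2 x).
    by rewrite indicE mem_set//= lerDr mulr_ge0// sumsq_ge0.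
  rewrite -[leLHS]addr0 lerD// -sqr_vnorm -/(h1 x) mulrC ler_pdivlMr; last first.
    by rewrite mulr_gt0// exprn_gt0.
  rewrite mul1r (_ : 4 * lam ^+ 2 = (2 * lam) ^+ 2); last by ring.
  have h1x : 2 * lam < h1 x.
    have := vnormD (tconv K g1 ^~ x) (tconv K g2 ^~ x).
    rewrite (_ : (fun j => _) = tconv K g ^~ x); last first.
      by apply/funext => j; rewrite [in RHS]gE tconvD.
    rewrite -/(h1 x) -/(h2 x) -/(h x); lra.
  rewrite lerXn2r ?nnegrE ?mulr_ge0 ?vnorm_ge0//; first exact: ltW.
  exact: ltW.
rewrite nintD//; last 2 first.
- by meas.
- by move=> x; rewrite mulr_ge0// sumsq_ge0.
rewrite nintZ//; last 2 first.
- by meas.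
- by move=> x; exact: sumsq_ge0.
have G0 x : 0 <= G x by exact: vnorm_ge0.
have lo0 x : 0 <= lo lam x by rewrite /lo.
have hi0 x : 0 <= hi lam x by rewrite /hi.
have W0 : 0 <= W by rewrite /W; lra.
have ml := mlo lam; have mhl := mhi lam.
have lam2 : 0 <= (lam ^+ 2)^-1 by rewrite invr_ge0 sqr_ge0.
have lam1 : 0 <= lam^-1 by rewrite invr_ge0 ltW.
under [leRHS]eq_nint do rewrite mulrDr.
rewrite nintD; last 4 first.
- by meas.
- by meas.
- by move=> x; rewrite !mulr_ge0// sqr_ge0.
- by move=> x; rewrite !mulr_ge0.
apply: leeD.
  have V1 x : \sum_i g1 i x ^+ 2 = G x ^+ 2 * lo lam x.
    rewrite /G sqr_vnorm mulr_suml; apply: eq_bigr => i _.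
    by rewrite /g1 exprMn /lo; case: (_ <= _)%R; rewrite ?expr1n ?expr0n.
  have mGl : measurable_fun setT (fun x => G x ^+ 2 * lo lam x) by meas.
  have Gl0 x : 0 <= G x ^+ 2 * lo lam x by rewrite mulr_ge0 ?sqr_ge0.
  apply: (@le_trans _ _ ((4 * lam ^+ 2)^-1%:E * (B2%:E * nint (fun x => G x ^+ 2 * lo lam x)%R))%E).
    rewrite lee_wpmul2l ?lee_fin//; apply: (le_trans (H2 _ b1)).
    by rewrite (eq_nint V1).
  rewrite muleA -EFinM -nintZ ?mulr_ge0//; apply: nint_le => x.
    by rewrite !mulr_ge0.
  rewrite [leRHS]mulrA; apply: ler_wpM2r => //.
  rewrite invfM mulrC mulrA; apply: ler_wpM2r => //.
  by rewrite /W; lra.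
have V2 x : vnorm (g2 ^~ x) = G x * hi lam x.
  rewrite /G /vnorm /g2; under eq_bigr do rewrite exprMn.
  by rewrite -mulr_suml sqrtrM ?sumsq_ge0// sqrtr_sqr ger0_norm.
have := weak_type kK B10 B20 lam0 H2 H1 H0 b2.
rewrite nintZ ?(ltW lam0)//.
rewrite (eq_nint V2) -/W => wt.
rewrite [leRHS](eq_nint (g := fun x => lam^-1 * (2 * W) * (G x * hi lam x)))%R; last first.
  by move=> x; ring.
rewrite nintZ ?mulr_ge0//; last 2 first.
- by meas.
- by move=> x; rewrite mulr_ge0.
rewrite EFinM -muleA; apply: le_trans (lee_wpmul2l _ wt); last by rewrite lee_fin.
by rewrite muleA -EFinM mulVf ?mul1e// gt_eqF.
Qed.

Definition strong_cst (p : R) : R := 8 `^ p * (geom_cst (2 - p) + 2 * geom_cst (p - 1)).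

(* Marcinkiewicz interpolation with the layer-cake integral replaced by a sum
   over the dyadic levels [2 ^- N * 2 ^+ i]. *)
Lemma strong_type (p : R) : 1 < p -> p < 2 ->
  (nint (fun x => h x `^ p)%R <= (strong_cst p * W)%:E * nint (fun x => G x `^ p)%R)%E.
Proof.
move=> p1 p2; case: (cz) => kK [B10 B20] H2 H1 H0.
have W0 : 0 <= W by rewrite /W; lra.
have p0 : 0 < p by lra.
have G0 x : 0 <= G x by exact: vnorm_ge0.
have h0 x : 0 <= h x by exact: vnorm_ge0.
have mGp : measurable_fun setT (fun x => G x `^ p).
  exact: measurable_powRf.
(* Confining [h] between two heights leaves the finitely many levels [i < N + N]; Fatou's lemma lets
   [N] grow. *)
pose cond (N : nat) x := (4 * 2 ^- N < h x) && (h x <= 4 * 2 ^+ N).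
have mhp : measurable_fun setT (fun x => h x `^ p) by exact: measurable_powRf.
pose hN (N : nat) x : R := h x `^ p * (cond N x)%:R.
have g20 : 0 < 2 - p by lra.
have g10 : 0 < p - 1 by lra.
have [c20 _] := geom_cst_spec g20.
have [c10 _] := geom_cst_spec g10.
have sc0 : 0 <= strong_cst p.
  by rewrite /strong_cst mulr_ge0 ?powR_ge0 ?addr_ge0 ?mulr_ge0 ?(ltW c20) ?(ltW c10).
apply: (@nint_fatou R hN).
- move=> N; rewrite /hN; apply: measurable_funM => //.
  rewrite (_ : (fun x => _) = fun x => \1_[set x | 4 * 2 ^- N < h x] x * (1 - \1_[set x | 4 * 2 ^+ N < h x] x)).
    have a1 : measurable_fun setT (\1_[set x | 4 * 2 ^- N < h x] : R -> R).
      by apply: measurable_indic; exact: measurable_set_gt.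
    have a2 : measurable_fun setT (\1_[set x | 4 * 2 ^+ N < h x] : R -> R).
      by apply: measurable_indic; exact: measurable_set_gt.
    by meas.
  apply/funext => x; rewrite !indicE /cond.
  have -> : (x \in [set x | 4 * 2 ^- N < h x]) = (4 * 2 ^- N < h x) by apply/idP/idP; rewrite inE.
  have -> : (x \in [set x | 4 * 2 ^+ N < h x]) = (4 * 2 ^+ N < h x) by apply/idP/idP; rewrite inE.
  by case: (_ < _); rewrite ?mul0r//= mul1r; case: ltP; rewrite ?subrr ?subr0.
- by move=> N x; rewrite mulr_ge0 ?powR_ge0.
- move=> x; have [h0x|hx] := eqVneq (h x) 0.
    rewrite /hN h0x powR0 ?gt_eqF//; under eq_fun do rewrite mul0r.
    exact: cvg_cst.
  have hx0 : 0 < h x by rewrite lt_def hx h0.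
  apply: cvg_near_cst.
  exists (maxn (Num.bound (4 / h x)) (Num.bound (h x / 4))) => // N /=.
  rewrite geq_max => /andP[N1 N2].
  rewrite /hN /cond.
  have -> : 4 * 2 ^- N < h x.
    have := upper_nthrootP N1; rewrite ltr_pdivrMr// => lt.
    by rewrite ltr_pdivrMr ?exprn_gt0// mulrC.
  have -> : h x <= 4 * 2 ^+ N.
    by have := upper_nthrootP N2; rewrite ltr_pdivrMr// mulrC => /ltW.
  by rewrite mulr1.
move=> N.
pose lam (i : nat) : R := 2 ^- N * 2 ^+ i.
have lam0 i : 0 < lam i by rewrite mulr_gt0 ?invr_gt0 ?exprn_gt0.
have mset i : measurable_fun setT (\1_[set x | 4 * lam i < h x] : R -> R).
  by apply: measurable_indic; exact: measurable_set_gt.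
apply: (@le_trans _ _ (nint (fun x => \sum_(i < N + N) (8 * lam i) `^ p * \1_[set x | 4 * lam i < h x] x)%R)).
  apply: nint_le => x; first by rewrite mulr_ge0 ?powR_ge0.
  rewrite /hN /cond; case: (boolP (_ && _)) => [/andP[l u]|_]; last first.
    by rewrite mulr0 sumr_ge0// => i _; rewrite mulr_ge0 ?powR_ge0 ?indic_ge0.
  rewrite mulr1.
  have [|i il iu] := @dyadic_level R (4 * 2 ^- N) (h x) (N + N) l.
    rewrite exprD -mulrA [_^-1 * _]mulrA mulVf ?mul1r// expf_neq0//.
  rewrite (bigD1 i)//= -[leLHS]addr0 lerD//; last first.
    by rewrite sumr_ge0// => k _; rewrite mulr_ge0 ?powR_ge0 ?indic_ge0.
  rewrite indicE mem_set/= /lam ?mulrA// mulr1.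
  apply: le_powR; rewrite ?(ltW p0)//.
  by apply: (le_trans iu); rewrite !mulrA; lra.
rewrite nint_sum; last 2 first.
- by move=> i; have := mset i => ?; meas.
- by move=> i x; rewrite mulr_ge0 ?powR_ge0 ?indic_ge0.
pose T (i : nat) x := W * ((lam i ^+ 2)^-1 * (G x ^+ 2 * lo (lam i) x) +
                       2 * ((lam i)^-1 * (G x * hi (lam i) x))).
have mT i : measurable_fun setT (T i).
  by have := mlo (lam i); have := mhi (lam i) => ? ?; rewrite /T; meas.
have T0 i x : 0 <= T i x.
  rewrite /T mulr_ge0// addr_ge0// !mulr_ge0 ?invr_ge0 ?sqr_ge0// ?(ltW (lam0 i))//.
apply: (@le_trans _ _ (nint (fun x => \sum_(i < N + N) (8 * lam i) `^ p * T i x)%R)).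
  rewrite nint_sum; last 2 first.
  - by move=> i; meas.
  - by move=> i x; rewrite mulr_ge0 ?powR_ge0.
  apply: lee_sum => i _; rewrite [leLHS]nintZ ?powR_ge0//.
  rewrite [leRHS]nintZ ?powR_ge0//.
  apply: lee_wpmul2l; first by rewrite lee_fin powR_ge0.
  exact: weak_type_split.
have sW : 0 <= strong_cst p * W by exact: mulr_ge0.
rewrite -nintZ//; last by move=> x; exact: powR_ge0.
apply: nint_le => x; first by rewrite sumr_ge0// => i _; rewrite mulr_ge0 ?powR_ge0.
have [Gx|Gx] := eqVneq (G x) 0.
  rewrite Gx powR0 ?gt_eqF// mulr0 big1// => i _; rewrite /T Gx.
  by rewrite expr0n/= !(mul0r,mulr0) addr0 !mulr0.
have Gx0 : 0 < G x by rewrite lt_def Gx G0.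
have i2N : 0 < 2 ^- N :> R by rewrite invr_gt0 exprn_gt0.
have s1 := geom_sum_up (N + N) g20 Gx0 i2N.
have s2 := geom_sum_down (N + N) g10 Gx0 i2N.
(* The power of [lam i] is merged with its inverses, leaving exponent [p - 2] in the low part and
   [p - 1] in the high part: the two geometric sums [s1] and [s2]. *)
have E i : (8 * lam i) `^ p * T i x =
  8 `^ p * W * (G x ^+ 2 * (((lam i) `^ (2 - p))^-1 * lo (lam i) x) +
                2 * (G x * ((lam i) `^ (p - 1) * hi (lam i) x))).
  have l0 := lam0 i.
  have -> : lam i `^ (p - 1) = lam i `^ p / lam i.
    by rewrite powRB ?powRr1 ?(ltW l0)//; rewrite (gt_eqF l0) implybT.
  have -> : (lam i `^ (2 - p))^-1 = lam i `^ p / lam i ^+ 2.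
    rewrite powRB; last by rewrite (gt_eqF l0) implybT.
    by rewrite invfM invrK mulrC -powR_mulrn ?ltW.
  rewrite powRM ?(ltW l0)// /T; field; exact: lt0r_neq0.
under eq_bigr do rewrite E.
rewrite -mulr_sumr big_split/= -!mulr_sumr.
have -> : strong_cst p * W * G x `^ p = 8 `^ p * W *
   (G x ^+ 2 * (geom_cst (2 - p) * (G x `^ (2 - p))^-1) +
    2 * (G x * (geom_cst (p - 1) * G x `^ (p - 1)))).
  have -> : G x `^ (p - 1) = G x `^ p / G x.
    by rewrite powRB ?powRr1 ?(ltW Gx0)//; rewrite (gt_eqF Gx0) implybT.
  have -> : (G x `^ (2 - p))^-1 = G x `^ p / G x ^+ 2.
    rewrite powRB; last by rewrite (gt_eqF Gx0) implybT.
    by rewrite invfM invrK mulrC -powR_mulrn ?ltW.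
  rewrite /strong_cst; field; exact: lt0r_neq0.
rewrite ler_wpM2l ?mulr_ge0 ?powR_ge0// lerD//.
  by rewrite ler_wpM2l ?sqr_ge0//; exact: s1.
by rewrite ler_wpM2l// ler_wpM2l//; exact: s2.
Qed.

End StrongType.

(** * Almost orthogonality of dilated profiles *)

Section Dilation.
Context {R : realType}.
Local Notation mu := (@lebesgue_measure R).
Implicit Types psi f g H : R -> R.

(** One constant bounds everything, so later constants depend on the profile through [A] alone. The
    first moment controls tails, mean zero gives cancellation, and the last clause, an [L^1]
    Lipschitz condition on translations, stands for an integrable derivative. *)
Definition mother psi (A : R) : Prop :=
  [/\ continuous psi /\ bounded_by A psi,
      (nint (fun u => `|psi u|)%R <= A%:E)%E,
      (nint (fun u => `|u| * `|psi u|)%R <= A%:E)%E,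
      \int[mu]_u psi u = 0 &
      forall s s' : R, (nint (fun t => `|psi (s + t) - psi (s' + t)|)%R <= (A * `|s - s'|)%:E)%E].

(** Normalized in [L^1] and concentrated around [- b / 2 ^ k] at width [2 ^ (- k)]; the shift [b] is
    measured in units of that width. *)
Definition dil psi (k : int) (b x : R) : R := 2 ^ k * psi (2 ^ k * x + b).

Lemma exp2z_gt0 (k : int) : 0 < (2 : R) ^ k.
Proof. exact: exprz_gt0. Qed.

Lemma continuous_affine f (a b : R) : continuous f -> continuous (fun x => f (a * x + b)).
Proof.
move=> cf x; apply: (@continuous_comp _ _ _ (fun x => a * x + b) f); last exact: cf.
apply: cvgD; last exact: cvg_cst.
by apply: cvgM; [exact: cvg_cst|exact: cvg_id].
Qed.

Lemma continuous_shift_abs f (b : R) : continuous f -> continuous (fun x => f (b + x)).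
Proof.
move=> cf; have := @continuous_affine f 1 b cf.
by rewrite (_ : (fun x => f (1 * x + b)) = (fun x => f (b + x)))//; apply/funext => x; rewrite mul1r addrC.
Qed.

Lemma continuous_shift_r f (b : R) : continuous f -> continuous (fun x => f (x + b)).
Proof.
move=> cf; have := @continuous_affine f 1 b cf.
by rewrite (_ : (fun x => f (1 * x + b)) = (fun x => f (x + b)))//; apply/funext => x; rewrite mul1r.
Qed.

Lemma continuous_norm f : continuous f -> continuous (fun x => `|f x|).
Proof. by move=> cf x; apply: cvg_norm; exact: cf. Qed.

(** Writing [f] as [(|f| + f) - |f|], a difference of nonnegative continuous functions, reduces this
    to [nint_affine]. *)
Lemma Rint_affine f (a b : R) : 0 < a -> continuous f -> L1 f ->
  \int[mu]_x f (a * x + b) = a^-1 * \int[mu]_x f x.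
Proof.
move=> a0 cf fL; have [mf fy] := fL.
have nL (F : R -> R) : L1 F -> L1 (fun x => `|F x|).
  move=> FL; apply/L1_integrable; apply: integrable_norm; exact/L1_integrable.
have pos (F : R -> R) : (forall x, 0 <= F x) -> continuous F -> L1 F ->
    L1 (fun x => F (a * x + b)) /\ \int[mu]_x F (a * x + b) = a^-1 * \int[mu]_x F x.
  move=> F0 cF [mF Fy].
  have e := nint_affine b a0 cF F0.
  have Fy' : (nint F < +oo)%E.
    by apply: le_lt_trans Fy; apply: nint_le => // x; exact: ler_norm.
  split.
    split; first by meas.
    by under eq_nint do rewrite ger0_norm//; rewrite e lte_mul_pinfty// lee_fin invr_ge0 ltW.
  by rewrite /Rintegral -/(nint _) e (nint_fine F0 Fy').
have c1 : continuous (fun x => `|f x| + f x).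
  by move=> x; apply: cvgD; [exact: continuous_norm|exact: cf].
have p1 x : 0 <= `|f x| + f x by rewrite -lerBlDr sub0r -normrN ler_norm.
have [L1p E1] := pos _ p1 c1 (L1D (nL _ fL) fL).
have [L1n E2] := pos _ (fun x => normr_ge0 (f x)) (continuous_norm cf) (nL _ fL).
have dec (F : R -> R) : L1 F -> L1 (fun x => `|F x| + F x) -> L1 (fun x => `|F x|) ->
    \int[mu]_x F x = \int[mu]_x (`|F x| + F x) - \int[mu]_x `|F x|.
  move=> FL aL bL; rewrite -RintegralB//; try exact/L1_integrable.
  by apply: eq_Rintegral => x _; rewrite addrC addKr.
have fL' : L1 (fun x => f (a * x + b)).
  by split; [meas|case: L1n => _; under [X in (X < _)%E -> _]eq_nint do rewrite normr_id].
rewrite dec// E1 E2 (dec f fL)//; last 2 first.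
- exact: L1D (nL _ fL) fL.
- exact: nL.
by rewrite mulrBr.
Qed.

Section Mother.
Variables (psi : R -> R) (A : R).
Hypothesis hpsi : mother psi A.

Lemma mother_ge0 : 0 <= A.
Proof. by case: hpsi => -[_ /bounded_by_ge0]. Qed.

Let cpsi : continuous psi. Proof. by case: hpsi => -[]. Qed.
Let mpsi : measurable_fun setT psi. Proof. exact: continuous_measurable_fun. Qed.

Lemma dil_continuous k b : continuous (dil psi k b).
Proof.
move=> x; apply: cvgM; first exact: cvg_cst.
exact: continuous_affine.
Qed.

Lemma dil_meas k b : measurable_fun setT (dil psi k b).
Proof. by apply: continuous_measurable_fun; exact: dil_continuous. Qed.

Lemma norm_dil k b x : `|dil psi k b x| = 2 ^ k * `|psi (2 ^ k * x + b)|.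
Proof. by rewrite normrM (gtr0_norm (exp2z_gt0 k)). Qed.

Lemma nint_dil_weight (w : R -> R) k b : continuous w -> (forall x, 0 <= w x) ->
  nint (fun x => w (2 ^ k * x + b) * `|dil psi k b x|)%R =
  nint (fun u => w u * `|psi u|)%R.
Proof.
move=> cw w0; have k0 := exp2z_gt0 k.
have mw : measurable_fun setT w by exact: continuous_measurable_fun.
rewrite (eq_nint (g := fun x => 2 ^ k * (w (2 ^ k * x + b) * `|psi (2 ^ k * x + b)|)))%R; last first.
  by move=> x; rewrite norm_dil mulrCA.
rewrite nintZ ?(ltW k0)//; last 2 first.
- by meas.
- by move=> x; rewrite mulr_ge0.
rewrite (@nint_affine _ (fun u => w u * `|psi u|))//; last 2 first.
- by move=> x; apply: cvgM; [exact: cw|exact: continuous_norm].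
- by move=> x; rewrite mulr_ge0.
by rewrite muleA -EFinM divff ?mul1e// gt_eqF.
Qed.

Lemma nint_dil k b : nint (fun x => `|dil psi k b x|)%R = nint (fun u => `|psi u|)%R.
Proof.
have c1 : continuous (fun _ : R => 1 : R) by move=> x; exact: cvg_cst.
have := nint_dil_weight k b c1 (fun=> ler01).
by under eq_nint do rewrite mul1r; under [in RHS]eq_nint do rewrite mul1r.
Qed.

Lemma dil_kernel k b : kernel (dil psi k b).
Proof.
split; first exact: dil_continuous.
case: hpsi => -[_ pA] py _ _ _.
split; last first.
  exists (2 ^ k * A) => x; rewrite norm_dil ler_pM2l ?exp2z_gt0//; exact: pA.
split; first exact: dil_meas.
by rewrite nint_dil (le_lt_trans py)// ltry.
Qed.

Lemma dil_mean_zero k b : \int[mu]_x dil psi k b x = 0.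
Proof.
case: hpsi => -[_ pA] py _ p0 _; have k0 := exp2z_gt0 k.
have pL : L1 psi by split=> //; rewrite (le_lt_trans py)// ltry.
have pL' : L1 (fun x => psi (2 ^ k * x + b)).
  split; first by meas.
  by rewrite (@nint_affine _ (fun u => `|psi u|))//; [
     rewrite lte_mul_pinfty ?lee_fin ?invr_ge0 ?(ltW k0)// (le_lt_trans py) ?ltry|
     exact: continuous_norm].
rewrite /dil RintegralZl//; last exact/L1_integrable.
by rewrite Rint_affine// p0 !mulr0.
Qed.

Lemma nint_dil_diff k b s s' :
  (nint (fun t => `|dil psi k b (s + t) - dil psi k b (s' + t)|)%R <=
   (A * 2 ^ k * `|s - s'|)%:E)%E.
Proof.
case: hpsi => _ _ _ _ hd; have k0 := exp2z_gt0 k.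
pose F t := 2 ^ k * `|psi ((2 ^ k * s + b) + t) - psi ((2 ^ k * s' + b) + t)|.
have cF : continuous F.
  move=> x; apply: cvgM; first exact: cvg_cst.
  apply: cvg_norm; apply: cvgB; exact: continuous_shift_abs.
have F0 t : 0 <= F t by rewrite mulr_ge0// ltW.
rewrite (eq_nint (g := fun t => F (2 ^ k * t + 0))); last first.
  move=> t; rewrite /dil -mulrBr normrM (gtr0_norm k0) /F; congr (_ * `|psi _ - psi _|); ring.
rewrite nint_affine// nintZ ?(ltW k0)//; last by meas.
rewrite muleA -EFinM mulVf ?gt_eqF// mul1e.
apply: (le_trans (hd _ _)); rewrite lee_fin -mulrA.
rewrite (_ : _ + b - _ = 2 ^ k * (s - s')); last by ring.
by rewrite normrM (gtr0_norm k0).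
Qed.

Lemma nint_dil_diff' k b y c :
  (nint (fun x => `|dil psi k b (x - y) - dil psi k b (x - c)|)%R <=
   (A * 2 ^ k * `|y - c|)%:E)%E.
Proof.
have := nint_dil_diff k b (- y) (- c); rewrite -opprB normrN opprK addrC.
by under eq_nint do rewrite (addrC (- y)) (addrC (- c)).
Qed.

(** Off the doubled interval, [x] is at distance at least [h] from both [y] and [c]. Since [b] is at
    most half of [2 ^ k * h], the weight [|2 ^ k (x - z) + b|] is then at least [2 ^ k * h / 2], and
    the first moment bounds each of the two terms by [2 * A / (2 ^ k * h)]. *)
Lemma nint_dil_tail k b (h c y : R) : 0 < h -> 2 * `|b| <= 2 ^ k * h -> `|y - c| <= h ->
  (nint (fun x => \1_(~` `[c - 2 * h, c + 2 * h]) x *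
      `|dil psi k b (x - y) - dil psi k b (x - c)|)%R <= (4 * A * (2 ^ k * h)^-1)%:E)%E.
Proof.
move=> h0 bh yc; have k0 := exp2z_gt0 k; case: (hpsi) => _ _ hu _ _.
have kh0 : 0 < 2 ^ k * h by rewrite mulr_gt0.
pose F z x := `|2 ^ k * (x - z) + b| * `|dil psi k b (x - z)|.
have mF z : measurable_fun setT (F z).
  by have := dil_meas k b => ?; rewrite /F; meas.
have nF z : (nint (F z) <= A%:E)%E.
  have cw : continuous (fun u : R => `|u|) by apply: continuous_norm => u; exact: cvg_id.
  have := @nint_dil_weight (fun u => `|u|) k b cw (fun u => normr_ge0 u) => E.
  pose G0 x := `|2 ^ k * x + b| * `|dil psi k b x|.
  have cG : continuous G0.
    move=> x; apply: cvgM; last by apply: continuous_norm; exact: dil_continuous.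
    exact: (@continuous_affine (fun u => `|u|)).
  have := nint_shift (- z) cG; rewrite [F z](_ : _ = fun x => G0 (x - z))// => ->.
    by rewrite /G0 E.
  by move=> x; rewrite mulr_ge0.
apply: (@le_trans _ _ (nint (fun x => (2 / (2 ^ k * h)) * F y x + (2 / (2 ^ k * h)) * F c x)%R)).
  have r0 : 0 <= 2 / (2 ^ k * h) by rewrite divr_ge0// ltW.
  apply: nint_le => x; first by rewrite mulr_ge0// indic_ge0.
  rewrite indicE; case: (boolP (x \in _)) => [|_]; last first.
    by rewrite mul0r addr_ge0// mulr_ge0// /F mulr_ge0.
  rewrite inE /= in_itv/= => /negP xc; rewrite mul1r.
  have xc' : 2 * h < `|x - c|.
    rewrite ltNge; apply: contra xc; rewrite ler_distl => /andP[? ?].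
    by apply/andP; split; lra.
  have key z : h <= `|x - z| -> `|dil psi k b (x - z)| <= 2 / (2 ^ k * h) * F z x.
    move=> xz; rewrite /F mulrA -[leLHS]mul1r ler_wpM2r//.
    rewrite mulrAC ler_pdivlMr// mul1r.
    have : 2 ^ k * `|x - z| <= `|2 ^ k * (x - z) + b| + `|b|.
      rewrite -{1}(gtr0_norm k0) -normrM.
      by have := ler_normB (2 ^ k * (x - z) + b) b; rewrite addrK.
    have : 2 ^ k * h <= 2 ^ k * `|x - z| by rewrite ler_pM2l.
    lra.
  apply: (le_trans (ler_normB _ _)); apply: lerD; apply: key; last by lra.
  have := ler_distD y x c; lra.
rewrite nintD; last 4 first.
- by have := mF y => ?; meas.
- by have := mF c => ?; meas.
- by move=> x; rewrite mulr_ge0 ?divr_ge0 ?(ltW kh0)// /F mulr_ge0.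
- by move=> x; rewrite mulr_ge0 ?divr_ge0 ?(ltW kh0)// /F mulr_ge0.
have F0 z x : 0 <= F z x by rewrite /F mulr_ge0.
rewrite !nintZ ?divr_ge0 ?(ltW kh0)//.
rewrite (_ : 4 * A * _ = 2 / (2 ^ k * h) * A + 2 / (2 ^ k * h) * A); last by ring.
by rewrite EFinD !EFinM; apply: leeD; apply: lee_wpmul2l => //; rewrite lee_fin divr_ge0// ltW.
Qed.

End Mother.
End Dilation.

Section AlmostOrthogonality.
Context {R : realType}.
Local Notation mu := (@lebesgue_measure R).
Variables (psi : R -> R) (A : R).
Hypothesis hpsi : mother psi A.
Implicit Types f g : R -> R.

Lemma L1Linf_sqr f : L1Linf f -> L1 (fun x => f x ^+ 2).
Proof.
move=> [[mf fy] [B fB]]; split; first by meas.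
have B0 := bounded_by_ge0 fB.
apply: (@le_lt_trans _ _ (nint (fun x => B * `|f x|)%R)).
  by apply: nint_le => // x; rewrite normrX expr2 ler_wpM2r.
by rewrite nintZ//; [rewrite lte_mul_pinfty|meas].
Qed.

Let A0 : 0 <= A. Proof. exact: mother_ge0 hpsi. Qed.

Lemma nint_dil_diff_reflect k b s s' :
  (nint (fun z => `|dil psi k b (s - z) - dil psi k b (s' - z)|)%R <=
   (A * 2 ^ k * `|s - s'|)%:E)%E.
Proof.
have := nint_dil_diff hpsi k b s s'.
rewrite -(@nint_reflect _ (fun t => `|dil psi k b (s + t) - dil psi k b (s' + t)|) 0)//.
  by under eq_nint do rewrite sub0r.
have m := dil_meas hpsi k b; by meas.
Qed.

(* Schur's test: [|g y| |f z|] is split by AM-GM and the kernel is integrated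
   in the other variable. *)
Lemma conv_diff_pairing f g k b (s s' : R) : L1Linf f -> L1Linf g ->
  (nint (fun y => `|g y| * `|conv f (dil psi k b) (s + y) - conv f (dil psi k b) (s' + y)|)%R
   <= (A * 2 ^ k * `|s - s'| / 2)%:E *
      (nint (fun x => g x ^+ 2)%R + nint (fun x => f x ^+ 2)%R))%E.
Proof.
move=> fL gL; have [[mf fy] _] := fL; have [[mg gy] _] := gL.
have kK := dil_kernel hpsi k b; have mK := dil_meas hpsi k b.
have [_ [_ [B KB]]] := kK.
have [D [DE mD mDy mDz]] : exists D : R -> R -> R,
    [/\ forall y z, D y z = `|dil psi k b (s + y - z) - dil psi k b (s' + y - z)|,
       measurable_fun setT (fun z : R * R => D z.1 z.2),
       forall y, measurable_fun setT (D y) & forall z, measurable_fun setT (D ^~ z)].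
  exists (fun y z => `|dil psi k b (s + y - z) - dil psi k b (s' + y - z)|).
  by split=> // *; meas.
have D0 y z : 0 <= D y z by rewrite DE.
apply: (@le_trans _ _ (\int[mu]_y nint (fun z => 2^-1 * (g y ^+ 2 * D y z + f z ^+ 2 * D y z))%R)%E).
  apply: ge0_le_integral_nomeas => y; first by rewrite lee_fin mulr_ge0.
  apply: (@le_trans _ _ (`|g y|%:E * nint (fun z => `|f z| * D y z)%R)%E).
    rewrite EFinM lee_wpmul2l ?lee_fin// /conv -RintegralB//; last 2 first.
    - by apply/L1_integrable; apply: (L1_conv_integrand _ _ mK KB); case: fL.
    - by apply/L1_integrable; apply: (L1_conv_integrand _ _ mK KB); case: fL.
    apply: (le_trans (le_normr_Rint _)); first by meas.
    by apply: nint_le => z //; rewrite -mulrBr normrM DE.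
  rewrite -nintZ//; last 2 first.
  - by meas.
  - by move=> z; rewrite mulr_ge0.
  apply: nint_le => z; first by rewrite !mulr_ge0.
  rewrite mulrA -mulrDl mulrA; apply: ler_wpM2r => //.
  have := sqr_ge0 (`|g y| - `|f z|); rewrite sqrrB !real_normK ?num_real// -mulr_natr; lra.
have mF1 : measurable_fun setT (fun z : R * R => g z.1 ^+ 2 * D z.1 z.2) by meas.
have mF2 : measurable_fun setT (fun z : R * R => f z.2 ^+ 2 * D z.1 z.2) by meas.
set d := A * 2 ^ k * `|s - s'|.
have d0 : 0 <= d by rewrite /d !mulr_ge0// ltW// exp2z_gt0.
have Dz y : (nint (D y) <= d%:E)%E.
  have := nint_dil_diff_reflect k b (s + y) (s' + y).
  rewrite (@eq_nint _ (D y) _ (DE y)).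
  by rewrite (_ : s + y - (s' + y) = s - s')//; ring.
have Dy z : (nint (D ^~ z) <= d%:E)%E.
  have := nint_dil_diff hpsi k b (s - z) (s' - z).
  rewrite (_ : s - z - (s' - z) = s - s'); last by ring.
  rewrite (@eq_nint _ (D ^~ z) _ (fun y => DE y z)).
  by under eq_nint do rewrite (addrAC s) (addrAC s').
pose H1 y := nint (fun z => g y ^+ 2 * D y z)%R.
pose H2 y := nint (fun z => f z ^+ 2 * D y z)%R.
have mH1 : measurable_fun setT H1.
  apply: (@measurable_fun_fubini_tonelli_F _ _ _ _ _ mu (fun z => (g z.1 ^+ 2 * D z.1 z.2)%:E)) => //.
    by apply/measurable_EFinP.
  by move=> z; rewrite lee_fin mulr_ge0// sqr_ge0.
have mH2 : measurable_fun setT H2.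
  apply: (@measurable_fun_fubini_tonelli_F _ _ _ _ _ mu (fun z => (f z.2 ^+ 2 * D z.1 z.2)%:E)) => //.
    by apply/measurable_EFinP.
  by move=> z; rewrite lee_fin mulr_ge0// sqr_ge0.
have H10 y : (0 <= H1 y)%E by apply: nint_ge0 => z; rewrite mulr_ge0 ?sqr_ge0.
have H20 y : (0 <= H2 y)%E by apply: nint_ge0 => z; rewrite mulr_ge0 ?sqr_ge0.
have -> : (\int[mu]_y nint (fun z => 2^-1 * (g y ^+ 2 * D y z + f z ^+ 2 * D y z))%R =
  (2^-1)%:E * (\int[mu]_y H1 y + \int[mu]_y H2 y))%E.
  rewrite -ge0_integralD// -ge0_integralZl//; last 2 first.
  - exact: emeasurable_funD.
  - by move=> y _; exact: adde_ge0.
  apply: eq_integral => y _; rewrite nintZ//; last 2 first.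
  - by meas.
  - by move=> z; rewrite addr_ge0// mulr_ge0 ?sqr_ge0.
  rewrite nintD//.
  - by meas.
  - by meas.
  - by move=> z; rewrite mulr_ge0 ?sqr_ge0.
  - by move=> z; rewrite mulr_ge0 ?sqr_ge0.
rewrite mulrC EFinM -muleA; apply: lee_wpmul2l; first by rewrite lee_fin.
rewrite muleDr//; last by rewrite ge0_adde_def// inE; apply: nint_ge0 => x; exact: sqr_ge0.
apply: leeD.
  rewrite -nintZ//; last 2 first.
  - by meas.
  - by move=> x; exact: sqr_ge0.
  apply: ge0_le_integral_nomeas => // y; rewrite /H1 nintZ ?sqr_ge0//.
  by rewrite [d * _]mulrC [leRHS]EFinM; apply: lee_wpmul2l; [rewrite lee_fin sqr_ge0|exact: Dz].
rewrite /H2 (@nint_tonelli _ (fun z => f z.2 ^+ 2 * D z.1 z.2))//; last first.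
  by move=> z; rewrite mulr_ge0 ?sqr_ge0.
rewrite -nintZ//; last 2 first.
- by meas.
- by move=> x; exact: sqr_ge0.
apply: ge0_le_integral_nomeas => // z /=; first by apply: nint_ge0 => y; rewrite mulr_ge0 ?sqr_ge0.
rewrite nintZ ?sqr_ge0//.
by rewrite [d * _]mulrC [leRHS]EFinM; apply: lee_wpmul2l; [rewrite lee_fin sqr_ge0|exact: Dy].
Qed.

(* [dil psi k b] has mean zero and sits at distance [2 ^ (- k)] from
   [- b / 2 ^ k], where [conv f (dil psi l c)] oscillates by [2 ^ (l - k)].
   Neither [b] nor [c] enters the bound. *)
Lemma almost_orthogonal f g (k l : int) (b c : R) : L1Linf f -> L1Linf g ->
  (`|\int[mu]_x (conv f (dil psi l c) x * conv g (dil psi k b) x)|%:E <=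
   (A ^+ 2 * (2 ^ l / 2 ^ k) / 2)%:E *
      (nint (fun x => g x ^+ 2)%R + nint (fun x => f x ^+ 2)%R))%E.
Proof.
move=> fL gL; have [[mf fy] _] := fL; have [[mg gy] _] := gL.
have k0 : 0 < (2 : R) ^ k := exp2z_gt0 k.
have kK := dil_kernel hpsi k b; have mK := dil_meas hpsi k b.
have kL := dil_kernel hpsi l c.
have [cL [_ [BL LB]]] := kL; have [cK [[_ Ky] [BK KB]]] := kK.
pose H := conv f (dil psi l c).
have [HL [BH HB]] : L1Linf H by apply: conv_L1Linf => //; case: fL.
have cH : continuous H by apply: (conv_continuous _ cL LB); case: fL.
have mH : measurable_fun setT H by exact: continuous_measurable_fun.
rewrite -/H (conv_dual _ mH HB kK); last by case: gL.
pose c0 := - b / 2 ^ k.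
have inner y : ((`|\int[mu]_x (H x * dil psi k b (x - y))|%R)%:E <=
    nint (fun u => `|dil psi k b u| * `|H (u + y) - H (c0 + y)|)%R)%E.
  have sh : L1 (fun x => dil psi k b (x - y)).
    split; first by meas.
    by rewrite (@nint_shift _ (fun x => `|dil psi k b x|))//; apply: continuous_norm.
  have z : \int[mu]_x dil psi k b (x - y) = 0.
    have := @Rint_affine _ (dil psi k b) 1 (- y) ltr01 cK (conj mK Ky).
    by rewrite (dil_mean_zero hpsi) mulr0; under eq_Rintegral do rewrite mul1r.
  have iH : L1 (fun x => H x * dil psi k b (x - y)).
    split; first by meas.
    apply: (@le_lt_trans _ _ (nint (fun x => BH * `|dil psi k b (x - y)|)%R)).
      by apply: nint_le => // x; rewrite normrM ler_wpM2r.
    by case: sh => msh ysh; rewrite nintZ ?(bounded_by_ge0 HB)// ?lte_mul_pinfty// ?lee_fin ?(bounded_by_ge0 HB)//; meas.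
  have -> : \int[mu]_x (H x * dil psi k b (x - y)) =
      \int[mu]_x ((H x - H (c0 + y)) * dil psi k b (x - y)).
    under [RHS]eq_Rintegral do rewrite mulrBl.
    rewrite RintegralB//; last 2 first.
    - exact/L1_integrable.
    - by apply/L1_integrable; exact: L1Z.
    by rewrite RintegralZl//; [rewrite z mulr0 subr0|exact/L1_integrable].
  apply: (le_trans (le_normr_Rint _)); first by meas.
  pose F x := `|dil psi k b (x - y)| * `|H x - H (c0 + y)|.
  have cF : continuous F.
    move=> x; apply: cvgM; apply: cvg_norm.
      exact: (@continuous_shift_r _ (dil psi k b)).
    by apply: cvgB; [exact: cH|exact: cvg_cst].
  have := nint_shift y cF (fun x => mulr_ge0 (normr_ge0 _) (normr_ge0 _)).
  rewrite /F; under eq_nint do rewrite addrK; move=> ->.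
  by under eq_nint do rewrite normrM mulrC.
pose F (z : R * R) := `|g z.1| * (`|dil psi k b z.2| * `|H (z.2 + z.1) - H (c0 + z.1)|).
have mF : measurable_fun setT F by rewrite /F; meas.
have F0 z : 0 <= F z by rewrite /F !mulr_ge0.
have mW y : measurable_fun setT (fun u => `|dil psi k b u| * `|H (u + y) - H (c0 + y)|).
  by meas.
(* Recognizing a convolution with the reflected kernel gives continuity in [y], hence
   measurability. *)
have iE : (fun y => \int[mu]_x (H x * dil psi k b (x - y))) =
   conv H (fun t => dil psi k b (- t)).
  by apply/funext => y; apply: eq_Rintegral => x _; rewrite opprB.
have mI : measurable_fun setT (fun y : R => \int[mu]_x (H x * dil psi k b (x - y))).
  rewrite iE; apply: continuous_measurable_fun.
  apply: (@conv_continuous _ _ _ BK) => //.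
    move=> x; apply: (@continuous_comp _ _ _ -%R (dil psi k b)); last exact: cK.
    exact: opp_continuous.
apply: (le_trans (le_normr_Rint _)); first by meas.
apply: (@le_trans _ _ (\int[mu]_y nint (fun u => F (y, u)))%E).
  apply: ge0_le_integral_nomeas => y; first by rewrite lee_fin.
  rewrite /F /= nintZ//.
  by rewrite normrM EFinM lee_wpmul2l ?lee_fin.
rewrite nint_tonelli// /F /=.
set Q := (nint _ + nint _)%E.
have Q0 : (0 <= Q)%E by apply: adde_ge0; apply: nint_ge0 => x; exact: sqr_ge0.
have mr : measurable_fun setT (fun u : R => `|dil psi k b u| * (A * 2 ^ l / 2 * `|u - c0|)).
  by meas.
have l0 : 0 <= A * 2 ^ l / 2 by rewrite divr_ge0// mulr_ge0// ltW// exp2z_gt0.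
apply: (@le_trans _ _ (\int[mu]_u ((`|dil psi k b u| * (A * 2 ^ l / 2 * `|u - c0|))%:E * Q))%E).
  apply: ge0_le_integral_nomeas => u; first by apply: nint_ge0 => y; rewrite !mulr_ge0.
  under eq_nint do rewrite mulrCA.
  rewrite nintZ//; last by meas.
  rewrite EFinM -muleA lee_wpmul2l ?lee_fin//.
  apply: (le_trans (conv_diff_pairing l c u c0 fL gL)).
  by rewrite -/Q lee_wpmul2r// lee_fin; lra.
rewrite ge0_integralZr//; last 2 first.
- exact/measurable_EFinP.
- by move=> u _; rewrite lee_fin mulr_ge0// mulr_ge0.
rewrite lee_wpmul2r//.
rewrite -/(nint _).
have mb : measurable_fun setT (fun x : R => `|2 ^ k * x + b| * `|dil psi k b x|) by meas.
rewrite (eq_nint (g := fun u => (A * 2 ^ l / 2 / 2 ^ k) * (`|2 ^ k * u + b| * `|dil psi k b u|))%R); last first.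
  move=> u; have -> : 2 ^ k * u + b = 2 ^ k * (u - c0).
    by rewrite /c0; field; exact: lt0r_neq0.
  rewrite (normrM (2 ^ k) (u - c0)) (gtr0_norm k0); field; exact: lt0r_neq0.
have cw : continuous (fun u : R => `|u|) by apply: continuous_norm => u; exact: cvg_id.
have r0 : 0 <= A * 2 ^ l / 2 / 2 ^ k by apply: mulr_ge0 => //; rewrite invr_ge0 ltW.
rewrite nintZ//.
rewrite (nint_dil_weight hpsi k b cw (fun u => normr_ge0 u)).
have [_ _ hu _ _] := hpsi.
apply: (@le_trans _ _ ((A * 2 ^ l / 2 / 2 ^ k)%:E * A%:E)%E).
  by rewrite lee_wpmul2l ?lee_fin.
by rewrite -EFinM lee_fin le_eqVlt; apply/orP; left; apply/eqP; field; exact: lt0r_neq0.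
Qed.

End AlmostOrthogonality.

(** * Square functions over lacunary scales *)

Section Families.
Context {R : realType}.
Local Notation mu := (@lebesgue_measure R).
Implicit Types f g : R -> R.

Definition decay (z : int) : R := 2^-1 ^+ absz z.

(** Stated as the row-sum bound that Schur's test and the Hoermander sum consume, uniformly in the
    centre [s] and in [n]. Pairwise distinct integers give at most
    [1 + 2 * (1/2 + 1/4 + ...) = 3]. *)
Definition lacunary (kappa : nat -> int) : Prop :=
  forall (n : nat) (s : int), \sum_(i < n) decay (kappa i - s) <= 4.

Lemma decay_ge0 z : 0 <= decay z.
Proof. by rewrite /decay exprn_ge0// invr_ge0. Qed.

Lemma decayN z : decay (- z) = decay z.
Proof. by rewrite /decay abszN. Qed.

Lemma L1Linf_mul f g : L1Linf f -> L1Linf g -> L1 (fun x => f x * g x).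
Proof.
move=> [[mf fy] _] [[mg gy] [B gB]]; have B0 := bounded_by_ge0 gB; split; first by meas.
apply: (@le_lt_trans _ _ (nint (fun x => B * `|f x|)%R)).
  by apply: nint_le => // x; rewrite normrM mulrC ler_wpM2r.
by rewrite nintZ//; [rewrite lte_mul_pinfty|meas].
Qed.

Lemma le_Rint f g : L1 f -> L1 g -> (forall x, f x <= g x) ->
  \int[mu]_x f x <= \int[mu]_x g x.
Proof. by move=> fL gL fg; apply: le_Rintegral => //; exact/L1_integrable. Qed.

Lemma RintZ (c : R) f : L1 f -> \int[mu]_x (c * f x) = c * \int[mu]_x f x.
Proof. by move=> fL; rewrite RintegralZl//; exact/L1_integrable. Qed.

Lemma RintD f g : L1 f -> L1 g ->
  \int[mu]_x (f x + g x) = \int[mu]_x f x + \int[mu]_x g x.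
Proof. by move=> fL gL; rewrite RintegralD//; exact/L1_integrable. Qed.

Lemma exp2z_ratio (k l : int) : l <= k -> 2 ^ l / 2 ^ k = decay (k - l).
Proof.
move=> lk; rewrite invr_expz -expfzDr// (_ : l - k = - (absz (k - l))%:Z); last by lia.
by rewrite -exprz_inv -exprnP.
Qed.

Section Family.
Variables (psi : R -> R) (A b : R) (kappa : nat -> int).
Hypothesis hpsi : mother psi A.
Hypothesis hkappa : lacunary kappa.
Variable n : nat.

Let K (i : nat) := dil psi (kappa i) b.
Let A0 : 0 <= A. Proof. exact: mother_ge0 hpsi. Qed.

Lemma conv_dil_L1Linf i g : L1Linf g -> L1Linf (conv g (K i)).
Proof. by move=> [gL _]; apply: conv_L1Linf => //; exact: (dil_kernel hpsi). Qed.

(** The square is expanded into pairs; almost orthogonality bounds each pair by [decay] of the scale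
    difference times the mean of the two energies. The matrix is symmetric with row sums at most 4,
    so Schur's test gives [4 * A ^+ 2]. *)
Lemma synthesis_L2 (g : 'I_n -> R -> R) : (forall i, L1Linf (g i)) ->
  (nint (fun x => (\sum_i conv (g i) (K i) x) ^+ 2)%R <=
   (4 * A ^+ 2)%:E * nint (fun x => \sum_i (g i x) ^+ 2)%R)%E.
Proof.
move=> gL.
pose h i := conv (g i) (K i).
have hL i : L1Linf (h i) by exact: conv_dil_L1Linf.
pose E i := \int[mu]_x (g i x ^+ 2).
have E0 i : 0 <= E i by apply: Rintegral_ge0 => x _; exact: sqr_ge0.
have gE i : nint (fun x => g i x ^+ 2)%R = (E i)%:E.
  by apply: nint_L1; [exact: L1Linf_sqr|move=> x; exact: sqr_ge0].
have -> : nint (fun x => \sum_i g i x ^+ 2)%R = (\sum_i E i)%:E.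
  rewrite nint_L1; last by move=> x; exact: sumsq_ge0.
    by rewrite Rint_sum// => i; exact: L1Linf_sqr.
  by apply: L1_sum => i; exact: L1Linf_sqr.
have dbl x : (\sum_i h i x) ^+ 2 = \sum_i \sum_j h i x * h j x.
  by rewrite expr2 mulr_suml; apply: eq_bigr => i _; rewrite mulr_sumr.
have hhL i j : L1 (fun x => h i x * h j x) by exact: L1Linf_mul.
have sL i : L1 (fun x => \sum_j h i x * h j x) by exact: L1_sum.
rewrite (eq_nint dbl) nint_L1; last 2 first.
- exact: L1_sum.
- by move=> x; rewrite -dbl sqr_ge0.
rewrite -EFinM lee_fin Rint_sum//.
pose d (i j : nat) : R := decay (kappa i - kappa j).
have dC i j : d i j = d j i by rewrite /d -decayN opprB.
have ao (i j : 'I_n) : \int[mu]_x (h i x * h j x) <= A ^+ 2 * d i j / 2 * (E i + E j).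
  (* [almost_orthogonal] gains only when its first scale is the finer one; the pairing is symmetric,
     so the indices may be ordered. *)
  wlog ij : i j / kappa i <= kappa j.
    move=> W; have [|/ltW ji] := leP (kappa i) (kappa j); first exact: W.
    have -> : \int[mu]_x (h i x * h j x) = \int[mu]_x (h j x * h i x).
      by apply: eq_Rintegral => x _; rewrite mulrC.
    by rewrite dC addrC; exact: W.
  have := almost_orthogonal hpsi (kappa j) (kappa i) b b (gL i) (gL j).
  rewrite !gE -EFinD -EFinM lee_fin exp2z_ratio// -/(d j i) dC addrC.
  by move=> /(le_trans (ler_norm _)).
apply: (@le_trans _ _ (\sum_(i < n) \sum_(j < n) A ^+ 2 * d i j / 2 * (E i + E j))).
  by apply: ler_sum => i _; rewrite Rint_sum//; apply: ler_sum => j _; exact: ao.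
have S i : \sum_(j < n) d i j <= 4.
  have := hkappa n (kappa i).
  by rewrite (eq_bigr (fun j : 'I_n => d i j))// => j _; rewrite dC.
have -> : \sum_(i < n) \sum_(j < n) A ^+ 2 * d i j / 2 * (E i + E j) =
    A ^+ 2 * \sum_(i < n) (E i * \sum_(j < n) d i j).
  transitivity (A ^+ 2 / 2 * (\sum_(i < n) \sum_(j < n) E i * d i j +
     \sum_(i < n) \sum_(j < n) E j * d i j)).
    rewrite -big_split/= mulr_sumr; apply: eq_bigr => i _.
    by rewrite -big_split/= mulr_sumr; apply: eq_bigr => j _; ring.
  rewrite [X in _ + X]exchange_big/=.
  have -> : \sum_(j < n) \sum_(i < n) E j * d i j = \sum_(i < n) \sum_(j < n) E i * d i j.
    by apply: eq_bigr => j _; apply: eq_bigr => i _; rewrite dC.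
  under [in RHS]eq_bigr do rewrite mulr_sumr.
  by field.
have -> : 4 * A ^+ 2 * \sum_i E i = A ^+ 2 * (4 * \sum_i E i) by ring.
rewrite ler_wpM2l ?sqr_ge0// mulr_sumr.
by apply: ler_sum => i _; rewrite [4 * _]mulrC ler_wpM2l// S.
Qed.

Variable m : nat.
Hypothesis hb : `|b| <= 2 ^+ m.

(* In the three cases below, [d <= 0] uses the smoothness of the kernel,
   [d <= m] only its [L^1] norm, and [m < d] its tail. *)
Lemma oscillation_term (i : nat) (N : int) (c y : R) : `|y - c| <= 2 ^ N ->
  (nint (fun x => \1_(~` `[c - 2 * 2 ^ N, c + 2 * 2 ^ N]) x * `|K i (x - y) - K i (x - c)|)%R
   <= (8 * A * \sum_(q < m.+2) decay (kappa i - (q%:Z - N)))%:E)%E.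
Proof.
move=> yc; pose d := kappa i + N.
have N0 := @exp2z_gt0 R N; have k0 := @exp2z_gt0 R (kappa i).
have dE : 2 ^ kappa i * 2 ^ N = 2 ^ d :> R by rewrite /d expfzDr.
(* Each case is charged to a single term of the sum, whose argument is [d - q]: [q = 0] for
   smoothness, [q = d] (value 1) in the middle range, and [q = m + 1] for the tail. *)
have pick (q : nat) : (q < m.+2)%N ->
    decay (kappa i - (q%:Z - N)) <= \sum_(q < m.+2) decay (kappa i - (q%:Z - N)).
  move=> qm; rewrite (bigD1 (Ordinal qm))//= lerDl sumr_ge0// => q' _; exact: decay_ge0.
have drop (C : \bar R) : (nint (fun x => `|K i (x - y) - K i (x - c)|)%R <= C)%E ->
   (nint (fun x => \1_(~` `[c - 2 * 2 ^ N, c + 2 * 2 ^ N]) x * `|K i (x - y) - K i (x - c)|)%R <= C)%E.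
  apply: le_trans; apply: nint_le => x; first by rewrite mulr_ge0// indic_ge0.
  by rewrite indicE; case: (_ \in _); rewrite ?mul1r// mul0r.
have [d0|d0] := leP d 0.
  apply: drop; apply: (le_trans (nint_dil_diff' hpsi _ _ _ _)); rewrite lee_fin.
  apply: (@le_trans _ _ (A * 2 ^ d)).
    by rewrite -dE mulrA ler_wpM2l// mulr_ge0// ltW.
  have -> : 2 ^ d = decay (kappa i - (0%N%:Z - N)).
    by rewrite -[LHS]divr1 -(expr0z 2) exp2z_ratio// sub0r decayN /d; congr decay; ring.
  have := pick 0%N isT; set u := decay _; set v := \sum_(_ < _) _ => uv.
  have u0 : 0 <= u by exact: decay_ge0.
  have AuAv : A * u <= A * v by rewrite ler_wpM2l.
  have Au0 : 0 <= A * u by rewrite mulr_ge0.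
  by rewrite -mulrA; lra.
have [dm|dm] := leP d m%:Z.
  apply: drop.
  apply: (@le_trans _ _ (2 * A)%:E).
    have mK := dil_meas hpsi (kappa i) b; have cK := dil_continuous hpsi (k := kappa i) (b := b).
    have [_ hy _ _ _] := hpsi.
    have sh z : (nint (fun x => `|K i (x - z)|)%R <= A%:E)%E.
      rewrite (@nint_shift _ (fun x => `|K i x|))//; last exact: continuous_norm.
      by rewrite (nint_dil hpsi).
    apply: (@le_trans _ _ (nint (fun x => `|K i (x - y)| + `|K i (x - c)|)%R)).
      by apply: nint_le => // x; exact: ler_normB.
    rewrite /K nintD//; [|by meas|by meas].
    by rewrite (_ : 2 * A = A + A) ?EFinD ?leeD ?sh//; ring.
  rewrite lee_fin.
  have qm : (`|d|%N < m.+2)%N by lia.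
  have := pick _ qm; rewrite (_ : kappa i - _ = 0); last by rewrite /d in d0 *; lia.
  rewrite [decay 0]/decay expr0; set v := \sum_(_ < _) _ => uv.
  have : A * 1 <= A * v by rewrite ler_wpM2l.
  have -> : 8 * A * v = 8 * (A * v) by ring.
  by rewrite mulr1; move: A0; lra.
have bd : 2 * `|b| <= 2 ^ kappa i * 2 ^ N.
  rewrite dE; apply: (@le_trans _ _ (2 ^+ m.+1)); first by rewrite exprS ler_pM2l.
  by rewrite exprnP; apply: ler_weXz2l; [rewrite ler1n|lia].
apply: (le_trans (nint_dil_tail hpsi N0 bd yc)); rewrite dE lee_fin.
have := pick m.+1 (ltnSn _); set v := \sum_(_ < _) _ => uv.
apply: (@le_trans _ _ (4 * A * decay (kappa i - (m.+1%:Z - N)))).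
  rewrite ler_wpM2l ?mulr_ge0// -div1r -(expr0z 2) exp2z_ratio; last exact: ltW.
  rewrite /decay; apply: ler_wiXn2l; rewrite ?invr_ge0// ?invf_le1// ?ler1n// /d in dm *; lia.
have u0 : 0 <= decay (kappa i - (m.+1%:Z - N)) by exact: decay_ge0.
have : A * decay (kappa i - (m.+1%:Z - N)) <= A * v by rewrite ler_wpM2l.
have : 0 <= A * decay (kappa i - (m.+1%:Z - N)) by rewrite mulr_ge0.
by rewrite -!mulrA; lra.
Qed.

(** After exchanging the sums, each of the [m + 2] values of [q] costs at most 4 by lacunarity,
    which with the factor [8 * A] of [oscillation_term] gives 32. This is where the loss linear in
    [m] arises. *)
Lemma hoermander_sum (N : int) (c y : R) : `|y - c| <= 2 ^ N ->
  (nint (fun x => \1_(~` `[(c - 2 * 2 ^ N)%R, (c + 2 * 2 ^ N)%R]) x *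
     \sum_(i < n) `|K i (x - y) - K i (x - c)|)%R
   <= (32 * A * m.+2%:R)%:E)%E.
Proof.
move=> yc; under eq_nint do rewrite mulr_sumr.
have mK i := dil_meas hpsi (kappa i) b.
have mI : measurable_fun setT (\1_(~` `[c - 2 * 2 ^ N, c + 2 * 2 ^ N]) : R -> R).
  by apply: measurable_indic; apply: measurableC; exact: measurable_itv.
rewrite nint_sum; last 2 first.
- by move=> i; have := mK i => ?; rewrite /K; meas.
- by move=> i x; rewrite mulr_ge0// indic_ge0.
apply: (@le_trans _ _ (\sum_(i < n) (8 * A * \sum_(q < m.+2) decay (kappa i - (q%:Z - N)))%:E)%E).
  by apply: lee_sum => i _; exact: oscillation_term.
rewrite sumEFin lee_fin -mulr_sumr exchange_big/=.
apply: (@le_trans _ _ (8 * A * \sum_(q < m.+2) 4)).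
  by rewrite ler_wpM2l ?mulr_ge0//; apply: ler_sum => q _; exact: hkappa.
by rewrite sumr_const card_ord -mulr_natr le_eqVlt; apply/orP; left; apply/eqP; ring.
Qed.

(** Finitely many kernels have a common Lipschitz constant [S] in [L^1]. The length [delta] depends
    on the scales and on [n], but the bound does not, and only the bound enters the final
    constants. *)
Lemma small_oscillation : 0 < A ->
  exists2 delta : R, 0 < delta & forall c y : R, `|y - c| <= delta ->
    (nint (fun x => \sum_(i < n) `|K i (x - y) - K i (x - c)|)%R
     <= (32 * A * m.+2%:R)%:E)%E.
Proof.
move=> Ap; pose S := \sum_(i < n) A * 2 ^ kappa i.
have S0 : 0 <= S by apply: sumr_ge0 => i _; rewrite mulr_ge0// ltW// exp2z_gt0.
have B0 : 0 < 32 * A * m.+2%:R by rewrite !mulr_gt0.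
exists (32 * A * m.+2%:R / (1 + S)); first by rewrite divr_gt0//; lra.
move=> c y yc; have mK i := dil_meas hpsi (kappa i) b.
rewrite nint_sum//; last first.
  by move=> i; have := mK i => ?; rewrite /K; meas.
apply: (@le_trans _ _ (\sum_(i < n) (A * 2 ^ kappa i * `|y - c|)%:E)%E).
  by apply: lee_sum => i _; exact: (nint_dil_diff' hpsi).
rewrite sumEFin lee_fin -mulr_suml -/S.
apply: (@le_trans _ _ (S * (32 * A * m.+2%:R / (1 + S)))).
  by rewrite ler_wpM2l.
rewrite mulrCA ler_piMr ?(ltW B0)// ler_pdivrMr; lra.
Qed.

End Family.

Lemma mother_reflect (psi : R -> R) A : mother psi A -> mother (fun u => psi (- u)) A.
Proof.
move=> hpsi; have [[c B] i1 i2 i3 i4] := hpsi.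
have mpsi : measurable_fun setT psi by exact: continuous_measurable_fun.
have refl (w : R -> R) : measurable_fun setT w -> (forall x, 0 <= w x) ->
    nint (fun x => w (- x)) = nint w.
  by move=> mw w0; rewrite -(@nint_reflect _ w 0)//; apply: eq_nint => x; rewrite sub0r.
split.
- split; last by move=> x; exact: B.
  have := @continuous_affine _ psi (-1) 0 c.
  by rewrite (_ : (fun x => psi (-1 * x + 0)) = (fun u => psi (- u)))//; apply/funext => x; rewrite addr0 mulN1r.
- by rewrite (refl (fun u => `|psi u|)%R)//; meas.
- rewrite (eq_nint (g := fun u => (fun v => `|v| * `|psi v|) (- u))%R); last first.
    by move=> u; rewrite /= normrN.
  by rewrite (refl (fun v => `|v| * `|psi v|)%R)//; meas.
- have psiL : L1 psi by split=> //; rewrite (le_lt_trans i1)// ltry.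
  rewrite /Rintegral (_ : (\int[mu]_x (psi (- x))%:E = \int[mu]_x (psi x)%:E)%E)//.
  rewrite [LHS]integralE [RHS]integralE; congr (_ - _)%E.
    transitivity (nint (fun x => Num.max (psi (- x)) 0)).
      by apply: eq_integral => x _; rewrite funeposE/= EFin_max.
    rewrite (refl (fun x => Num.max (psi x) 0)).
    + by apply: eq_integral => x _; rewrite funeposE/= EFin_max.
    + exact: measurable_maxr.
    + by move=> x; rewrite le_max lexx orbT.
  transitivity (nint (fun x => Num.max (- psi (- x)) 0)).
    by apply: eq_integral => x _; rewrite funenegE/= EFin_max EFinN.
  rewrite (refl (fun x => Num.max (- psi x) 0)).
  + by apply: eq_integral => x _; rewrite funenegE/= EFin_max EFinN.
  + apply: measurable_maxr; last by meas.
    by meas.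
  + by move=> x; rewrite le_max lexx orbT.
- move=> s s'; pose w t := `|psi (- s + t) - psi (- s' + t)|.
  have -> : nint (fun t => `|psi (- (s + t)) - psi (- (s' + t))|)%R = nint (fun t => w (- t)).
    by apply: eq_nint => t; rewrite /w !opprD.
  rewrite refl; [|by rewrite /w; meas|by move=> t; exact: normr_ge0].
  by apply: (le_trans (i4 (- s) (- s'))); rewrite -opprD normrN.
Qed.

Section Analysis.
Variables (psi : R -> R) (A b : R) (kappa : nat -> int).
Hypothesis hpsi : mother psi A.
Hypothesis hpsiN : mother (fun u => psi (- u)) A.
Hypothesis hkappa : lacunary kappa.
Variable n : nat.

Let K (i : nat) := dil psi (kappa i) b.
Let Kt (i : nat) := dil (fun u => psi (- u)) (kappa i) (- b).

Lemma dil_reflect (k : int) (c x : R) :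
  dil (fun u => psi (- u)) k (- c) x = dil psi k c (- x).
Proof. by rewrite /dil opprD opprK mulrN. Qed.

(** The transpose of convolution with a dilate is convolution with its reflection, again a dilate:
    of the reflected profile, with shift [- b]. Analysis and synthesis are thus adjoint within one
    class of kernels. *)
Lemma analysis_dual (g : R -> R) (H : 'I_n -> R -> R) : L1Linf g -> (forall i, L1Linf (H i)) ->
  \sum_i \int[mu]_x (H i x * conv g (K i) x) =
  \int[mu]_x (g x * \sum_i conv (H i) (Kt i) x).
Proof.
move=> gL HL.
have KtL i : L1Linf (conv (H i) (Kt i)).
  by apply: conv_L1Linf; [exact: (HL i).1|exact: (dil_kernel hpsiN)].
transitivity (\int[mu]_x (\sum_i (g x * conv (H i) (Kt i) x))); last first.
  by apply: eq_Rintegral => x _; rewrite mulr_sumr.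
rewrite Rint_sum; last by move=> i; exact: L1Linf_mul.
apply: eq_bigr => i _; have [[mH Hy] [B HB]] := HL i.
rewrite (conv_dual gL.1 mH HB (dil_kernel hpsi _ _)).
apply: eq_Rintegral => y _; congr (_ * _); apply: eq_Rintegral => x _.
by rewrite /Kt dil_reflect opprB.
Qed.

Lemma L1Linf_sum (I : finType) (F : I -> R -> R) : (forall i, L1Linf (F i)) ->
  L1Linf (fun x => \sum_i F i x).
Proof.
move=> FL; split; first by apply: L1_sum => i; case: (FL i).
have /choice [B hB] : forall i, exists B, bounded_by B (F i) by move=> i; case: (FL i).
exists (\sum_i B i) => x; apply: (le_trans (ler_norm_sum _ _ _)).
by apply: ler_sum => i _; exact: hB.
Qed.

(** Let [P] be the energy of the analysis of [g], and [s] the synthesis of that analysis. Then [P]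
    is the integral of [g * s], while the energy of [s] is at most [4 * A ^+ 2 * P]. Weighting the
    arithmetic-geometric inequality by [8 * A ^+ 2] turns the [s] term into [P / 2], which is
    absorbed because [P] is finite. *)
Lemma analysis_L2 (g : R -> R) : 0 < A -> L1Linf g ->
  (nint (fun x => \sum_(i < n) (conv g (K i) x) ^+ 2)%R <=
   (4 * A ^+ 2)%:E * nint (fun x => (g x) ^+ 2)%R)%E.
Proof.
move=> A0 gL.
have hL (i : 'I_n) : L1Linf (conv g (K i)) by exact: (conv_dil_L1Linf b kappa hpsi).
pose s x := \sum_(i < n) conv (conv g (K i)) (Kt i) x.
have sL : L1Linf s by apply: L1Linf_sum => i; exact: (conv_dil_L1Linf (- b) kappa hpsiN).
have g2 := L1Linf_sqr gL; have s2 := L1Linf_sqr sL.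
have h2 (i : 'I_n) := L1Linf_sqr (hL i).
have pL : L1 (fun x => \sum_(i < n) conv g (K i) x ^+ 2) by exact: L1_sum.
have sb : (nint (fun x => s x ^+ 2)%R <= (4 * A ^+ 2)%:E *
    nint (fun x => \sum_(i < n) conv g (K i) x ^+ 2)%R)%E.
  exact: (@synthesis_L2 _ _ (- b) _ hpsiN hkappa n (fun i => conv g (K i)) hL).
have dual : \int[mu]_x (\sum_(i < n) conv g (K i) x ^+ 2) = \int[mu]_x (g x * s x).
  rewrite Rint_sum// -(analysis_dual gL hL); apply: eq_bigr => i _.
  by apply: eq_Rintegral => x _; rewrite expr2.
move: sb; rewrite !nint_L1//; try by move=> x; rewrite ?sqr_ge0//; exact: sumsq_ge0.
rewrite -!EFinM !lee_fin; set Q := \int[mu]_x _; set P := \int[mu]_x _ => QP.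
set G := \int[mu]_x _.
have A2 : 0 < A ^+ 2 by rewrite exprn_gt0.
have amgm : P <= 2 * A ^+ 2 * G + (8 * A ^+ 2)^-1 * Q.
  rewrite {1}/P dual -!RintZ// -RintD; try exact: L1Z.
  apply: le_Rint; [exact: L1Linf_mul|by apply: L1D; exact: L1Z|move=> x].
  rewrite -subr_ge0 (_ : _ - _ = (8 * A ^+ 2)^-1 * (4 * A ^+ 2 * g x - s x) ^+ 2); last by field; lra.
  by rewrite mulr_ge0 ?sqr_ge0// invr_ge0; lra.
have : (8 * A ^+ 2)^-1 * Q <= (8 * A ^+ 2)^-1 * (4 * A ^+ 2 * P).
  by rewrite ler_wpM2l// invr_ge0; lra.
have -> : (8 * A ^+ 2)^-1 * (4 * A ^+ 2 * P) = P / 2 by field; lra.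
have -> : 4 * A ^+ 2 * G = 2 * (2 * A ^+ 2 * G) by ring.
by lra.
Qed.

End Analysis.
End Families.

(** * Square function bounds on bounded functions of bounded support *)

Section SquareFunction.
Context {R : realType}.
Local Notation mu := (@lebesgue_measure R).
Implicit Types f g : R -> R.

Definition square psi (kappa : nat -> int) (b : R) (n : nat) g (x : R) : R :=
  vnorm (fun i : 'I_n => conv g (dil psi (kappa i) b) x).

Section CalderonZygmund.
Variables (psi : R -> R) (A b : R) (kappa : nat -> int) (m : nat).
Hypothesis A0 : 0 < A.
Hypothesis hpsi : mother psi A.
Hypothesis hkappa : @lacunary R kappa.
Hypothesis hb : `|b| <= 2 ^+ m.
Variable n : nat.

Lemma analysis_cz :
  calderon_zygmund (fun (j : 'I_n) (_ : 'I_1) => dil psi (kappa j) b)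
    (32 * A * m.+2%:R) (4 * A ^+ 2).
Proof.
have oscE c y x : osc (fun (j : 'I_n) (_ : 'I_1) => dil psi (kappa j) b) c y x =
    \sum_(j < n) `|dil psi (kappa j) b (x - y) - dil psi (kappa j) b (x - c)|.
  rewrite /osc -(pair_bigA _ (fun (j : 'I_n) (i : 'I_1) =>
    `|dil psi (kappa j) b (x - y) - dil psi (kappa j) b (x - c)|))/=.
  by apply: eq_bigr => j _; rewrite big_ord1.
split.
- by move=> j _; exact: (dil_kernel hpsi).
- by split; rewrite !mulr_ge0// ?exprn_ge0//; exact: ltW.
- move=> f fb; under eq_nint do under eq_bigr do rewrite /tconv big_ord1.
  under [in leRHS]eq_nint do rewrite big_ord1.
  apply: (analysis_L2 b hpsi _ hkappa) => //; first exact: mother_reflect.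
  exact: bounded_supp_L1Linf.
- move=> N c y yc; under eq_nint do rewrite oscE.
  exact: (hoermander_sum hpsi).
- have [d d0 hd] := small_oscillation b kappa hpsi n m A0.
  exists d => // c y yc; under eq_nint do rewrite oscE.
  exact: hd.
Qed.

Lemma synthesis_cz :
  calderon_zygmund (fun (_ : 'I_1) (i : 'I_n) => dil psi (kappa i) b)
    (32 * A * m.+2%:R) (4 * A ^+ 2).
Proof.
have oscE c y x : osc (fun (_ : 'I_1) (i : 'I_n) => dil psi (kappa i) b) c y x =
    \sum_(j < n) `|dil psi (kappa j) b (x - y) - dil psi (kappa j) b (x - c)|.
  rewrite /osc -(pair_bigA _ (fun (_ : 'I_1) (j : 'I_n) =>
    `|dil psi (kappa j) b (x - y) - dil psi (kappa j) b (x - c)|))/=.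
  by rewrite big_ord1.
split.
- by move=> _ j; exact: (dil_kernel hpsi).
- by split; rewrite !mulr_ge0// ?exprn_ge0//; exact: ltW.
- move=> f fb; under eq_nint do rewrite big_ord1 /tconv.
  apply: (synthesis_L2 b hpsi hkappa) => i.
  exact: bounded_supp_L1Linf.
- move=> N c y yc; under eq_nint do rewrite oscE.
  exact: (hoermander_sum hpsi).
- have [d d0 hd] := small_oscillation b kappa hpsi n m A0.
  exists d => // c y yc; under eq_nint do rewrite oscE.
  exact: hd.
Qed.

End CalderonZygmund.

(** The summand 1 makes [sharp_cst A p * m.+1] at least one, so that it is bounded by its own [p]-th
    power and the bound takes the form of a norm inequality. The coefficient 64 is 32 doubled by
    [m + 2 <= 2 * (m + 1)]. *)
Definition sharp_cst (A p : R) : R := 1 + strong_cst p * (4 * A ^+ 2 + 1 + 64 * A).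

Lemma strong_cst_ge0 (p : R) : 1 < p -> p < 2 -> 0 <= strong_cst p.
Proof.
move=> p1 p2; rewrite /strong_cst; apply: mulr_ge0; first exact: powR_ge0.
have [g1 _] : 0 < geom_cst (2 - p) /\ geom_cst (2 - p) = 1 + (2 `^ (2 - p))^-1 * geom_cst (2 - p).
  by apply: geom_cst_spec; rewrite subr_gt0.
have [g2 _] : 0 < geom_cst (p - 1) /\ geom_cst (p - 1) = 1 + (2 `^ (p - 1))^-1 * geom_cst (p - 1).
  by apply: geom_cst_spec; rewrite subr_gt0.
by move: g1 g2; set u := geom_cst _; set v := geom_cst _; lra.
Qed.

Lemma sharp_cst_bound A p (m : nat) : 0 < A -> 1 < p -> p < 2 ->
  strong_cst p * (4 * A ^+ 2 + 1 + 32 * A * m.+2%:R) <= (sharp_cst A p * m.+1%:R) `^ p.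
Proof.
move=> A0 p1 p2; have s0 := strong_cst_ge0 p1 p2.
have A2 : 0 <= A ^+ 2 by rewrite sqr_ge0.
have m1 : 1 <= m.+1%:R :> R by rewrite ler1n.
have m2 : m.+2%:R <= 2 * m.+1%:R :> R by rewrite -natrM ler_nat; lia.
pose u := 4 * A ^+ 2 + 1 + 64 * A.
have u0 : 0 <= u by rewrite /u; lra.
have su0 : 0 <= strong_cst p * u by exact: mulr_ge0.
have step : strong_cst p * (4 * A ^+ 2 + 1 + 32 * A * m.+2%:R) <= sharp_cst A p * m.+1%:R.
  apply: (@le_trans _ _ (strong_cst p * (u * m.+1%:R))).
    rewrite ler_wpM2l//.
    have -> : u * m.+1%:R = (4 * A ^+ 2 + 1) * m.+1%:R + 32 * A * (2 * m.+1%:R) by rewrite /u; ring.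
    by apply: lerD; [rewrite ler_peMr//; lra | rewrite ler_wpM2l// mulr_ge0// ltW].
  rewrite mulrA ler_wpM2r ?(le_trans _ m1)// /sharp_cst -/u; lra.
apply: (le_trans step); apply: le1r_powR; last exact: ltW.
by rewrite -[1]mulr1; apply: ler_pM => //; rewrite /sharp_cst -/u; lra.
Qed.

Section Bounds.
Variables (psi : R -> R) (A b : R) (kappa : nat -> int) (m : nat).
Hypothesis A0 : 0 < A.
Hypothesis hpsi : mother psi A.
Hypothesis hkappa : @lacunary R kappa.
Hypothesis hb : `|b| <= 2 ^+ m.
Variable n : nat.

Lemma vnorm_ord1 (u : 'I_1 -> R) : vnorm u = `|u ord0|.
Proof. by rewrite /vnorm big_ord1 sqrtr_sqr. Qed.

Lemma measurable_square g : bounded_supp g -> measurable_fun setT (square psi kappa b n g).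
Proof.
move=> gb; apply: measurable_vnorm => i.
have [[? _] _] := conv_dil_L1Linf b kappa hpsi i (bounded_supp_L1Linf gb).
by [].
Qed.

Lemma square_lt2 g p : 1 < p -> p < 2 -> bounded_supp g ->
  (nint (fun x => square psi kappa b n g x `^ p)%R <=
   ((sharp_cst A p * m.+1%:R) `^ p)%:E * nint (fun x => `|g x| `^ p)%R)%E.
Proof.
move=> p1 p2 gb.
have := strong_type (analysis_cz A0 hpsi hkappa hb n) (g := fun _ => g) (fun=> gb) p1 p2.
rewrite (eq_nint (g := fun x => square psi kappa b n g x `^ p)); last first.
  move=> x; congr (vnorm _ `^ _); apply/funext => i; by rewrite /tconv big_ord1.
rewrite [X in (_ <= _ * X)%E](eq_nint (g := fun x => `|g x| `^ p)); last first.
  by move=> x; rewrite vnorm_ord1.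
move=> /le_trans; apply; rewrite lee_wpmul2r ?lee_fin ?sharp_cst_bound//.
by apply: nint_ge0 => x; exact: powR_ge0.
Qed.

Lemma synthesis_lt2 (g : 'I_n -> R -> R) p : 1 < p -> p < 2 -> (forall i, bounded_supp (g i)) ->
  (nint (fun x => `|\sum_i conv (g i) (dil psi (kappa i) b) x| `^ p)%R <=
   ((sharp_cst A p * m.+1%:R) `^ p)%:E * nint (fun x => vnorm (g ^~ x) `^ p)%R)%E.
Proof.
move=> p1 p2 gb.
have := strong_type (synthesis_cz A0 hpsi hkappa hb n) gb p1 p2.
rewrite (eq_nint (g := fun x => `|\sum_i conv (g i) (dil psi (kappa i) b) x| `^ p)); last first.
  by move=> x; rewrite vnorm_ord1.
move=> /le_trans; apply; rewrite lee_wpmul2r ?lee_fin ?sharp_cst_bound//.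
by apply: nint_ge0 => x; exact: powR_ge0.
Qed.

(** The exponent at which the interpolation constant degenerates is covered by [analysis_L2] itself,
    weakened by [1 <= m.+1] to match the shape of the other cases. *)
Lemma square_eq2 g : bounded_supp g ->
  (nint (fun x => square psi kappa b n g x `^ 2)%R <=
   ((2 * A * m.+1%:R) `^ 2)%:E * nint (fun x => `|g x| `^ 2)%R)%E.
Proof.
move=> gb.
have := analysis_L2 b hpsi (mother_reflect hpsi) hkappa n A0 (bounded_supp_L1Linf gb).
rewrite (eq_nint (g := fun x => square psi kappa b n g x `^ 2)); last first.
  by move=> x; rewrite powR_mulrn ?vnorm_ge0// sqr_vnorm.
rewrite [X in (_ <= _ * X)%E](eq_nint (g := fun x => `|g x| `^ 2)); last first.
  by move=> x; rewrite powR_mulrn// real_normK// num_real.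
move=> /le_trans; apply; rewrite lee_wpmul2r//; last first.
  rewrite lee_fin powR_mulrn ?mulr_ge0//; last exact: ltW.
  have -> : 4 * A ^+ 2 = (2 * A) ^+ 2 by ring.
  by rewrite [leRHS]exprMn ler_peMr ?sqr_ge0 ?exprn_ege1 ?ler1n.
by apply: nint_ge0 => x; exact: powR_ge0.
Qed.


Lemma square_bounded g : bounded_supp g -> exists B, bounded_by B (square psi kappa b n g).
Proof.
move=> gb; have hL (i : 'I_n) := conv_dil_L1Linf b kappa hpsi i (bounded_supp_L1Linf gb).
have /choice [B hB] : forall i : 'I_n, exists B, bounded_by B (conv g (dil psi (kappa i) b)).
  by move=> i; case: (hL i).
exists (\sum_i B i) => x; rewrite ger0_norm ?vnorm_ge0//.
by apply: (le_trans (vnorm_le_sum _)); apply: ler_sum => i _; exact: hB.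
Qed.


End Bounds.

Section LargeExponents.
Variables (psi : R -> R) (A b : R) (kappa : nat -> int) (m : nat).
Hypothesis A0 : 0 < A.
Hypothesis hpsi : mother psi A.
Hypothesis hkappa : @lacunary R kappa.
Hypothesis hb : `|b| <= 2 ^+ m.
Variable n : nat.

(* Duality with the synthesis operator at the conjugate exponent.  Young's
   inequality weighted by [D] replaces Hoelder's and absorbs part of the left
   side without taking roots. *)
Lemma square_gt2 g p : 2 < p -> bounded_supp g ->
  (nint (fun x => square psi kappa b n g x `^ p)%R <=
   ((sharp_cst A (p / (p - 1)) * m.+1%:R) `^ p)%:E * nint (fun x => `|g x| `^ p)%R)%E.
Proof.
move=> p2 gb; pose q := p / (p - 1); rewrite -/q.
have q1 : 1 < q by rewrite /q ltr_pdivlMr; lra.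
have q2 : q < 2 by rewrite /q ltr_pdivrMr; lra.
have pq : p^-1 + q^-1 = 1 by rewrite /q invf_div; field; lra.
have [D DE D0] : exists2 D, D = sharp_cst A q * m.+1%:R & 0 < D.
  exists (sharp_cst A q * m.+1%:R) => //.
  have := strong_cst_ge0 q1 q2; rewrite /sharp_cst => s0.
  rewrite mulr_gt0 ?ltr0n// ltr_pwDl// mulr_ge0//.
  by move: (sqr_ge0 A) A0; lra.
rewrite -DE.
have gL := bounded_supp_L1Linf gb; have [mg _] := gb.
pose H := square psi kappa b n g.
have mH : measurable_fun setT H by exact: (measurable_square b kappa hpsi).
have H0 x : 0 <= H x by exact: vnorm_ge0.
have [B hB] := square_bounded b kappa hpsi n gb.
have hpsiN := mother_reflect hpsi.
have trunc (N : nat) : (nint (fun x => H x `^ p * \1_(`[- N%:R, N%:R]) x)%R <=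
    (D `^ p)%:E * nint (fun x => `|g x| `^ p)%R)%E.
  pose chi : R -> R := \1_(`[- N%:R, N%:R]%classic).
  have chi01 x : chi x = 0 \/ chi x = 1 by rewrite /chi indicE; case: (_ \in _); [right|left].
  have chi0 x : 0 <= chi x by exact: indic_ge0.
  have mchi : measurable_fun setT chi by apply: measurable_indic; exact: measurable_itv.
  have Hchi (r : R) : 0 <= r -> bounded_supp (fun x => H x `^ r * chi x).
    move=> r0; split; first by apply: measurable_funM => //; exact: measurable_powRf.
    exists (B `^ r + N%:R) => x; split.
      rewrite ger0_norm ?mulr_ge0 ?powR_ge0//.
      have HB : H x `^ r <= B `^ r.
        by apply: le_powR => //; have := hB x; rewrite ger0_norm// vnorm_ge0.
      have N0 : 0 <= N%:R :> R by [].
      have Bp : 0 <= B `^ r by exact: powR_ge0.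
      by case: (chi01 x) => ->; rewrite ?mulr0 ?mulr1; lra.
    move=> xN; rewrite /chi indicE memNset ?mulr0//= in_itv/= -ler_norml.
    by apply/negP; rewrite -ltNge (le_lt_trans _ xN)// lerDr powR_ge0.
  (* The extremal dual vector: the components of the analysis times [H]^ (p -
     2)[. Its pairing with them is]H [^ p], and its norm [H]^ (p - 1)[has]q[-th power]H [^ p]
     again. *)
  pose w x := H x `^ (p - 2) * chi x.
  pose G (i : 'I_n) x := conv g (dil psi (kappa i) b) x * w x.
  have mw : measurable_fun setT w by apply: measurable_funM => //; exact: measurable_powRf.
  have mG i : measurable_fun setT (G i).
    have [[mc _] _] := conv_dil_L1Linf b kappa hpsi i gL.
    exact: measurable_funM.
  have HG i x : `|G i x| <= H x `^ (p - 1) * chi x.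
    rewrite /G normrM [`|w x|]ger0_norm /w ?mulr_ge0 ?powR_ge0// mulrA ler_wpM2r//.
    rewrite -(@mulr_powRB1 _ _ (p - 1))//; last by lra.
    have -> : p - 1 - 1 = p - 2 by ring.
    by rewrite ler_wpM2r ?powR_ge0//; exact: (ler_vnorm (fun i : 'I_n => conv g (dil psi (kappa i) b) x)).
  have Gb i : bounded_supp (G i).
    apply: (@bounded_supp_dom _ _ (fun x => H x `^ (p - 1) * chi x)) => //.
      by move=> x; rewrite [leRHS]ger0_norm ?mulr_ge0 ?powR_ge0.
    by apply: Hchi; lra.
  pose T x := \sum_i conv (G i) (dil (fun u => psi (- u)) (kappa i) (- b)) x.
  have TL : L1Linf T.
    apply: L1Linf_sum => i; apply: (conv_dil_L1Linf (- b) kappa hpsiN).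
    exact: bounded_supp_L1Linf.
  have [[mT _] _] := TL.
  have vG x : vnorm (G ^~ x) `^ q = H x `^ p * chi x.
    have -> : vnorm (G ^~ x) = H x `^ (p - 1) * chi x.
      rewrite /vnorm (eq_bigr (fun i : 'I_n => w x ^+ 2 * conv g (dil psi (kappa i) b) x ^+ 2)); last first.
        by move=> i _; rewrite /G exprMn mulrC.
      rewrite -mulr_sumr sqrtrM ?sqr_ge0// sqrtr_sqr ger0_norm /w ?mulr_ge0 ?powR_ge0//.
      rewrite -(@mulr_powRB1 _ _ (p - 1))//; last by lra.
      have -> : p - 1 - 1 = p - 2 by ring.
      by rewrite /H /square /vnorm; ring.
    rewrite powRM ?powR_ge0// -powRrM; have -> : (p - 1) * q = p by rewrite /q; field; lra.
    by case: (chi01 x) => ->; rewrite ?powR1// powR0//; apply/eqP; lra.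
  have TX : (nint (fun x => `|T x| `^ q)%R <=
      (D `^ q)%:E * nint (fun x => H x `^ p * chi x)%R)%E.
    rewrite -(eq_nint vG).
    by rewrite DE; apply: (synthesis_lt2 A0 hpsiN hkappa (m := m)) => //; rewrite normrN.
  have Xfin : (nint (fun x => H x `^ p * chi x)%R < +oo)%E.
    have [_ hy] : L1 (fun x => H x `^ p * chi x) by apply/bounded_supp_L1/Hchi; lra.
    apply: le_lt_trans hy; apply: nint_le => x; last exact: ler_norm.
    by rewrite mulr_ge0 ?powR_ge0.
  have dual : (nint (fun x => H x `^ p * chi x)%R <= nint (fun x => `|g x| * `|T x|)%R)%E.
    have XL : L1 (fun x => H x `^ p * chi x) by apply/bounded_supp_L1/Hchi; lra.
    rewrite nint_L1//; last by move=> x; rewrite mulr_ge0 ?powR_ge0.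
    have -> : \int[mu]_x (H x `^ p * chi x) = \int[mu]_x (g x * T x).
      rewrite -(analysis_dual b kappa hpsi hpsiN gL (fun i => bounded_supp_L1Linf (Gb i))).
      rewrite -Rint_sum; last first.
        by move=> i; apply: L1Linf_mul; [exact: bounded_supp_L1Linf|exact: (conv_dil_L1Linf b kappa hpsi)].
      apply: eq_Rintegral => x _.
      rewrite (eq_bigr (fun i : 'I_n => w x * conv g (dil psi (kappa i) b) x ^+ 2)); last first.
        by move=> i _; rewrite /G; ring.
      rewrite -mulr_sumr -sqr_vnorm -/(square psi kappa b n g x) -/(H x) /w.
      rewrite -(@mulr_powRB1 _ _ p)//; last by lra.
      rewrite -(@mulr_powRB1 _ _ (p - 1))//; last by lra.
      have -> : p - 1 - 1 = p - 2 by ring.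
      by ring.
    rewrite (eq_nint (g := fun x => `|g x * T x|)) => [|x]; last by rewrite normrM.
    apply: le_trans (le_normr_Rint _); last by meas.
    by rewrite lee_fin ler_norm.
  (* Young's inequality for [D * |g|] and [|T| / D]. The powers of [D] cancel the synthesis bound,
     so with [X] the truncated integral the last term becomes [X / q]; since [1 - 1 / q = 1 / p],
     what remains is [X <= D]^ p[times the integral of]|g| [^ p]. *)
  have yg : (nint (fun x => `|g x| * `|T x|)%R <=
     (D `^ p / p)%:E * nint (fun x => `|g x| `^ p)%R +
     ((D `^ q)^-1 / q)%:E * nint (fun x => `|T x| `^ q)%R)%E.
    have ED : D^-1 `^ q * D `^ q = 1.
      by rewrite -powRM ?invr_ge0 ?(ltW D0)// mulVf ?gt_eqF// powR1.
    have -> : (D `^ q)^-1 = D^-1 `^ q by rewrite -[LHS]mul1r -ED mulfK// gt_eqF// powR_gt0.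
    rewrite -!nintZ//; first last.
    - by rewrite divr_ge0 ?powR_ge0//; lra.
    - by apply: measurable_powRf; meas.
    - by rewrite divr_ge0 ?powR_ge0//; lra.
    - by apply: measurable_powRf; meas.
    rewrite -nintD//; first last.
    - by move=> x; rewrite mulr_ge0 ?powR_ge0// divr_ge0 ?powR_ge0//; lra.
    - by move=> x; rewrite mulr_ge0 ?powR_ge0// divr_ge0 ?powR_ge0//; lra.
    - by apply: measurable_funM => //; apply: measurable_powRf; meas.
    - by apply: measurable_funM => //; apply: measurable_powRf; meas.
    apply: nint_le => x; first by rewrite mulr_ge0.
    have /(_ _ _ _ _ pq) := @conjugate_powR _ (D * `|g x|) (D^-1 * `|T x|) p q.
    rewrite mulrACA mulfV ?gt_eqF// mul1r !powRM ?invr_ge0 ?(ltW D0)// => h.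
    apply: (le_trans (h _ _ _ _)); rewrite ?mulr_ge0 ?invr_ge0 ?(ltW D0)//; [lra|lra|].
    by rewrite le_eqVlt; apply/orP; left; apply/eqP; ring.
  have Dq0 : 0 < D `^ q by rewrite powR_gt0.
  have q0 : 0 < q by lra.
  have := le_trans dual yg.
  have : (((D `^ q)^-1 / q)%:E * nint (fun x => `|T x| `^ q)%R <=
      (q^-1)%:E * nint (fun x => H x `^ p * chi x)%R)%E.
    apply: le_trans (lee_wpmul2l _ TX) _; first by rewrite lee_fin divr_ge0 ?invr_ge0 ?ltW.
    rewrite muleA -EFinM (_ : _ / q * _ = q^-1)//; by field; rewrite !gt_eqF.
  rewrite -/chi; move: Xfin; have : (0 <= nint (fun x => H x `^ p * chi x)%R)%E.
    by apply: nint_ge0 => x; rewrite mulr_ge0 ?powR_ge0.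
  have : (0 <= nint (fun x => `|g x| `^ p)%R)%E by apply: nint_ge0 => x; exact: powR_ge0.
  case: (nint (fun x => `|g x| `^ p)%R) => [a||]//; last first.
    by move=> *; rewrite gt0_muley ?lte_fin ?powR_gt0// leey.
  case: (nint (fun x => H x `^ p * chi x)%R) => [X||]// a0 X0 _ h1 h2.
  have := le_trans h2 (leeD2l _ h1).
  rewrite -!EFinM -EFinD !lee_fin => h.
  have := ler_wpM2l (_ : 0 <= p) h; rewrite mulrDr (_ : p * (D `^ p / p * a) = D `^ p * a); last by field; lra.
  have -> : p * (q^-1 * X) = p * X - X by rewrite /q; field; apply/andP; split; lra.
  by move=> /(_ ltac:(lra)); lra.
apply: (@nint_fatou _ (fun N x => H x `^ p * \1_(`[- N%:R, N%:R]) x)) trunc.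
- move=> N; apply: measurable_funM; first exact: measurable_powRf.
  by apply: measurable_indic; exact: measurable_itv.
- by move=> N x; rewrite mulr_ge0 ?powR_ge0// indic_ge0.
move=> x; apply: cvg_near_cst; near=> N.
rewrite indicE mem_set ?mulr1//= in_itv/= -ler_norml.
by near: N; exact: nbhs_infty_ger.
Unshelve. all: by end_near.
Qed.

End LargeExponents.
End SquareFunction.

(** * Truncation and convolution on [L^p] *)

Section LebesgueSpace.
Context {R : realType}.
Local Notation mu := (@lebesgue_measure R).
Implicit Types f g K : R -> R.

Definition Lp (p : R) g := measurable_fun setT g /\ (nint (fun x => `|g x| `^ p)%R < +oo)%E.

Lemma conjugate_exponent (p : R) : 1 < p -> exists q : R, 1 < q /\ p^-1 + q^-1 = 1.
Proof.
move=> p1; exists (p / (p - 1)); split; first by rewrite ltr_pdivlMr; lra.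
by rewrite invf_div; field; lra.
Qed.

Lemma L1Linf_Lp K (q : R) : 1 < q -> L1Linf K -> Lp q K.
Proof.
move=> q1 [[mK Ky] [B KB]]; have B0 := bounded_by_ge0 KB; split=> //.
apply: (@le_lt_trans _ _ (nint (fun x => B `^ (q - 1) * `|K x|)%R)).
  apply: nint_le => x; first exact: powR_ge0.
  rewrite -(@mulr_powRB1 _ _ q)//; last by lra.
  by rewrite mulrC ler_wpM2r//; apply: le_powR => //; lra.
rewrite nintZ//; last 2 first.
- by meas.
- exact: powR_ge0.
by rewrite lte_mul_pinfty// lee_fin powR_ge0.
Qed.

Lemma Lp_conv_integrand g K (p : R) (x : R) : 1 < p -> Lp p g -> kernel K ->
  L1 (fun y => g y * K (x - y)).
Proof.
move=> p1 [mg gy] kK; have mK := kernel_meas kK; have [q [q1 pq]] := conjugate_exponent p1.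
have [_ Ky] := L1Linf_Lp q1 kK.2.
split; first by meas.
have p0 : 0 < p by lra.
have q0 : 0 < q by lra.
have mgp : measurable_fun setT (fun y : R => `|g y| `^ p) by apply: measurable_powRf; meas.
have mKq : measurable_fun setT (fun y : R => `|K (x - y)| `^ q) by apply: measurable_powRf; meas.
apply: (@le_lt_trans _ _ (nint (fun y => p^-1 * `|g y| `^ p + q^-1 * `|K (x - y)| `^ q)%R)).
  apply: nint_le => y //; rewrite normrM [p^-1 * _]mulrC [q^-1 * _]mulrC.
  exact: conjugate_powR.
rewrite nintD//; last 4 first.
- by meas.
- by meas.
- by move=> y; rewrite mulr_ge0 ?powR_ge0// invr_ge0 ltW.
- by move=> y; rewrite mulr_ge0 ?powR_ge0// invr_ge0 ltW.
rewrite !nintZ//; try by move=> y; exact: powR_ge0.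
  rewrite (@nint_reflect _ (fun y => `|K y| `^ q))//; last first.
    by apply: measurable_powRf; meas.
  apply: lte_add_pinfty.
    by apply: lte_mul_pinfty; [rewrite lee_fin invr_ge0 ltW|by []|exact: gy].
  by apply: lte_mul_pinfty; [rewrite lee_fin invr_ge0 ltW|by []|exact: Ky].
- by rewrite invr_ge0 ltW.
- by rewrite invr_ge0 ltW.
Qed.

Definition truncate g (N : nat) (y : R) : R :=
  g y * ((`|y| <= N%:R)%R%:R * (`|g y| <= N%:R)%R%:R).

Lemma truncate_le g N y : `|truncate g N y| <= `|g y|.
Proof.
rewrite /truncate normrM ler_piMr// ger0_norm ?mulr_ge0//.
by case: (`|y| <= _)%R; case: (`|g y| <= _)%R; rewrite ?mulr1 ?mulr0 ?mul0r.
Qed.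

Lemma bounded_supp_truncate g N : measurable_fun setT g -> bounded_supp (truncate g N).
Proof.
move=> mg; split.
  have mle (f : R -> R) : measurable_fun setT f -> measurable_fun setT (fun y => (f y <= N%:R)%R%:R : R).
    move=> mf; have -> : (fun y => (f y <= N%:R)%R%:R : R) = \1_[set y | f y <= N%:R].
      by apply/funext => y; rewrite indicE; congr (nat_of_bool _)%:R; apply/idP/idP => [h|/set_mem//]; exact: mem_set.
    apply: measurable_indic; rewrite -[X in measurable X]setTI.
    exact: (measurable_fun_le measurableT mf (measurable_cst _)).
  by apply: measurable_funM => //; apply: measurable_funM; apply: mle; meas.
exists N%:R => y; rewrite /truncate; split.
  have [h|h] := leP `|g y| N%:R; last by rewrite !mulr0 normr0.
  rewrite mulr1 normrM (le_trans _ h)// ler_piMr//.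
  by case: (`|y| <= _)%R; rewrite ?normr1 ?normr0.
by move=> h; rewrite leNgt h mul0r mulr0.
Qed.

Lemma cvg_sum_seq (I : Type) (s : seq I) (F : I -> nat -> R) (l : I -> R) :
  (forall i, F i N @[N --> \oo] --> l i) ->
  (\sum_(i <- s) F i N) @[N --> \oo] --> \sum_(i <- s) l i.
Proof.
move=> h; elim: s => [|i s IH].
  by rewrite big_nil; under eq_fun do rewrite big_nil; exact: cvg_cst.
by rewrite big_cons; under eq_fun do rewrite big_cons; exact: cvgD.
Qed.

Lemma cvg_powR (p : R) (u : nat -> R) (l : R) : 1 <= p -> (forall N, 0 <= u N) ->
  u N @[N --> \oo] --> l -> u N `^ p @[N --> \oo] --> l `^ p.
Proof.
move=> p1 u0 ul.
have : 0 <= l by rewrite -(cvg_lim _ ul)//; apply: limr_ge; [apply/cvg_ex; exists l | exact: nearW].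
rewrite le_eqVlt => /orP[/eqP l0|l0].
  rewrite -l0 powR0; last by rewrite gt_eqF//; lra.
  apply: (@squeeze_cvgr _ _ _ _ (fun=> 0) u); last by rewrite l0.
  - near=> N; rewrite powR_ge0/=.
    have uN1 : u N < 1 by near: N; apply: (cvgr_lt l) => //; rewrite -l0.
    have := u0 N; rewrite le_eqVlt => /orP[/eqP <-|uN0].
      by rewrite powR0// gt_eqF//; lra.
    by apply: ge1r_powR => //; rewrite uN0 ltW.
  - exact: cvg_cst.
have -> : l `^ p = expR (p * ln l) by rewrite /powR gt_eqF.
apply: (@cvg_trans _ ((fun N => expR (p * ln (u N))) @ \oo)).
  apply: near_eq_cvg; near=> N; rewrite /powR gt_eqF//.
  by near: N; exact: (cvgr_gt l).
apply: (@continuous_cvg _ _ _ _ _ _ expR); first exact: continuous_expR.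
apply: cvgM; first exact: cvg_cst.
by apply: (@continuous_cvg _ _ _ _ _ u (@ln R) l) => //; exact: continuous_ln.
Unshelve. all: by end_near. Qed.

Lemma truncate_cvg g y : truncate g N y @[N --> \oo] --> g y.
Proof.
apply: cvg_near_cst; near=> N; rewrite /truncate.
have -> : (`|y| <= N%:R)%R by near: N; exact: nbhs_infty_ger.
have -> : (`|g y| <= N%:R)%R by near: N; exact: nbhs_infty_ger.
by rewrite !mulr1.
Unshelve. all: by end_near. Qed.

Lemma conv_truncate_cvg g K (p : R) (x : R) : 1 < p -> Lp p g -> kernel K ->
  conv (truncate g N) K x @[N --> \oo] --> conv g K x.
Proof.
move=> p1 gL kK; have mK := kernel_meas kK; have [mg _] := gL.
have IL := Lp_conv_integrand x p1 gL kK.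
have mt N : measurable_fun setT (truncate g N) by case: (bounded_supp_truncate N mg).
have ig : mu.-integrable setT (fun y => (`|g y * K (x - y)|)%:E).
  by have /L1_integrable := IL; exact: integrable_norm.
have h : (\int[mu]_y (truncate g N y * K (x - y))%:E)%E @[N --> \oo] --> (\int[mu]_y (g y * K (x - y))%:E)%E.
  have [] // := @dominated_convergence _ _ _ mu setT measurableT
   (fun N y => (truncate g N y * K (x - y))%:E) (fun y => (g y * K (x - y))%:E) (fun y => (`|g y * K (x - y)|)%:E).
  - by move=> N; apply/measurable_EFinP; meas.
  - by apply/measurable_EFinP; meas.
  - apply: aeW => y _; apply: cvg_EFin; first exact: nearW.
    by apply: cvgM; [exact: truncate_cvg|exact: cvg_cst].
  - by apply: aeW => y N _; rewrite /= lee_fin [leLHS]normrM [leRHS]normrM ler_wpM2r// truncate_le.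
have fin : (\int[mu]_y (g y * K (x - y))%:E)%E \is a fin_num.
  by apply: integrable_fin_num => //; have /L1_integrable := IL.
by have := fine_cvg; rewrite /conv /Rintegral => F; apply: F; rewrite fineK.
Qed.

End LebesgueSpace.

Section Lacunary.
Context {R : realType}.

Lemma lacunary_of_increasing (kappa : nat -> int) :
  (forall i, kappa i + 1 <= kappa i.+1) -> @lacunary R kappa.
Proof.
move=> inc n s; have pw (k : nat) : 0 < 2^-1 ^+ k :> R by rewrite exprn_gt0// invr_gt0.
(* A two-phase invariant. Up to [s] the terms at least double from one to the next, so the sum is at
   most twice its last term. Beyond [s] they at least halve, and a reserve equal to the last term
   pays for all that follow. *)
suff H : (0 < n)%N -> (kappa n.-1 <= s ->
      \sum_(i < n) decay (kappa i - s) <= 2 * decay (kappa n.-1 - s) :> R) /\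
    (s < kappa n.-1 -> \sum_(i < n) decay (kappa i - s) <= 4 - decay (kappa n.-1 - s) :> R).
  case: n H => [_|n H]; first by rewrite big_ord0.
  have [h1 h2] := H isT; have [ks|ks] := leP (kappa n) s.
    apply: (le_trans (h1 ks)); have : decay (kappa n - s) <= 1 :> R by rewrite /decay exprn_ile1 ?invf_le1 ?ler1n.
    lra.
  by apply: (le_trans (h2 ks)); have := @decay_ge0 R (kappa n - s); lra.
case: n => // n _; elim: n => [|n [IH1 IH2]] /=.
  rewrite big_ord1; set d := decay _; have d0 : 0 <= d by exact: decay_ge0.
  have d1 : d <= 1 by rewrite /d /decay exprn_ile1 ?invf_le1 ?ler1n.
  by split=> _; lra.
move: IH1 IH2; rewrite /= => IH1 IH2; rewrite big_ord_recr/=; have := inc n => incn.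
have half (a b : int) : (absz a < absz b)%N -> 2 * decay b <= decay a :> R.
  move=> ab; rewrite /decay; have -> : absz b = ((absz b - absz a).-1 + (absz a).+1)%N by lia.
  rewrite exprD exprS; have := pw (absz a); set u := _ ^+ absz a => u0.
  have v1 : 2^-1 ^+ (absz b - absz a).-1 <= 1 :> R by rewrite exprn_ile1 ?invf_le1 ?ler1n.
  set v := _ ^+ _ in v1 *; have -> : 2 * (v * (2^-1 * u)) = v * u by field.
  by rewrite ler_piMl// ltW.
split=> ks.
  have h := half (kappa n.+1 - s) (kappa n - s) ltac:(lia).
  have := IH1 ltac:(lia); lra.
have [kn|kn] := leP (kappa n) s.
  have := IH1 kn; have := @decay_ge0 R (kappa n - s).
  have d1 : decay (kappa n - s) <= 1 :> R by rewrite /decay exprn_ile1 ?invf_le1 ?ler1n.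
  have : 2 * decay (kappa n.+1 - s) <= decay 0 :> R by apply: half; lia.
  by rewrite /decay expr0 -/(decay _) -/(decay _); lra.
have := IH2 kn; have := half (kappa n - s) (kappa n.+1 - s) ltac:(lia); lra.
Qed.

Lemma lacunary_opp (kappa : nat -> int) :
  @lacunary R kappa -> @lacunary R (fun i => - kappa i).
Proof.
move=> h n s; rewrite (eq_bigr (fun i : 'I_n => decay (kappa i - (- s)))); first exact: h.
by move=> i _; rewrite -decayN; congr decay; ring.
Qed.

End Lacunary.

Section SquareFunctionLp.
Context {R : realType}.
Local Notation mu := (@lebesgue_measure R).

(** For a fixed number of scales the square functions of the truncations converge pointwise, which
    carries measurability and, by Fatou, the bound to all of [Lp p]. That [C] precedes [n] is what
    later permits the limit over all scales. *)
Theorem square_Lp (A p : R) : 0 < A -> 1 < p -> exists2 C : R, 0 < C &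
  forall psi kappa b (m n : nat) g, mother psi A -> @lacunary R kappa -> `|b| <= 2 ^+ m ->
  Lp p g -> measurable_fun setT (square psi kappa b n g) /\
  (nint (fun x => square psi kappa b n g x `^ p)%R <=
   ((C * m.+1%:R) `^ p)%:E * nint (fun x => `|g x| `^ p)%R)%E.
Proof.
move=> A0 p1.
have [C C0 hC] : exists2 C : R, 0 < C &
  forall psi kappa b (m n : nat) g, mother psi A -> @lacunary R kappa -> `|b| <= 2 ^+ m ->
  bounded_supp g ->
  (nint (fun x => square psi kappa b n g x `^ p)%R <=
   ((C * m.+1%:R) `^ p)%:E * nint (fun x => `|g x| `^ p)%R)%E.
  have sp r : 1 < r -> r < 2 -> 0 < sharp_cst A r.
    move=> r1 r2; have := strong_cst_ge0 r1 r2; rewrite /sharp_cst => s0.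
    by rewrite ltr_pwDl// mulr_ge0//; move: (sqr_ge0 A) A0; lra.
  have [p2|p2|p2] := ltgtP p 2.
  - exists (sharp_cst A p); first exact: sp.
    by move=> psi kappa b m n g h1 h2 h3 gb; exact: square_lt2.
  - exists (sharp_cst A (p / (p - 1))).
      by apply: sp; [rewrite ltr_pdivlMr; lra | rewrite ltr_pdivrMr; lra].
    by move=> psi kappa b m n g h1 h2 h3 gb; exact: square_gt2.
  - exists (2 * A); first by rewrite mulr_gt0.
    by move=> psi kappa b m n g h1 h2 h3 gb; rewrite p2; exact: square_eq2.
exists C => // psi kappa b m n g h1 h2 h3 gL; have [mg _] := gL.
have cv x : square psi kappa b n (truncate g N) x @[N --> \oo] --> square psi kappa b n g x.
  rewrite /square /vnorm; apply: (@continuous_cvg _ _ _ _ _ _ (@Num.sqrt R)); first exact: sqrt_continuous.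
  apply: cvg_sum_seq => i; rewrite expr2; under eq_fun do rewrite expr2.
  by apply: cvgM; apply: (conv_truncate_cvg p1) => //; exact: (dil_kernel h1).
have ms N : measurable_fun setT (square psi kappa b n (truncate g N)).
  by apply: (measurable_square b kappa h1); exact: bounded_supp_truncate.
split.
  by apply: (measurable_fun_cvg ms) => x _; exact: cv.
apply: (@nint_fatou _ (fun N x => square psi kappa b n (truncate g N) x `^ p)).
- by move=> N; exact: measurable_powRf.
- by move=> N x; exact: powR_ge0.
- by move=> x; apply: cvg_powR; [exact: ltW|move=> N; exact: vnorm_ge0|exact: cv].
- move=> N; apply: (le_trans (hC _ _ _ _ _ _ h1 h2 h3 (bounded_supp_truncate N mg))).
  apply: lee_wpmul2l; first by rewrite lee_fin powR_ge0.
  apply: nint_le => x; first exact: powR_ge0.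
  by apply: le_powR; rewrite ?truncate_le//; lra.
Qed.

End SquareFunctionLp.

(** * Inverse Fourier transforms of bumps *)

Section Amplitudes.
Context {R : realType}.
Local Notation mu := (@lebesgue_measure R).
Implicit Types a f g : R -> R.

Fixpoint Ck (n : nat) a : Prop :=
  if n is n'.+1 then (forall x : R, derivable a x 1) /\ Ck n' (derive1 a) else continuous a.

Lemma derivable_cont a : (forall x : R, derivable a x 1) -> continuous a.
Proof. by move=> da x; apply/differentiable_continuous; rewrite -derivable1_diffP. Qed.

Lemma Ck_continuous n a : Ck n a -> continuous a.
Proof. by case: n => // n [da _]; exact: derivable_cont. Qed.

Lemma CkW n a : Ck n.+1 a -> Ck n a.
Proof.
elim: n a => [|n IH] a [da ca]; first exact: derivable_cont.
by split=> //; exact: IH.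
Qed.

Lemma Ck_ext n a f : a =1 f -> Ck n a -> Ck n f.
Proof. by move=> /funext ->. Qed.

Lemma derive1_eq f (x d : R) : is_derive x 1 f d -> (derive1 f) x = d.
Proof. by move=> h; rewrite derive1E derive_val. Qed.

Lemma CkD n a f : Ck n a -> Ck n f -> Ck n (fun x => a x + f x).
Proof.
elim: n a f => [|n IH] a f; first by move=> ca cf x; apply: cvgD; [exact: ca|exact: cf].
move=> [da ca] [df cf]; split; first by move=> x; exact: derivableD.
apply: Ck_ext (IH _ _ ca cf) => x; rewrite /= [RHS]derive1E (deriveD (da x) (df x)).
by rewrite -!derive1E.
Qed.

Lemma CkM n a f : Ck n a -> Ck n f -> Ck n (fun x => a x * f x).
Proof.
elim: n a f => [|n IH] a f; first by move=> ca cf x; apply: cvgM; [exact: ca|exact: cf].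
move=> h1 h2; case: (h1) => da ca; case: (h2) => df cf.
split; first by move=> x; exact: derivableM.
apply: Ck_ext (CkD (IH _ _ (CkW h1) cf) (IH _ _ (CkW h2) ca)) => x.
by rewrite /= [RHS]derive1E (deriveM (da x) (df x)) -!derive1E.
Qed.

Lemma Ck_cst n (c : R) : Ck n (fun=> c).
Proof.
elim: n c => [|n IH] c; first by move=> x; exact: cvg_cst.
split; first by move=> x; exact: derivable_cst.
by apply: Ck_ext (IH 0) => x; rewrite derive1_cst.
Qed.

Lemma Ck_id n : Ck n (fun x : R => x).
Proof.
case: n => [|n]; first by move=> x; exact: cvg_id.
split; first by move=> x; exact: derivable_id.
by apply: Ck_ext (Ck_cst n 1) => x; rewrite derive1_id.
Qed.

(** Compact support removes boundary terms in the integrations by parts; support away from the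
    origin permits division by the frequency, from which the mean zero of the kernels follows. *)
Definition amp n a : Prop := Ck n a /\ forall x, ~ (2^-1 <= x <= 2) -> a x = 0.

Lemma near_out (x : R) : ~ (2^-1 <= x <= 2) -> \forall y \near x, ~ (2^-1 <= y <= 2).
Proof.
move=> /negP; rewrite negb_and -!ltNge => /orP[h|h].
  near=> y; apply/negP; rewrite negb_and -!ltNge; apply/orP; left.
  by near: y; apply: lt_nbhsl.
near=> y; apply/negP; rewrite negb_and -!ltNge; apply/orP; right.
by near: y; apply: lt_nbhsr.
Unshelve. all: by end_near. Qed.

Lemma is_derive_near0 a (x : R) : (\forall y \near x, a y = 0) -> is_derive x 1 a 0.
Proof.
move=> h; have h' : \forall y \near x, cst (0 : R) y = a y by apply: filterS h => y ->.
apply: DeriveDef; first by apply: (near_eq_derivable h'); exact: derivable_cst.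
by rewrite -(near_eq_derive _ h') derive_cst.
Qed.

Lemma amp_derive n a : amp n.+1 a -> amp n (derive1 a).
Proof.
move=> [[da ca] a0]; split=> // x xo; apply: derive1_eq; apply: is_derive_near0.
by near=> y; apply: a0; near: y; exact: near_out.
Unshelve. all: by end_near. Qed.

Lemma ampM n a f : Ck n f -> amp n a -> amp n (fun x => f x * a x).
Proof. by move=> cf [ca a0]; split; [exact: CkM|move=> x /a0 ->; rewrite mulr0]. Qed.

(** For [x <= 0] the function vanishes on a neighbourhood, the complement of the support interval
    being open, so the singularity is never met. The derivative is [a' / x - a / x / x], whose terms
    are again quotients of amplitudes of lower order. *)
Lemma amp_div n a : amp n a -> amp n (fun x => a x / x).
Proof.
move=> ha; split; last by case: ha => _ a0 x /a0 ->; rewrite mul0r.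
have der (f : R -> R) (x : R) : (forall x : R, derivable f x 1) -> (forall x, ~ (2^-1 <= x <= 2) -> f x = 0) ->
    is_derive x 1 (fun x => f x / x) ((derive1 f) x / x - f x / x / x).
  move=> df f0; have [x0|x0] := ltP 0 x.
    have x0' : x != 0 by rewrite gt_eqF.
    have h1 : is_derive x 1 f (derive1 f x) by rewrite derive1E; exact/derivableP.
    have h2 := is_deriveV x0' (is_derive_id x (1 : R)).
    apply: (is_derive_eq (is_deriveM h1 h2)).
    by rewrite /GRing.scale/=; field.
  have xo : ~ (2^-1 <= x <= 2) by move=> /andP[h _]; have : 0 < (2:R)^-1 by []; lra.
  have f'0 : (derive1 f) x = 0.
    by apply: derive1_eq; apply: is_derive_near0; near=> y; apply: f0; near: y; exact: near_out.
  rewrite f'0 (f0 x xo) !mul0r subrr; apply: is_derive_near0.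
  by near=> y; rewrite f0 ?mul0r//; near: y; exact: near_out.
elim: n a ha => [|n IH] a ha.
  have [ca a0] := ha; move=> x; have [x0|x0] := ltP 0 x.
    apply: cvgM; first exact: ca.
    by apply: cvgV; [rewrite gt_eqF|exact: cvg_id].
  have xo : ~ (2^-1 <= x <= 2) by move=> /andP[h _]; have : 0 < (2:R)^-1 by []; lra.
  rewrite /continuous_at a0// mul0r; apply: cvg_near_cst.
  by near=> y; rewrite a0 ?mul0r//; near: y; exact: near_out.
have [[da ca] a0] := ha.
split; first by move=> x; have [] := der a x da a0.
have h0 : amp n a by split=> //; exact: (@CkW n a ha.1).
have h1 := IH _ (amp_derive ha).
have h2 := IH _ h0.
have h3 : Ck n (fun x => a x / x / x).
  by apply: IH; split=> // x /a0 ->; rewrite mul0r.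
apply: Ck_ext (CkD h1 (CkM (Ck_cst n (-1)) h3)) => x.
by rewrite (derive1_eq (der a x da a0)) mulN1r.
Unshelve. all: by end_near. Qed.

Lemma amp_bounded_supp n a : amp n a -> bounded_supp a.
Proof.
move=> [ca a0]; have cta := Ck_continuous ca; split; first exact: continuous_measurable_fun.
have [c _ hc] := @EVT_max R (fun x => `|a x|) 0 3 ltac:(lra) (continuous_subspaceT (continuous_norm cta)).
exists (`|a c| + 2) => x; split.
  have [xi|xo] := boolP (2^-1 <= x <= 2); last by rewrite a0 ?normr0 ?addr_ge0//; exact/negP.
  have xi' : x \in `[0, 3] by move/andP: xi => [h1 h2]; rewrite in_itv/=; apply/andP; split; lra.
  by have := hc x xi'; lra.
move=> h; apply: a0 => /andP[x1 x2]; have : 0 <= `|a c| by [].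
by rewrite [`|x|]ger0_norm in h; lra.
Qed.

Lemma amp_L1 n a : amp n a -> L1 a.
Proof. by move=> /amp_bounded_supp; exact: bounded_supp_L1. Qed.

Lemma Rint_FTC (F f : R -> R) (a b : R) : a < b -> (forall x : R, is_derive x 1 F (f x)) ->
  continuous f -> \int[mu]_x (f x * \1_(`[a, b]) x) = F b - F a.
Proof.
move=> ab dF cf.
have cF : continuous F by apply: derivable_cont => x; case: (dF x).
have := @continuous_FTC2 R f F a b ab (continuous_subspaceT cf).
have h1 : derivable_oo_LRcontinuous F a b.
  split; first by move=> x _; case: (dF x).
    by apply: cvg_at_right_filter; exact: cF.
  by apply: cvg_at_left_filter; exact: cF.
move=> /(_ h1 (fun x _ => derive1_eq (dF x))) h.
rewrite /Rintegral (_ : (\int[mu]_x (f x * _)%:E = \int[mu]_(x in `[a, b]) (f x)%:E)%E); first by rewrite h.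
rewrite [RHS]integral_mkcond; apply: eq_integral => x _.
rewrite /patch indicE; case: ifPn => _; first by rewrite mulr1.
by rewrite mulr0.
Qed.

End Amplitudes.

(** * Decay and differentiation of oscillatory integrals *)

Section OscillatoryIntegrals.
Context {R : realType}.
Local Notation mu := (@lebesgue_measure R).
Implicit Types a f g : R -> R.

(* Both parts of an inverse Fourier transform are sums of waves, the phase
   [- (pi / 2)] turning the cosine into a sine. *)
Definition wave a (th x : R) : R := \int[mu]_xi (a xi * cos (2 * pi * (x * xi) + th)).

Lemma is_derive_affine_comp f (k c x d : R) : is_derive (k * x + c) 1 f d ->
  is_derive x 1 (fun x : R => f (k * x + c)) (k * d).
Proof.
move=> hf; have h : is_derive x 1 (fun x : R => k * x + c) k.
  have h1 := is_deriveD (is_deriveZ k (is_derive_id x (1 : R))) (is_derive_cst c x (1 : R)).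
  by apply: (is_derive_eq h1); rewrite addr0 [LHS]mulr1.
by apply: (is_derive_eq (@is_derive1_comp R f (fun x : R => k * x + c) x _ _ hf h)); rewrite mulrC.
Qed.

Lemma is_derive_cos_affine (k th xi : R) :
  is_derive xi 1 (fun xi : R => cos (k * xi + th)) (- k * sin (k * xi + th)).
Proof. by apply: (is_derive_eq (is_derive_affine_comp (is_derive_cos _))); ring. Qed.

Lemma is_derive_sin_affine (k th xi : R) :
  is_derive xi 1 (fun xi : R => sin (k * xi + th)) (k * cos (k * xi + th)).
Proof. exact: (is_derive_affine_comp (is_derive_sin _)). Qed.

Lemma cos_add_pihalf (t th : R) : cos (t + (th + pi / 2)) = - sin (t + th).
Proof. by rewrite addrA cosDpihalf. Qed.

Lemma continuous_cos_affine (k th : R) : continuous (fun xi : R => cos (k * xi + th)).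
Proof. exact: (@continuous_affine R (@cos R) k th (@continuous_cos R)). Qed.

Lemma wave_integrand n a th x : amp n a ->
  continuous (fun xi => a xi * cos (2 * pi * (x * xi) + th)) /\
  L1 (fun xi => a xi * cos (2 * pi * (x * xi) + th)).
Proof.
move=> ha.
have cc : continuous (fun xi => cos (2 * pi * (x * xi) + th)).
  have -> : (fun xi => cos (2 * pi * (x * xi) + th)) = (fun xi => cos (2 * pi * x * xi + th)).
    by apply/funext => xi; rewrite !mulrA.
  exact: continuous_cos_affine.
have ca := Ck_continuous ha.1.
split; first by move=> xi; apply: cvgM; [exact: ca|exact: cc].
apply: bounded_supp_L1; apply: bounded_suppM.
- exact: (amp_bounded_supp ha).
- exact: continuous_measurable_fun.
- by exists 1 => xi; exact: cos_max.
Qed.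

Lemma wave_bound n a th : amp n a -> bounded_by (\int[mu]_xi `|a xi|) (wave a th).
Proof.
move=> ha x; have [cw wL] := wave_integrand th x ha.
have aL := amp_L1 ha.
have naL : L1 (fun xi => `|a xi|).
  by apply/L1_integrable; apply: integrable_norm; exact/L1_integrable.
rewrite -lee_fin -nint_L1//.
apply: (le_trans (le_normr_Rint wL.1)); apply: nint_le => xi //.
by rewrite normrM ler_piMr// ler_norml cos_geN1 cos_le1.
Qed.

(** Integration by parts over [[0, 3]], at whose endpoints the amplitude vanishes. Each use trades a
    factor [2 * pi * x] for a derivative of the amplitude and a phase shift of a quarter turn. *)
Lemma wave_ibp n a th x : amp n.+1 a ->
  2 * pi * x * wave a th x = wave (derive1 a) (th + pi / 2) x.
Proof.
move=> ha; have [[da ca] a0] := ha; have ha' := amp_derive ha.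
have [cw wL] := wave_integrand th x ha.
have [cw' wL'] := wave_integrand (th + pi / 2) x ha'.
pose F xi := a xi * sin (2 * pi * (x * xi) + th).
have dF (xi : R) : is_derive xi 1 F
    (2 * pi * x * (a xi * cos (2 * pi * (x * xi) + th)) -
     derive1 a xi * cos (2 * pi * (x * xi) + (th + pi / 2))).
  have h1 : is_derive xi 1 a (derive1 a xi) by rewrite derive1E; exact/derivableP.
  have h2 : is_derive xi 1 (fun xi : R => sin (2 * pi * (x * xi) + th))
     (2 * pi * x * cos (2 * pi * (x * xi) + th)).
    have := is_derive_sin_affine (2 * pi * x) th xi.
    rewrite (_ : (fun xi : R => sin (2 * pi * x * xi + th)) = (fun xi : R => sin (2 * pi * (x * xi) + th))).
      by rewrite (_ : 2 * pi * x * xi = 2 * pi * (x * xi)); last ring.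
    by apply/funext => t; rewrite mulrA.
  apply: (is_derive_eq (is_deriveM h1 h2)).
  by rewrite cos_add_pihalf /GRing.scale/=; ring.
have := @Rint_FTC R F _ 0 3 ltac:(lra) dF.
have out (t : R) : t <= 0 \/ 3 <= t -> ~ (2^-1 <= t <= 2).
  by move=> h /andP[h1 h2]; have : 0 < (2:R)^-1 by []; case: h; lra.
rewrite /F !a0 ?mul0r ?subrr; last 2 first.
- by apply: out; left.
- by apply: out; right.
have e (xi : R) : (2 * pi * x * (a xi * cos (2 * pi * (x * xi) + th)) -
     derive1 a xi * cos (2 * pi * (x * xi) + (th + pi / 2))) * \1_(`[0, 3]) xi =
   2 * pi * x * (a xi * cos (2 * pi * (x * xi) + th)) +
   (-1) * (derive1 a xi * cos (2 * pi * (x * xi) + (th + pi / 2))).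
  rewrite mulN1r indicE; have [xi03|xi03] := boolP (xi \in _); first by rewrite mulr1.
  have xo : ~ (2^-1 <= xi <= 2).
    apply: out; move: xi03; rewrite notin_setE/= in_itv/= => /negP.
    by rewrite negb_and -!ltNge => /orP[h|h]; [left|right]; exact: ltW.
  by rewrite (a0 _ xo) ha'.2// !(mul0r,mulr0) subr0.
rewrite (_ : \int[mu]_xi (_ * _) = 2 * pi * x * wave a th x + (-1) * wave (derive1 a) (th + pi / 2) x); last first.
  transitivity (\int[mu]_xi (2 * pi * x * (a xi * cos (2 * pi * (x * xi) + th)) +
    (-1) * (derive1 a xi * cos (2 * pi * (x * xi) + (th + pi / 2))))).
    by apply: eq_Rintegral => xi _; exact: e.
  by rewrite RintD ?RintZ//; exact: L1Z.
move=> h; apply/eqP; rewrite -subr_eq0 -mulN1r; apply/eqP/h.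
move=> xi; apply: cvgB; last exact: cw'.
by apply: cvgM; [exact: cvg_cst|exact: cw].
Qed.

(** The weight expands to [1 + 2 x^2 + x^4]; the three terms are bounded after zero, two and four
    integrations by parts. *)
Lemma wave_decay a th : amp 4 a -> exists C, forall x, `|wave a th x| * (1 + x ^+ 2) ^+ 2 <= C.
Proof.
move=> ha.
have h1 := amp_derive ha; have h2 := amp_derive h1; have h3 := amp_derive h2; have h4 := amp_derive h3.
pose t2 := th + pi / 2 + pi / 2; pose t4 := t2 + pi / 2 + pi / 2.
have b0 := wave_bound th ha; have b2 := wave_bound t2 h2; have b4 := wave_bound t4 h4.
have e2 x : (2 * pi * x) ^+ 2 * wave a th x = wave (derive1 (derive1 a)) t2 x.
  by rewrite expr2 -mulrA (wave_ibp _ _ ha) (wave_ibp _ _ h1).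
have e4 x : (2 * pi * x) ^+ 4 * wave a th x = wave (derive1 (derive1 (derive1 (derive1 a)))) t4 x.
  rewrite (_ : (2 * pi * x) ^+ 4 = (2 * pi * x) ^+ 2 * (2 * pi * x) ^+ 2); last by rewrite -exprD.
  by rewrite -mulrA e2 expr2 -mulrA (wave_ibp _ _ h2) (wave_ibp _ _ h3).
eexists => x.
have pi2 : 2 <= pi :> R by exact: pi_ge2.
have up2 : x ^+ 2 <= (2 * pi * x) ^+ 2.
  by rewrite [leRHS]exprMn ler_peMl ?sqr_ge0// exprn_ege1//; lra.
have up4 : x ^+ 4 <= (2 * pi * x) ^+ 4.
  by rewrite [leRHS]exprMn ler_peMl ?exprn_even_ge0// exprn_ege1//; lra.
have [w [wE w0]] : exists w, w = `|wave a th x| /\ 0 <= w by exists `|wave a th x|.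
rewrite -wE.
have B0 := b0 x; rewrite -wE in B0.
have B2 : w * x ^+ 2 <= \int[mu]_xi `|derive1 (derive1 a) xi|.
  by apply: le_trans (b2 x); rewrite -e2 normrM -wE mulrC ler_wpM2r// ger0_norm ?sqr_ge0.
have B4 : w * x ^+ 4 <= \int[mu]_xi `|derive1 (derive1 (derive1 (derive1 a))) xi|.
  by apply: le_trans (b4 x); rewrite -e4 normrM -wE mulrC ler_wpM2r// ger0_norm ?exprn_even_ge0.
have -> : w * (1 + x ^+ 2) ^+ 2 = w + 2 * (w * x ^+ 2) + w * x ^+ 4 by ring.
have B2' := ler_wpM2l (ler0n R 2) B2.
exact: lerD (lerD B0 B2') B4.
Qed.

(** Differentiation under the integral multiplies the amplitude by [2 * pi * xi] and shifts the
    phase, so the derivative of a wave is a wave and has the same decay. *)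
Lemma is_derive_wave n a th (x : R) : amp n a ->
  is_derive x 1 (wave a th) (wave (fun xi => 2 * pi * xi * a xi) (th + pi / 2) x).
Proof.
move=> ha.
have ha' : amp n (fun xi => 2 * pi * xi * a xi).
  by apply: ampM => //; apply: CkM; [exact: Ck_cst|exact: Ck_id].
pose f (x xi : R) := a xi * cos (2 * pi * (x * xi) + th).
have df (z xi : R) : is_derive z 1 (fun z : R => f z xi)
   (2 * pi * xi * a xi * cos (2 * pi * (z * xi) + (th + pi / 2))).
  have h2 : is_derive z 1 (fun z : R => cos (2 * pi * (z * xi) + th))
     (- (2 * pi * xi) * sin (2 * pi * (z * xi) + th)).
    have := is_derive_cos_affine (2 * pi * xi) th z.
    rewrite (_ : (fun z : R => cos (2 * pi * xi * z + th)) = (fun z : R => cos (2 * pi * (z * xi) + th))).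
      by rewrite (_ : 2 * pi * xi * z = 2 * pi * (z * xi)); last ring.
    by apply/funext => t; rewrite -mulrA [xi * t]mulrC.
  apply: (is_derive_eq (is_deriveZ (a xi) h2)).
  by rewrite cos_add_pihalf /GRing.scale/=; ring.
pose G xi := `|2 * pi * xi * a xi|.
have GL : mu.-integrable setT (EFin \o G).
  by apply: integrable_norm; apply/L1_integrable; exact: (amp_L1 ha').
have Gub (z xi : R) : `|derive1 (fun z : R => f z xi) z| <= G xi.
  rewrite (derive1_eq (df z xi)) normrM ler_piMr//.
  by rewrite ler_norml cos_geN1 cos_le1.
have Ix : [set` `]x - 1, x + 1[] x by rewrite /= in_itv/=; apply/andP; split; lra.
have intf (z : R) : `](x - 1), (x + 1)[%classic z -> mu.-integrable setT (EFin \o f z).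
  by move=> _; apply/L1_integrable; have [] := wave_integrand th z ha.
have derf (z xi : R) : `](x - 1), (x + 1)[%classic z -> setT xi -> derivable (f ^~ xi) z 1.
  by move=> _ _; case: (df z xi).
apply: DeriveDef.
  exact: (@derivable_under_integral R _ _ mu f setT measurableT x _ _ Ix intf derf G (fun=> normr_ge0 _) GL (fun z xi _ _ => Gub z xi)).
rewrite -derive1E.
rewrite (@differentiation_under_integral R _ _ mu f setT measurableT x _ _ Ix intf derf G (fun=> normr_ge0 _) GL (fun z xi _ _ => Gub z xi)).
by apply: eq_Rintegral => xi _; rewrite /partial1of2 (derive1_eq (df x xi)).
Qed.

End OscillatoryIntegrals.

(** * From pointwise decay to the integral conditions on a profile *)

Section Profiles.
Context {R : realType}.
Local Notation mu := (@lebesgue_measure R).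
Implicit Types psi f g : R -> R.

Lemma nint_oneDsqrV : nint (fun x : R => (oneDsqr x)^-1)%R = (pi : R)%:E.
Proof.
rewrite /nint ge0_symfun_integralT; first last.
- by move=> x; rewrite /= /oneDsqr sqrrN.
- exact: continuous_oneDsqrV.
- by move=> x; rewrite invr_ge0 (le_trans ler01)// oneDsqr_ge1.
rewrite (_ : [set x | 0 <= x] = `[0, +oo[%classic); last first.
  by apply/seteqP; split => x /=; rewrite in_itv/= andbT.
by rewrite integral0y_oneDsqr -EFinM; congr EFin; field.
Qed.

(** A pointwise counterpart of [mother]. Fourth-order decay of [psi] makes [|u| * |psi u|]
    integrable, and second-order decay of the derivative gives the [L^1] Lipschitz condition. *)
Definition profile psi : Prop :=
  [/\ exists C, forall x, `|psi x| * oneDsqr x ^+ 2 <= C,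
      exists2 dpsi : R -> R, (forall x : R, is_derive x 1 psi (dpsi x)) &
        exists C, forall x, `|dpsi x| * oneDsqr x <= C &
      \int[mu]_x psi x = 0].

Let q0 (x : R) : 0 < oneDsqr x. Proof. exact: lt_le_trans ltr01 (oneDsqr_ge1 x). Qed.

Let mq : measurable_fun setT (fun x : R => (oneDsqr x)^-1).
Proof. by apply: continuous_measurable_fun; exact: continuous_oneDsqrV. Qed.

Let nintq (C : R) : 0 <= C -> nint (fun x : R => C * (oneDsqr x)^-1)%R = (C * pi)%:E.
Proof. by move=> C0; rewrite nintZ ?nint_oneDsqrV// => x; rewrite invr_ge0 ltW. Qed.

Lemma profile_continuous psi : profile psi -> continuous psi.
Proof. by move=> [_ [dpsi h _] _]; apply: derivable_cont => x; case: (h x). Qed.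

Let decay_le psi C x : `|psi x| * oneDsqr x ^+ 2 <= C -> `|psi x| * oneDsqr x <= C.
Proof.
by apply: le_trans; rewrite ler_wpM2l// expr2 ler_peMr ?oneDsqr_ge1// ltW.
Qed.

Lemma decay_L1 psi C : continuous psi -> (forall x, `|psi x| * oneDsqr x ^+ 2 <= C) -> L1 psi.
Proof.
move=> c hC; split; first exact: continuous_measurable_fun.
have C0 : 0 <= C by apply: le_trans (hC 0); rewrite mulr_ge0// sqr_ge0.
apply: (@le_lt_trans _ _ (nint (fun x : R => C * (oneDsqr x)^-1)%R)); last by rewrite nintq// ltry.
by apply: nint_le => x //; rewrite ler_pdivlMr// decay_le.
Qed.

Lemma profile_L1 psi : profile psi -> L1 psi.
Proof. by move=> hp; case: (hp) => -[C hC] _ _; exact: decay_L1 (profile_continuous hp) hC. Qed.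

Lemma profileD f g : profile f -> profile g -> profile (fun x => f x + g x).
Proof.
move=> hf hg; have fL := profile_L1 hf; have gL := profile_L1 hg.
case: hf => -[C hC] [df hdf [D hD]] f0; case: hg => -[C' hC'] [dg hdg [D' hD']] g0; split.
- exists (C + C') => x; apply: le_trans (lerD (hC x) (hC' x)).
  by rewrite -mulrDl ler_wpM2r ?sqr_ge0// ler_normD.
- exists (fun x => df x + dg x); first by move=> x; exact: is_deriveD.
  exists (D + D') => x; apply: le_trans (lerD (hD x) (hD' x)).
  by rewrite -mulrDl ler_wpM2r ?(ltW (q0 _))// ler_normD.
- by rewrite RintD// f0 g0 addr0.
Qed.

Lemma motherW psi (A B : R) : A <= B -> mother psi A -> mother psi B.
Proof.
move=> AB [[h1 h2] h3 h4 h5 h6]; split=> //.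
- by split=> // x; exact: le_trans (h2 x) AB.
- by apply: (le_trans h3); rewrite lee_fin.
- by apply: (le_trans h4); rewrite lee_fin.
- by move=> s s'; apply: (le_trans (h6 s s')); rewrite lee_fin ler_wpM2r.
Qed.

Lemma profile_mother psi : profile psi -> exists2 A, 0 < A & mother psi A.
Proof.
move=> hp; have c := profile_continuous hp; have [mpsi _] := profile_L1 hp.
case: hp => -[C hC] [dpsi hd [D hD]] int0.
have C0 : 0 <= C by apply: le_trans (hC 0); rewrite mulr_ge0// sqr_ge0.
have D0 : 0 <= D by apply: le_trans (hD 0); rewrite mulr_ge0// ltW.
have pi2 : 2 <= pi :> R by exact: pi_ge2.
have Cpi : C <= C * pi by rewrite ler_peMr//; lra.
have Dpi : 0 <= D * pi by rewrite mulr_ge0//; lra.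
have psiC x : `|psi x| <= C * (oneDsqr x)^-1 by rewrite ler_pdivlMr// decay_le.
have psi1 : (nint (fun x => `|psi x|)%R <= (C * pi)%:E)%E.
  by rewrite -nintq//; exact: nint_le.
have shiftq s : nint (fun t : R => (oneDsqr (s + t))^-1)%R = (pi : R)%:E.
  rewrite -nint_oneDsqrV -[RHS](@nint_shift R (fun x => (oneDsqr x)^-1) s).
  - by apply: eq_nint => t; rewrite addrC.
  - exact: continuous_oneDsqrV.
  - by move=> x; rewrite invr_ge0 ltW.
(* [C * pi] bounds the integrals of [|psi|] and of [|u| * |psi u|], twice that amount covers
   translations by more than 1, and [3 * (D * pi)] those by at most 1; the 1 makes the constant
   positive. *)
exists (1 + 3 * (C * pi) + 3 * (D * pi)); first by lra.
split=> //.
- split=> // x; apply: (le_trans (psiC x)).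
  by apply: (@le_trans _ _ C); [rewrite ler_piMr// invf_le1// oneDsqr_ge1|lra].
- by apply: (le_trans psi1); rewrite lee_fin; lra.
- apply: (@le_trans _ _ (C * pi)%:E); last by rewrite lee_fin; lra.
  rewrite -nintq//; apply: nint_le => x; first by rewrite mulr_ge0.
  rewrite ler_pdivlMr//; apply: le_trans (hC x); rewrite expr2 [`|x| * _]mulrC -!mulrA ler_wpM2l//.
  rewrite ler_wpM2r ?(ltW (q0 x))// /oneDsqr -[x ^+ 2]real_normK ?num_real//.
  by have := sqr_ge0 (`|x| - 1); rewrite sqrrB1; have := normr_ge0 x; lra.
(* Beyond distance 1 the triangle inequality suffices, as the right side is at least [A]. Within
   distance 1 the mean value theorem applies, and moving the evaluation point by at most 1 changes
   [oneDsqr] by a factor of at most 3. *)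
move=> s s'; have [h1|h1] := leP `|s - s'| 1; last first.
  apply: (@le_trans _ _ (nint (fun t => `|psi (s + t)| + `|psi (s' + t)|)%R)).
    by apply: nint_le => t //; exact: ler_normB.
  rewrite nintD//; [|by meas|by meas].
  have sh z : nint (fun t => `|psi (z + t)|)%R = nint (fun x => `|psi x|)%R.
    rewrite -[RHS](@nint_shift R (fun x => `|psi x|) z)//; last exact: continuous_norm.
    by apply: eq_nint => t; rewrite addrC.
  rewrite !sh; apply: (le_trans (leeD psi1 psi1)); rewrite -EFinD lee_fin.
  set h := `|_|.
  apply: (@le_trans _ _ ((C * pi + C * pi) * 1)); first by rewrite mulr1.
  by apply: ler_pM; [lra|exact: ler01|lra|exact: ltW].
apply: (@le_trans _ _ (nint (fun t => (3 * D * `|s - s'|) * (oneDsqr (s' + t))^-1)%R)).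
  apply: nint_le => t //.
  have [z [zs ->]] : exists z, `|z - (s' + t)| <= 1 /\
      `|psi (s + t) - psi (s' + t)| = `|dpsi z| * `|s - s'|.
    have st : s - s' = (s + t) - (s' + t) by ring.
    have [lt|lt] := leP (s' + t) (s + t).
      have [z zi e] := @MVT_segment R psi dpsi _ _ lt (fun x _ => hd x) (continuous_subspaceT c).
      exists z; split; last by rewrite e normrM -st.
      move: zi; rewrite in_itv/= => /andP[z1 z2].
      have : s - s' <= 1 by apply: le_trans h1; exact: ler_norm.
      by rewrite ler_norml; move: z1 z2; lra.
    have [z zi e] := @MVT_segment R psi dpsi _ _ (ltW lt) (fun x _ => hd x) (continuous_subspaceT c).
    exists z; split; last by rewrite distrC e normrM [s - s']st distrC.
    move: zi; rewrite in_itv/= => /andP[z1 z2].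
    have : - (s - s') <= 1 by apply: le_trans h1; rewrite -normrN; exact: ler_norm.
    by rewrite ler_norml; move: z1 z2; lra.
  rewrite ler_pdivlMr// mulrAC [3 * D]mulrC -mulrA -!mulrA.
  set y := s' + t in zs *.
  have hq : oneDsqr y <= 3 * oneDsqr z.
    rewrite /oneDsqr; have : (y - z) ^+ 2 <= 1.
      by rewrite -[_ ^+ 2]real_normK ?num_real// distrC exprn_ile1.
    by have := sqr_ge0 (2 * z - y); have := sqr_ge0 z; lra.
  have key : `|dpsi z| * oneDsqr y <= D * 3.
    apply: (@le_trans _ _ (`|dpsi z| * (3 * oneDsqr z))); first by rewrite ler_wpM2l.
    by rewrite mulrCA mulrC ler_wpM2r// hD.
  by have := ler_wpM2r (normr_ge0 (s - s')) key; rewrite -!mulrA.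
rewrite nintZ//; last 2 first.
- apply: continuous_measurable_fun.
  exact: (@continuous_shift_abs R (fun x : R => (oneDsqr x)^-1) s' (@continuous_oneDsqrV R)).
- by rewrite !mulr_ge0.
rewrite shiftq -EFinM lee_fin mulrAC ler_wpM2r//; lra.
Qed.

Lemma cvg_natV : (N%:R : R)^-1 @[N --> \oo] --> 0.
Proof. by rewrite -cvg_shiftS; exact: cvg_harmonic. Qed.

(* The wave of [a] is the derivative of the wave of [a xi / (2 pi xi)], which
   vanishes at infinity; hence it has mean zero. *)
Lemma wave_profile a (th : R) : amp 5 a -> profile (wave a th).
Proof.
move=> ha; have ha4 : amp 4 a by split; [exact: CkW ha.1|exact: ha.2].
have ha' : amp 4 (fun xi => 2 * pi * xi * a xi).
  by apply: ampM => //; apply: CkM; [exact: Ck_cst|exact: Ck_id].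
have hb : amp 5 (fun xi => (2 * pi)^-1 * (a xi / xi)).
  by apply: ampM; [exact: Ck_cst|exact: amp_div].
have hb4 : amp 4 (fun xi => (2 * pi)^-1 * (a xi / xi)).
  by split; [exact: CkW hb.1|exact: hb.2].
have [C hC] := wave_decay th ha4.
have [D hD] := wave_decay (th + pi / 2) ha'.
have [E hE] := wave_decay (th - pi / 2) hb4.
set F := wave _ (th - pi / 2) in hE.
have dF (x : R) : is_derive x 1 F (wave a th x).
  have := is_derive_wave (th - pi / 2) x hb.
  rewrite (_ : th - pi / 2 + pi / 2 = th); last by ring.
  rewrite (_ : (fun xi => 2 * pi * xi * _) = a)//; apply/funext => xi.
  (* At the origin both sides vanish: the left by its factor [xi], and [a] because 0 lies outside
     its support. *)
  have [xi0|xi0] := eqVneq xi 0; last first.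
    have pin : 2 * (pi : R) != 0 by rewrite mulf_neq0// gt_eqF// pi_gt0.
    by rewrite mulrACA mulfV// mul1r mulrC divfK.
  rewrite xi0 mulr0 mul0r ha.2// => /andP[h _]; have : 0 < (2 : R)^-1 by [].
  by lra.
have cw : continuous (wave a th).
  by apply: derivable_cont => x; case: (is_derive_wave th x ha).
have pr0 : \int[mu]_x wave a th x = 0 -> profile (wave a th).
  move=> w0; split=> //; first by exists C.
  exists (wave (fun xi => 2 * pi * xi * a xi) (th + pi / 2)).
    by move=> x; exact: (is_derive_wave th x ha).
  by exists D => x; exact: decay_le (hD x).
have wL : L1 (wave a th) := decay_L1 cw hC.
apply: pr0.
have cv1 : \int[mu]_x (wave a th x * \1_(`[- N%:R, N%:R]) x) @[N --> \oo] --> \int[mu]_x wave a th x.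
  have [mw _] := wL.
  have mI (N : nat) : measurable_fun setT (\1_(`[- N%:R, N%:R]%classic) : R -> R).
    by apply: measurable_indic; exact: measurable_itv.
  have h : (\int[mu]_x (wave a th x * \1_(`[- N%:R, N%:R]) x)%:E)%E @[N --> \oo] -->
      (\int[mu]_x (wave a th x)%:E)%E.
    have [] // := @dominated_convergence _ _ _ mu setT measurableT
      (fun N x => (wave a th x * \1_(`[- N%:R, N%:R]) x)%:E) (fun x => (wave a th x)%:E)
      (fun x => (`|wave a th x|)%:E).
    - by move=> N; apply/measurable_EFinP; apply: measurable_funM.
    - exact/measurable_EFinP.
    - apply: aeW => x _; apply: cvg_near_cst; near=> N.
      rewrite indicE mem_set ?mulr1//= in_itv/= -ler_norml.
      by near: N; exact: nbhs_infty_ger.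
    - by apply: integrable_norm; exact/L1_integrable.
    - apply: aeW => x N _; rewrite /= lee_fin normrM ler_piMr//.
      by rewrite indicE; case: (_ \in _); rewrite ?normr1 ?normr0.
  have fin : (\int[mu]_x (wave a th x)%:E)%E \is a fin_num.
    by apply: integrable_fin_num => //; exact/L1_integrable.
  by have := fine_cvg; rewrite /Rintegral => G; apply: G; rewrite fineK.
have cv2 : \int[mu]_x (wave a th x * \1_(`[- N%:R, N%:R]) x) @[N --> \oo] --> 0.
  have E0 : 0 <= E by apply: le_trans (hE 0); rewrite mulr_ge0// sqr_ge0.
  have FE x : 1 <= `|x| -> `|F x| <= E / `|x|.
    move=> x1; rewrite ler_pdivlMr ?(lt_le_trans ltr01)//; apply: le_trans (hE x).
    rewrite ler_wpM2l// -[x ^+ 2]real_normK ?num_real//.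
    set u := `|x| in x1 *.
    have u2 : u <= 1 + u ^+ 2 by have := ler_wpM2l (_ : 0 <= u) x1; rewrite -expr2 mulr1; move=> /(_ ltac:(lra)); lra.
    by apply: (le_trans u2); rewrite expr2 ler_peMr//; have := sqr_ge0 u; lra.
  apply: (@squeeze_cvgr _ _ _ _ (fun N : nat => - (2 * E * N%:R^-1)) (fun N : nat => 2 * E * N%:R^-1)).
  - near=> N.
    have N0 : 1 <= N%:R :> R by near: N; exact: nbhs_infty_ger.
    rewrite (Rint_FTC _ dF)//; last by lra.
    rewrite -ler_norml; apply: (le_trans (ler_normB _ _)).
    have -> : 2 * E * N%:R^-1 = E / N%:R + E / N%:R by ring.
    have NN : `|N%:R| = N%:R :> R by rewrite ger0_norm.
    apply: lerD; first by rewrite -{2}NN FE// NN.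
    by rewrite -{2}NN -[`|N%:R|]normrN FE// normrN NN.
  - rewrite -oppr0; apply: cvgN; rewrite -[X in _ --> X](mulr0 (2 * E)).
    by apply: cvgM; [exact: cvg_cst|exact: cvg_natV].
  - rewrite -[X in _ --> X](mulr0 (2 * E)).
    by apply: cvgM; [exact: cvg_cst|exact: cvg_natV].
by rewrite -(cvg_lim _ cv1)// (cvg_lim _ cv2).
Unshelve. all: by end_near. Qed.

End Profiles.

(** * The kernels of the pieces as dilates of two real profiles *)

Section BumpKernels.
Context {R : realType}.
Local Notation mu := (@lebesgue_measure R).

Lemma Ck_of_smooth (a : R -> R) n : (forall n (x : R), derivable (derive1n n a) x 1) -> Ck n a.
Proof.
move=> h; have : forall k, Ck n (derive1n k a); last by move=> /(_ 0%N).
elim: n => [|n IH] k /=; first exact: derivable_cont.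
by split=> //; exact: (IH k.+1).
Qed.

Lemma bump_amp (phi : R -> R[i]) n : bump_on (2^-1) 2 phi ->
  amp n (fun x => complex.Re (phi x)) /\ amp n (fun x => complex.Im (phi x)).
Proof.
move=> [sm su].
have z (x : R) : ~ (2^-1 <= x <= 2) -> phi x = 0.
  move=> xo; apply/eqP; apply: contra_notT xo => /su/=.
  by rewrite in_itv.
by split; (split; [by apply: Ck_of_smooth => k x; case: (sm k x) | by move=> x /z ->]).
Qed.

(** The real part of the inverse Fourier transform of [phi], that is, [Re phi * cos - Im phi * sin]
    integrated, with [- sin t] written as a cosine advanced by [pi / 2]; the explicit [0 +] is the
    shape of [cos_add_pihalf]. *)
Definition psi_re (phi : R -> R[i]) (x : R) : R :=
  wave (fun xi => complex.Re (phi xi)) 0 x + wave (fun xi => complex.Im (phi xi)) (0 + pi / 2) x.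

Definition psi_im (phi : R -> R[i]) (x : R) : R :=
  wave (fun xi => complex.Re (phi xi)) (- (pi / 2)) x + wave (fun xi => complex.Im (phi xi)) 0 x.

Lemma Re_mul (u v : R[i]) : complex.Re (u * v) = complex.Re u * complex.Re v - complex.Im u * complex.Im v.
Proof. by case: u => a b; case: v. Qed.

Lemma Im_mul (u v : R[i]) : complex.Im (u * v) = complex.Re u * complex.Im v + complex.Im u * complex.Re v.
Proof. by case: u => a b; case: v. Qed.

Lemma wave_dilate (a b : R -> R) (th th' : R) n (D y : R) : 0 < D -> amp n a -> amp n b ->
  \int[mu]_xi (a (xi / D) * cos (2 * pi * (y * (xi / D)) + th) +
               b (xi / D) * cos (2 * pi * (y * (xi / D)) + th')) =
  D * (wave a th y + wave b th' y).
Proof.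
move=> D0 ha hb; have [c1 L1a] := wave_integrand th y ha; have [c2 L1b] := wave_integrand th' y hb.
pose F xi := a xi * cos (2 * pi * (y * xi) + th) + b xi * cos (2 * pi * (y * xi) + th').
have cF : continuous F by move=> x; apply: cvgD; [exact: c1|exact: c2].
have := @Rint_affine R F D^-1 0 _ cF (L1D L1a L1b).
have -> : \int[mu]_x F x = wave a th y + wave b th' y by rewrite /F RintD.
rewrite invr_gt0 invrK => /(_ D0) <-.
by apply: eq_Rintegral => xi _; rewrite addr0 [D^-1 * _]mulrC.
Qed.

(** A change of variables in the inverse transform: the modulation adds [2 ^+ m] to the rescaled
    position in the phase, and rescaling the frequency produces the factor in front. The profiles
    are built from [fourier Phi1] directly. *)
Lemma Phi_dil (Phi1 : R -> R[i]) (L M j : int) (m : nat) (x : R) :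
  bump_on (2^-1) 2 (fourier Phi1) ->
  complex.Re (Phi Phi1 L M j m x) = dil (psi_re (fourier Phi1)) (L * j + M) (2 ^+ m) x /\
  complex.Im (Phi Phi1 L M j m x) = dil (psi_im (fourier Phi1)) (L * j + M) (2 ^+ m) x.
Proof.
move=> hb; have [ha ha'] := bump_amp 0 hb; have D0 := @exp2z_gt0 R (L * j + M).
rewrite /dil /psi_re /psi_im -!(wave_dilate _ _ _ D0 ha ha') /Phi /inv_fourier /Phi_hat.
move: (fourier Phi1) => phi.
have e (xi : R) : 2 * pi * (2 ^+ m * xi / dyadic L M j) + 2 * pi * (x * xi) =
    2 * pi * ((2 ^ (L * j + M) * x + 2 ^+ m) * (xi / 2 ^ (L * j + M))).
  by rewrite /dyadic; field; rewrite gt_eqF.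
split; apply: eq_Rintegral => xi _; rewrite !(Re_mul, Im_mul)/=.
- rewrite cos_add_pihalf addr0 -e cosD sinD; ring.
- rewrite addr0 -e cosBpihalf cosD sinD; ring.
Qed.

Lemma psi_profile (phi : R -> R[i]) : bump_on (2^-1) 2 phi -> profile (psi_re phi) /\ profile (psi_im phi).
Proof.
by move=> /(bump_amp 5) [ha hb]; split; apply: profileD; exact: wave_profile.
Qed.

End BumpKernels.

(** * Paraproducts *)

Section SeriesAndHoelder.
Context {R : realType}.
Local Notation mu := (@lebesgue_measure R).

(** The limit is taken in the extended reals, since it may be infinite on a null set. Finiteness of
    its integral then makes it finite almost everywhere, which is how the convergence of the
    paraproduct series is obtained. *)
Lemma monotone_limit (H : nat -> R -> R) (B : \bar R) :
  (forall n, measurable_fun setT (H n)) -> (forall n x, 0 <= H n x) ->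
  (forall n x, H n x <= H n.+1 x) -> (forall n, nint (H n) <= B)%E ->
  exists H' : R -> \bar R, [/\ measurable_fun setT H', forall n x, ((H n x)%:E <= H' x)%E &
    (\int[mu]_x H' x <= B)%E].
Proof.
move=> mH H0 Hnd HB.
have nd (x : R) : nondecreasing_seq (fun n => (H n x)%:E).
  by apply/nondecreasing_seqP => n; rewrite lee_fin.
have cv (x : R) : cvgn (fun n => (H n x)%:E) by apply: ereal_nondecreasing_is_cvgn; exact: nd.
have mE n : measurable_fun setT (fun x => (H n x)%:E) by exact/measurable_EFinP.
exists (fun x => limn (fun n => (H n x)%:E)); split.
- apply: (emeasurable_fun_cvg (fun n x => (H n x)%:E)) => // x _; exact: cv.
- by move=> n x; apply: lime_ge; [exact: cv|near=> k; apply: nd; near: k; exact: nbhs_infty_ge].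
- rewrite (@monotone_convergence _ _ _ mu setT measurableT (fun n x => (H n x)%:E)) => //.
  + apply: lime_le; last by apply: nearW => n; exact: HB.
    apply: ereal_nondecreasing_is_cvgn; apply/nondecreasing_seqP => n.
    by apply: nint_le.
  + by move=> n x _; rewrite lee_fin.
Unshelve. all: by end_near. Qed.

(** Young's inequality with the conjugate exponents [p1 / r] and [p2 / r] is applied to the [r]-th
    powers of [Q1 / D1] and [Q2 / D2], and the coefficients satisfy [r / p1 + r / p2 = 1]. The
    argument includes the quasi-norm range [r < 1]. *)
Lemma hoelder_nint (p1 p2 r D1 D2 : R) (Q1 Q2 : R -> R) : 0 < r -> 0 < p1 -> 0 < p2 ->
  p1^-1 + p2^-1 = r^-1 -> 0 < D1 -> 0 < D2 ->
  measurable_fun setT Q1 -> measurable_fun setT Q2 -> (forall x, 0 <= Q1 x) -> (forall x, 0 <= Q2 x) ->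
  (nint (fun x => Q1 x `^ p1)%R <= (D1 `^ p1)%:E)%E ->
  (nint (fun x => Q2 x `^ p2)%R <= (D2 `^ p2)%:E)%E ->
  (nint (fun x => (Q1 x * Q2 x) `^ r)%R <= ((D1 * D2) `^ r)%:E)%E.
Proof.
move=> r0 p10 p20 pr D10 D20 m1 m2 Q10 Q20 h1 h2.
have young x : (Q1 x * Q2 x) `^ r <= (D1 * D2) `^ r *
    (r / p1 * (D1 `^ p1)^-1 * Q1 x `^ p1 + r / p2 * (D2 `^ p2)^-1 * Q2 x `^ p2).
  have e (D Q p : R) : 0 < D -> 0 <= Q -> 0 < p -> ((D^-1 * Q) `^ r) `^ (p / r) = (D `^ p)^-1 * Q `^ p.
    move=> D0 Q0 p0; rewrite -powRrM (_ : r * (p / r) = p); last by field; rewrite gt_eqF.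
    rewrite powRM// ?invr_ge0 ?(ltW D0)//; congr (_ * _).
    by rewrite -[D^-1]powR_inv1 ?(ltW D0)// -powRrM mulN1r powRN.
  have q1 : 0 < p1 / r by rewrite divr_gt0.
  have q2 : 0 < p2 / r by rewrite divr_gt0.
  have pq : (p1 / r)^-1 + (p2 / r)^-1 = 1.
    by rewrite !invf_div -mulrDr pr mulfV// gt_eqF.
  have := conjugate_powR (powR_ge0 (D1^-1 * Q1 x) r) (powR_ge0 (D2^-1 * Q2 x) r) q1 q2 pq.
  rewrite !e// !invf_div => h.
  have -> : Q1 x * Q2 x = (D1 * D2) * ((D1^-1 * Q1 x) * (D2^-1 * Q2 x)).
    by field; rewrite !gt_eqF.
  have d1 : 0 <= D1^-1 * Q1 x by rewrite mulr_ge0// invr_ge0 ltW.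
  have d2 : 0 <= D2^-1 * Q2 x by rewrite mulr_ge0// invr_ge0 ltW.
  rewrite [leLHS]powRM; [|by rewrite mulr_ge0// ltW|exact: mulr_ge0].
  apply: ler_wpM2l; first exact: powR_ge0.
  rewrite [leLHS]powRM//; apply: (le_trans h); rewrite le_eqVlt; apply/orP; left; apply/eqP; ring.
have mQ1 : measurable_fun setT (fun x => Q1 x `^ p1) by exact: measurable_powRf.
have mQ2 : measurable_fun setT (fun x => Q2 x `^ p2) by exact: measurable_powRf.
have c0 (D p : R) : 0 < p -> 0 <= r / p * (D `^ p)^-1.
  by move=> p0; rewrite mulr_ge0// ?invr_ge0 ?powR_ge0// divr_ge0 ?ltW.
have pos (c : R) (Q : R -> R) p : 0 <= c -> forall x, 0 <= c * Q x `^ p.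
  by move=> ? x; rewrite mulr_ge0 ?powR_ge0.
apply: (le_trans (nint_le (fun x => powR_ge0 _ _) young)).
rewrite nintZ; last 3 first.
- by apply: measurable_funD; apply: measurable_funM.
- by move=> x; rewrite addr_ge0 ?pos ?c0.
- exact: powR_ge0.
rewrite -[leRHS]mule1; apply: lee_wpmul2l; first by rewrite lee_fin powR_ge0.
rewrite nintD; last 4 first.
- by apply: measurable_funM.
- by apply: measurable_funM.
- by apply: pos; exact: c0.
- by apply: pos; exact: c0.
rewrite !nintZ//; try exact: c0; try (by move=> x; exact: powR_ge0).
have step (D p : R) (X : \bar R) : 0 < D -> 0 < p -> (X <= (D `^ p)%:E)%E ->
    ((r / p * (D `^ p)^-1)%:E * X <= (r / p)%:E)%E.
  move=> D0 p0 X1; apply: (le_trans (lee_wpmul2l _ X1)); first by rewrite lee_fin c0.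
  by rewrite -EFinM lee_fin divfK// gt_eqF// powR_gt0.
apply: (le_trans (leeD (step _ _ _ D10 p10 h1) (step _ _ _ D20 p20 h2))).
by rewrite -EFinD lee_fin -mulrDr pr mulfV// gt_eqF.
Qed.

Lemma series_abs_bounded (u : nat -> R) (B : R) :
  (forall n, \sum_(i < n) `|u i| <= B) -> cvgn (series u).
Proof.
move=> uB; apply: normed_cvg; apply: nondecreasing_is_cvgn.
  by apply/nondecreasing_seqP => n; rewrite /= /series/= big_nat_recr//= lerDl.
by exists B => _ [n _ <-]; rewrite /= /series/= big_mkord.
Qed.

Lemma zseries_bounded (u : int -> R) (B : R) :
  (forall n, \sum_(i < n) (`|u (Posz i)| + `|u (Negz i)|) <= B) ->
  zseries_cvg u /\ `|zseries u| <= B.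
Proof.
move=> uB.
have c1 : cvgn (series (fun n => u (Posz n))).
  apply: (@series_abs_bounded _ B) => n; apply: le_trans (uB n).
  by apply: ler_sum => i _; rewrite lerDl.
have c2 : cvgn (series (fun n => u (Negz n))).
  apply: (@series_abs_bounded _ B) => n; apply: le_trans (uB n).
  by apply: ler_sum => i _; rewrite lerDr.
split=> //; rewrite /zseries.
have cv : (fun n => series (fun n => u (Posz n)) n + series (fun n => u (Negz n)) n) @ \oo -->
   limn (series (fun n => u (Posz n))) + limn (series (fun n => u (Negz n))) by exact: cvgD.
rewrite -(cvg_lim _ cv)//.
have bd n : `|series (fun n => u (Posz n)) n + series (fun n => u (Negz n)) n| <= B.
  rewrite /series/= !big_mkord -big_split/=; apply: le_trans (uB n).
  by apply: (le_trans (ler_norm_sum _ _ _)); apply: ler_sum => i _; exact: ler_normD.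
have cc := cvgP _ cv.
rewrite ler_norml; apply/andP; split.
  by apply: limr_ge => //; apply: nearW => n; have := bd n; rewrite ler_norml => /andP[].
by apply: limr_le => //; apply: nearW => n; have := bd n; rewrite ler_norml => /andP[].
Qed.

Lemma normc_ge_Re (z : R[i]) : `|complex.Re z| <= Normc.normc z.
Proof. by case: z => a b /=; rewrite -sqrtr_sqr ler_wsqrtr// lerDl sqr_ge0. Qed.

Lemma normc_ge_Im (z : R[i]) : `|complex.Im z| <= Normc.normc z.
Proof. by case: z => a b /=; rewrite -sqrtr_sqr ler_wsqrtr// lerDr sqr_ge0. Qed.

Lemma normc_ge0 (z : R[i]) : 0 <= Normc.normc z.
Proof. by case: z => a b /=; exact: sqrtr_ge0. Qed.

Lemma normc_le (z : R[i]) : Normc.normc z <= `|complex.Re z| + `|complex.Im z|.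
Proof.
case: z => a b /=; rewrite -[leRHS]ger0_norm ?addr_ge0// -sqrtr_sqr ler_wsqrtr//.
have ab : 0 <= `|a| * `|b| by rewrite mulr_ge0.
by rewrite sqrrD !real_normK ?num_real//; lra.
Qed.

Lemma czseries_bounded (u : int -> R[i]) (B : R) :
  (forall n, \sum_(i < n) (Normc.normc (u (Posz i)) + Normc.normc (u (Negz i))) <= B) ->
  czseries_cvg u /\ Normc.normc (czseries u) <= 2 * B.
Proof.
move=> uB.
have [c1 b1] : zseries_cvg (fun j => complex.Re (u j)) /\ `|zseries (fun j => complex.Re (u j))| <= B.
  apply: zseries_bounded => n; apply: le_trans (uB n); apply: ler_sum => i _.
  by apply: lerD; exact: normc_ge_Re.
have [c2 b2] : zseries_cvg (fun j => complex.Im (u j)) /\ `|zseries (fun j => complex.Im (u j))| <= B.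
  apply: zseries_bounded => n; apply: le_trans (uB n); apply: ler_sum => i _.
  by apply: lerD; exact: normc_ge_Im.
split=> //; apply: (le_trans (normc_le _)) => /=; lra.
Qed.

(** With [c = eps * ln 2 / 2] the exponential is the square of [expR (c * m)], and [m + 1 <= (1 + 1
    / c) * (1 + c * m) <= (1 + 1 / c) * expR (c * m)]. *)
Lemma sqr_succ_le_exp (eps : R) (m : nat) : 0 < eps ->
  m.+1%:R ^+ 2 <= (1 + 2 / (eps * ln 2)) ^+ 2 * 2 `^ (eps * m%:R).
Proof.
move=> e0; have l0 : 0 < ln (2 : R) by rewrite ln_gt0// ltr1n.
pose c := eps * ln 2 / 2; have c0 : 0 < c by rewrite /c !mulr_gt0// invr_gt0.
have -> : 2 / (eps * ln 2) = c^-1 by rewrite /c; field; rewrite !gt_eqF.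
have -> : 2 `^ (eps * m%:R) = expR (c * m%:R) ^+ 2.
  rewrite /powR gt_eqF// -expRM_natl; congr expR; by rewrite /c; field.
rewrite -exprMn lerXn2r ?nnegrE ?mulr_ge0 ?expR_ge0//; first by rewrite addr_ge0// invr_ge0 ltW.
apply: (@le_trans _ _ ((1 + c^-1) * (1 + c * m%:R))).
  have -> : (1 + c^-1) * (1 + c * m%:R) = m.+1%:R + (c * m%:R + c^-1).
    by rewrite -natr1; field; rewrite gt_eqF.
  by rewrite lerDl addr_ge0// ?invr_ge0 ?mulr_ge0// ltW.
by rewrite ler_wpM2l ?expR_ge1Dx// addr_ge0// invr_ge0 ltW.
Qed.

End SeriesAndHoelder.

(** * Domination of the partial sums by products of square functions *)

Section Majorant.
Context {R : realType}.
Local Notation mu := (@lebesgue_measure R).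

Lemma le_vnorm (I : finType) (u v : I -> R) : (forall i, 0 <= u i) -> (forall i, u i <= v i) ->
  vnorm u <= vnorm v.
Proof.
move=> u0 uv; rewrite /vnorm ler_wsqrtr//; apply: ler_sum => i _.
by apply: lerXn2r => //; rewrite nnegrE// (le_trans (u0 i)).
Qed.

Lemma vnorm_normr (I : finType) (u : I -> R) : vnorm (fun i => `|u i|) = vnorm u.
Proof.
by rewrite /vnorm; congr Num.sqrt; apply: eq_bigr => i _; rewrite real_normK// num_real.
Qed.

Lemma vnorm_sum (I T : finType) (u : T -> I -> R) :
  vnorm (fun i => \sum_t u t i) <= \sum_t vnorm (u t).
Proof.
elim: (index_enum T) => [|t s IH].
  rewrite big_nil /vnorm big1 ?sqrtr0// => i _; by rewrite big_nil expr0n.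
rewrite big_cons; apply: le_trans (lerD (lexx _) IH).
apply: le_trans (vnormD _ _).
by rewrite le_eqVlt; apply/orP; left; apply/eqP; congr vnorm; apply/funext => i; rewrite big_cons.
Qed.

(** The sum is at most [#|T|] times its largest term, and the power of that product is one of the
    summands on the right. *)
Lemma powR_sum (T : finType) (a : T -> R) (p : R) : 0 < p -> (forall t, 0 <= a t) ->
  (\sum_t a t) `^ p <= \sum_t (#|T|%:R * a t) `^ p.
Proof.
move=> p0 a0; case: (pickP (fun _ : T => true)) => [t0 _|T0]; last first.
  by rewrite !big_pred0// powR0// gt_eqF.
case: (@arg_maxP _ _ _ t0 predT a isT) => t1 _ ht.
apply: (@le_trans _ _ ((#|T|%:R * a t1) `^ p)); last first.
  by rewrite [leRHS](bigD1 t1)//= lerDl sumr_ge0// => t _; exact: powR_ge0.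
apply: le_powR; [exact: ltW|exact: sumr_ge0|].
apply: (@le_trans _ _ (\sum_(t : T) a t1)); first by apply: ler_sum => t _; exact: ht.
by rewrite sumr_const mulr_natl.
Qed.

Lemma big_pair_bool (T : finType) (F : T * bool -> R) :
  \sum_t F t = \sum_t F (t, true) + \sum_t F (t, false).
Proof.
rewrite (eq_bigr (fun p => F (p.1, p.2))); last by case.
rewrite -(pair_bigA _ (fun t b => F (t, b)))/= -big_split/=.
by apply: eq_bigr => t _; rewrite big_bool.
Qed.

Lemma big_bool2 (F : bool * bool -> R) :
  \sum_t F t = F (true, true) + F (false, true) + (F (true, false) + F (false, false)).
Proof. by rewrite big_pair_bool !big_bool. Qed.

Definition mpart (phi : R -> R[i]) (b : bool) := if b then psi_im phi else psi_re phi.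
Definition fpart (f : R -> R[i]) (b : bool) (x : R) := if b then complex.Im (f x) else complex.Re (f x).
(* The two halves of the sum over [j : int]; [Negz i] is [- i.+1]. *)
Definition scales (L M : int) (b : bool) (i : nat) : int := L * (if b then Negz i else Posz i) + M.

(* The eight square functions come from the real or imaginary part of the
   kernel, that of [f], and the sign of [j]. *)
Definition majorant (phi : R -> R[i]) (L M : int) (m : nat) (f : R -> R[i]) (n : nat) (x : R) : R :=
  \sum_(t : bool * bool * bool)
    square (mpart phi t.1.1) (scales L M t.2) (2 ^+ m) n (fpart f t.1.2) x.

(** Positivity of [L] separates consecutive scales by at least 1. For negative [j] the scales
    decrease, so the condition comes from the opposite sequence. *)
Lemma lacunary_scales (L M : int) b : 0 < L -> @lacunary R (scales L M b).
Proof.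
move=> L0; case: b; last first.
  by apply: lacunary_of_increasing => i; rewrite /scales; lia.
have -> : scales L M true = (fun i => - (L * (Posz i + 1) - M)).
  by apply/funext => i; rewrite /scales NegzE; lia.
by apply: lacunary_opp; apply: lacunary_of_increasing => i; lia.
Qed.

Lemma majorant_ge0 phi L M m f n x : 0 <= majorant phi L M m f n x.
Proof. by apply: sumr_ge0 => t _; exact: vnorm_ge0. Qed.

Lemma majorant_nd phi L M m f n x : majorant phi L M m f n x <= majorant phi L M m f n.+1 x.
Proof.
apply: ler_sum => t _; rewrite /square /vnorm ler_wsqrtr// big_ord_recr/= lerDl.
exact: sqr_ge0.
Qed.

Section Bound.
Variables (Phi1 : R -> R[i]) (p : R).
Hypothesis hb : bump_on (2^-1) 2 (fourier Phi1).
Hypothesis p1 : 1 < p.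

Lemma piece_le (L M : int) (m : nat) f (b : bool) (i : nat) x :
  (forall c, Lp p (fpart f c)) ->
  Normc.normc (piece Phi1 L M m f (if b then Negz i else Posz i) x) <=
  \sum_(t : bool * bool)
     `|conv (fpart f t.2) (dil (mpart (fourier Phi1) t.1) (scales L M b i) (2 ^+ m)) x|.
Proof.
move=> fL; set j := if b then _ else _.
have [hr hi] := psi_profile hb.
have [Ar _ mr] := profile_mother hr; have [Ai _ mi] := profile_mother hi.
have kk c : kernel (dil (mpart (fourier Phi1) c) (scales L M b i) (2 ^+ m)).
  by case: c; [exact: (dil_kernel mi)|exact: (dil_kernel mr)].
have IL c d := Lp_conv_integrand x p1 (fL c) (kk d).
pose K c := dil (mpart (fourier Phi1) c) (scales L M b i) (2 ^+ m).
have re y : complex.Re (f y * Phi Phi1 L M j m (x - y)) =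
    fpart f false y * K false (x - y) + (-1) * (fpart f true y * K true (x - y)).
  by rewrite Re_mul !(Phi_dil _ _ _ _ _ hb).1 !(Phi_dil _ _ _ _ _ hb).2 mulN1r.
have im y : complex.Im (f y * Phi Phi1 L M j m (x - y)) =
    fpart f false y * K true (x - y) + fpart f true y * K false (x - y).
  by rewrite Im_mul !(Phi_dil _ _ _ _ _ hb).1 !(Phi_dil _ _ _ _ _ hb).2.
apply: (le_trans (normc_le _)); rewrite /piece /convolution /cintegral/=.
have -> : \int[mu]_y complex.Re (f y * Phi Phi1 L M j m (x - y)) =
    conv (fpart f false) (K false) x + (-1) * conv (fpart f true) (K true) x.
  transitivity (\int[mu]_y (fpart f false y * K false (x - y) + (-1) * (fpart f true y * K true (x - y)))).
    by apply: eq_Rintegral => y _; exact: re.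
  rewrite RintD; [|exact: IL|by apply: L1Z; exact: IL].
  by rewrite RintZ//; exact: IL.
have -> : \int[mu]_y complex.Im (f y * Phi Phi1 L M j m (x - y)) =
    conv (fpart f false) (K true) x + conv (fpart f true) (K false) x.
  transitivity (\int[mu]_y (fpart f false y * K true (x - y) + fpart f true y * K false (x - y))).
    by apply: eq_Rintegral => y _; exact: im.
  by rewrite RintD//; exact: IL.
rewrite big_bool2 /=.
have four (c1 c2 c3 c4 : R) : `|c1 + -1 * c2| + `|c3 + c4| <= `|c2| + `|c4| + (`|c3| + `|c1|).
  by have := ler_normD c1 (- c2); have := ler_normD c3 c4; rewrite normrN mulN1r; lra.
exact: four.
Qed.

Lemma majorant_bound : exists2 C : R, 0 < C &
  forall (L M : int) (m n : nat) f (d : R), 0 < L -> (forall c, Lp p (fpart f c)) -> 0 <= d ->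
   (forall c, (nint (fun x => `|fpart f c x| `^ p)%R <= (d `^ p)%:E)%E) ->
   measurable_fun setT (majorant (fourier Phi1) L M m f n) /\
   (nint (fun x => majorant (fourier Phi1) L M m f n x `^ p)%R <= ((C * m.+1%:R * d) `^ p)%:E)%E.
Proof.
have [hr hi] := psi_profile hb.
have [Ar Ar0 mr] := profile_mother hr; have [Ai Ai0 mi] := profile_mother hi.
have hm c : mother (mpart (fourier Phi1) c) (Ar + Ai).
  by case: c; [apply: motherW mi|apply: motherW mr]; rewrite ?lerDl ?lerDr ltW.
have [C C0 hC] := square_Lp (addr_gt0 Ar0 Ai0) p1.
exists (64 * C); first by rewrite mulr_gt0.
move=> L M m n f d L0 fL d0 fd; have p0 := lt_trans ltr01 p1.
pose sq (t : bool * bool * bool) :=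
  square (mpart (fourier Phi1) t.1.1) (scales L M t.2) (2 ^+ m) n (fpart f t.1.2).
have h2 : `|2 ^+ m : R| <= 2 ^+ m by rewrite ger0_norm.
have hsq t : measurable_fun setT (sq t) /\
    (nint (fun x => sq t x `^ p)%R <= ((C * m.+1%:R * d) `^ p)%:E)%E.
  have [ms bs] := hC _ _ _ m n _ (hm t.1.1) (lacunary_scales M t.2 L0) h2 (fL t.1.2).
  split=> //; apply: (le_trans bs).
  have Cm : 0 <= C * m.+1%:R by rewrite mulr_ge0// ltW.
  have -> : (C * m.+1%:R * d) `^ p = (C * m.+1%:R) `^ p * d `^ p by rewrite powRM.
  rewrite EFinM; by apply: lee_wpmul2l; [rewrite lee_fin powR_ge0|exact: fd].
have mM : measurable_fun setT (majorant (fourier Phi1) L M m f n).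
  by apply: measurable_sum => t; case: (hsq t).
split=> //.
have msq t : measurable_fun setT (fun x => sq t x `^ p) by apply: measurable_powRf; case: (hsq t).
apply: (@le_trans _ _ (nint (fun x => \sum_t (8%:R `^ p * sq t x `^ p))%R)).
  apply: nint_le => x; first exact: powR_ge0.
  have sq0 t : 0 <= sq t x by exact: vnorm_ge0.
  apply: (le_trans (powR_sum p0 sq0)); apply: ler_sum => t _.
  by rewrite powRM// !card_prod card_bool.
rewrite nint_sum; last 2 first.
- by move=> t; apply: measurable_funM.
- by move=> t x; rewrite mulr_ge0 ?powR_ge0.
apply: (@le_trans _ _ (\sum_(t : bool * bool * bool) ((8 `^ p * (C * m.+1%:R * d) `^ p)%:E))%E).
  apply: lee_sum => t _; rewrite nintZ//; last by move=> x; exact: powR_ge0.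
  by rewrite EFinM; apply: lee_wpmul2l; [rewrite lee_fin powR_ge0|case: (hsq t)].
rewrite sumEFin lee_fin sumr_const !card_prod card_bool.
have X0 : 0 <= C * m.+1%:R * d by rewrite !mulr_ge0// ltW.
have -> : 64 * C * m.+1%:R * d = 8 * (8 * (C * m.+1%:R * d)) by ring.
have X8 : 0 <= 8 * (C * m.+1%:R * d) by rewrite mulr_ge0.
have pm (u : R) : 0 <= u -> (8 * u) `^ p = 8 `^ p * u `^ p by move=> ?; rewrite powRM.
have key (y : R) : 0 <= y -> y *+ (2 * 2 * 2) <= 8 `^ p * y.
  by move=> y0; rewrite -[leLHS]mulr_natl ler_wpM2r// le1r_powR ?ler1n// ltW.
by rewrite pm// pm//; apply: key; rewrite mulr_ge0 ?powR_ge0.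
Qed.

Lemma square_sum_le (L M : int) (m n : nat) f (b : bool) x : (forall c, Lp p (fpart f c)) ->
  vnorm (fun i : 'I_n => Normc.normc (piece Phi1 L M m f (if b then Negz i else Posz i) x)) <=
  \sum_(t : bool * bool)
    square (mpart (fourier Phi1) t.1) (scales L M b) (2 ^+ m) n (fpart f t.2) x.
Proof.
move=> fL; apply: (@le_trans _ _ (vnorm (fun i : 'I_n => \sum_(t : bool * bool)
     `|conv (fpart f t.2) (dil (mpart (fourier Phi1) t.1) (scales L M b i) (2 ^+ m)) x|))).
  by apply: le_vnorm => i; [exact: normc_ge0|exact: piece_le].
apply: (le_trans (vnorm_sum _)); apply: ler_sum => t _.
by rewrite vnorm_normr.
Qed.

End Bound.

Lemma majorant_split phi L M m f n x : majorant phi L M m f n x =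
  \sum_(t : bool * bool) square (mpart phi t.1) (scales L M true) (2 ^+ m) n (fpart f t.2) x +
  \sum_(t : bool * bool) square (mpart phi t.1) (scales L M false) (2 ^+ m) n (fpart f t.2) x.
Proof.
exact: (big_pair_bool (fun t => square (mpart phi t.1.1) (scales L M t.2) (2 ^+ m) n (fpart f t.1.2) x)).
Qed.

Lemma normcM (u v : R[i]) : Normc.normc (u * v) = Normc.normc u * Normc.normc v.
Proof. exact: Normc.normcM. Qed.

Lemma mul_sum_le (a b c d : R) : 0 <= a -> 0 <= b -> 0 <= c -> 0 <= d ->
  a * b + c * d <= (c + a) * (d + b).
Proof.
move=> a0 b0 c0 d0; have -> : (c + a) * (d + b) = a * b + c * d + (a * d + c * b) by ring.
by rewrite lerDl addr_ge0 ?mulr_ge0.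
Qed.

(** Cauchy-Schwarz is applied to each half of the integers separately; the sum of the two products
    is at most the product of the two sums. *)
Lemma paraproduct_partial (Phi1 : R -> R[i]) (p1 p2 : R) (L1 L2 M1 M2 : int) (m n : nat) f1 f2 x :
  bump_on (2^-1) 2 (fourier Phi1) -> 1 < p1 -> 1 < p2 ->
  (forall c, Lp p1 (fpart f1 c)) -> (forall c, Lp p2 (fpart f2 c)) ->
  \sum_(i < n) (Normc.normc (paraproduct_term Phi1 L1 L2 M1 M2 m f1 f2 x (Posz i)) +
                Normc.normc (paraproduct_term Phi1 L1 L2 M1 M2 m f1 f2 x (Negz i))) <=
  majorant (fourier Phi1) L1 M1 m f1 n x * majorant (fourier Phi1) L2 M2 m f2 n x.
Proof.
move=> hb p11 p21 fL1 fL2; rewrite big_split/= /paraproduct_term.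
have cs b : \sum_(i < n) Normc.normc (piece Phi1 L1 M1 m f1 (if b then Negz i else Posz i) x *
     piece Phi1 L2 M2 m f2 (if b then Negz i else Posz i) x) <=
   (\sum_(t : bool * bool) square (mpart (fourier Phi1) t.1) (scales L1 M1 b) (2 ^+ m) n (fpart f1 t.2) x) *
   (\sum_(t : bool * bool) square (mpart (fourier Phi1) t.1) (scales L2 M2 b) (2 ^+ m) n (fpart f2 t.2) x).
  under eq_bigr do rewrite normcM.
  apply: (le_trans (vnorm_cs (fun i : 'I_n => Normc.normc (piece Phi1 L1 M1 m f1 (if b then Negz i else Posz i) x))
    (fun i : 'I_n => Normc.normc (piece Phi1 L2 M2 m f2 (if b then Negz i else Posz i) x)))).
  apply: ler_pM; [exact: vnorm_ge0|exact: vnorm_ge0| |].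
    exact: (square_sum_le hb p11).
  exact: (square_sum_le hb p21).
rewrite !majorant_split; have := cs true; have := cs false => /=.
set a := \sum_(t : bool * bool) _; set b := \sum_(t : bool * bool) _.
set c := \sum_(t : bool * bool) _; set d := \sum_(t : bool * bool) _ => h1 h2.
have ge0 (F' : bool * bool -> R) : (forall t, 0 <= F' t) -> 0 <= \sum_t F' t by move=> ?; exact: sumr_ge0.
have [a0 b0 c0 d0] : [/\ 0 <= a, 0 <= b, 0 <= c & 0 <= d].
  by split; apply: ge0 => t; exact: vnorm_ge0.
apply: (le_trans (lerD h1 h2)); exact: mul_sum_le.
Qed.

End Majorant.

(** * Convergence and norm bound of the paraproduct *)

Section Paraproducts.
Context {R : realType}.
Local Notation mu := (@lebesgue_measure R).

(** The bound is offered for every [d'] above the norm [d], so that a strictly positive value can be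
    used when [d] is zero. *)
Lemma in_Lp_parts (p : R) (f : R -> R[i]) : 0 < p -> in_Lp p f ->
  exists d : R, [/\ 0 <= d, cLnorm p f = d%:E, forall c, Lp p (fpart f c) &
    forall d' c, d <= d' -> (nint (fun x => `|fpart f c x| `^ p)%R <= (d' `^ p)%:E)%E].
Proof.
move=> p0 [[mr mi] fy]; pose d := fine (cLnorm p f).
have dE : cLnorm p f = d%:E by rewrite fineK// ge0_fin_numE// Lnorm_ge0.
have d0 : 0 <= d by rewrite -lee_fin -dE Lnorm_ge0.
have mf c : measurable_fun setT (fpart f c) by case: c.
have fb c : (nint (fun x => `|fpart f c x| `^ p)%R <= (d `^ p)%:E)%E.
  rewrite -poweR_EFin -dE /cLnorm poweR_Lnorm ?gt_eqF//.
  apply: ge0_le_integral_nomeas => x; first by rewrite lee_fin powR_ge0.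
  rewrite gee0_abs; last by rewrite lee_fin normc_ge0.
  rewrite poweR_EFin lee_fin; apply: le_powR => //; first exact: ltW.
  by case: c; [exact: normc_ge_Im|exact: normc_ge_Re].
exists d; split=> // [c|d' c dd'].
  by split=> //; apply: le_lt_trans (fb c) _; exact: ltry.
by apply: (le_trans (fb c)); rewrite lee_fin; apply: le_powR => //; exact: ltW.
Qed.

Lemma cLnorm_le (r B : R) (f : R -> R[i]) : 0 < r -> 0 <= B ->
  (nint (fun x => Normc.normc (f x) `^ r)%R <= (B `^ r)%:E)%E -> (cLnorm r f <= B%:E)%E.
Proof.
move=> r0 B0 h.
have e : cLnorm r f = ((nint (fun x => Normc.normc (f x) `^ r)%R) `^ r^-1)%E.
  rewrite /cLnorm unlock; congr poweR; apply: eq_integral => x _.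
  by rewrite gee0_abs ?lee_fin ?normc_ge0// poweR_EFin.
have -> : B%:E = ((B `^ r)%:E `^ r^-1)%E.
  by rewrite poweR_EFin -powRrM mulfV ?gt_eqF// powRr1.
rewrite e; apply: gt0_ler_poweR => //.
- by rewrite invr_ge0 ltW.
- rewrite in_itv/= leey andbT; apply: nint_ge0 => x; exact: powR_ge0.
- by rewrite in_itv/= leey andbT lee_fin powR_ge0.
Qed.

Lemma paraproduct_bound (Phi1 : R -> R[i]) (p1 p2 r : R) (L1 L2 M1 M2 : int) (m : nat)
    (f1 f2 : R -> R[i]) (D1 D2 : R) :
  bump_on (2^-1) 2 (fourier Phi1) -> 1 < p1 -> 1 < p2 -> 0 < r -> p1^-1 + p2^-1 = r^-1 ->
  (forall c, Lp p1 (fpart f1 c)) -> (forall c, Lp p2 (fpart f2 c)) -> 0 < D1 -> 0 < D2 ->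
  (forall n, measurable_fun setT (majorant (fourier Phi1) L1 M1 m f1 n) /\
    (nint (fun x => majorant (fourier Phi1) L1 M1 m f1 n x `^ p1)%R <= (D1 `^ p1)%:E)%E) ->
  (forall n, measurable_fun setT (majorant (fourier Phi1) L2 M2 m f2 n) /\
    (nint (fun x => majorant (fourier Phi1) L2 M2 m f2 n x `^ p2)%R <= (D2 `^ p2)%:E)%E) ->
  {ae mu, forall x : R, czseries_cvg (paraproduct_term Phi1 L1 L2 M1 M2 m f1 f2 x)} /\
  (cLnorm r (paraproduct Phi1 L1 L2 M1 M2 m f1 f2) <= (2 * (D1 * D2))%:E)%E.
Proof.
move=> hb p11 p21 r0 pr fL1 fL2 D10 D20 h1 h2.
pose Q n x := majorant (fourier Phi1) L1 M1 m f1 n x * majorant (fourier Phi1) L2 M2 m f2 n x.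
have Q0 n x : 0 <= Q n x by rewrite mulr_ge0 ?majorant_ge0.
have mQ n : measurable_fun setT (Q n) by apply: measurable_funM; [case: (h1 n)|case: (h2 n)].
have [|||n|H [mH QH HD]] := @monotone_limit R (fun n x => Q n x `^ r) ((D1 * D2) `^ r)%:E.
- by move=> n; exact: measurable_powRf.
- by move=> n x; exact: powR_ge0.
- move=> n x; apply: le_powR; [exact: ltW|exact: Q0|].
  by apply: ler_pM; rewrite ?majorant_ge0 ?majorant_nd.
- have [m1 b1] := h1 n; have [m2 b2] := h2 n.
  by apply: (hoelder_nint r0 (lt_trans ltr01 p11) (lt_trans ltr01 p21)) => // x; exact: majorant_ge0.
have H0 x : (0 <= H x)%E by apply: le_trans (QH 0%N x); rewrite lee_fin powR_ge0.
(* Where [H] is finite it dominates the [r]-th powers of all partial sums of absolute values, giving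
   convergence and a bound at once; the factor 2 adds the real and imaginary parts. *)
have good x (h : R) : H x = h%:E ->
    czseries_cvg (paraproduct_term Phi1 L1 L2 M1 M2 m f1 f2 x) /\
    Normc.normc (paraproduct Phi1 L1 L2 M1 M2 m f1 f2 x) <= 2 * h `^ r^-1.
  move=> Hx; apply: czseries_bounded => n.
  apply: (le_trans (paraproduct_partial L1 L2 M1 M2 m n x hb p11 p21 fL1 fL2)).
  have := QH n x; rewrite Hx lee_fin => Qh.
  have -> : majorant (fourier Phi1) L1 M1 m f1 n x * majorant (fourier Phi1) L2 M2 m f2 n x =
      (Q n x `^ r) `^ r^-1 by rewrite -powRrM mulfV ?gt_eqF// powRr1.
  by apply: le_powR => //; rewrite ?invr_ge0 ?powR_ge0 ?(ltW r0).
split.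
  have iH : mu.-integrable setT H.
    apply/integrableP; split=> //.
    have -> : (\int[mu]_x `|H x| = \int[mu]_x H x)%E by apply: eq_integral => x _; rewrite gee0_abs.
    by apply: le_lt_trans HD _; exact: ltry.
  have := integrable_ae measurableT iH; apply: filterS => x /(_ I) fx.
  by have [] := @good x (fine (H x)) (esym (fineK fx)).
apply: cLnorm_le => //; first by rewrite !mulr_ge0// ltW.
apply: (@le_trans _ _ (\int[mu]_x ((2 `^ r)%:E * H x))%E).
  apply: ge0_le_integral_nomeas => x; first by rewrite lee_fin powR_ge0.
  (* Where [H] is infinite the series may diverge and the paraproduct take a default value; the
     inequality is then trivial. *)
  have := H0 x; case Hx : (H x) => [h| |]// h0; last by rewrite gt0_muley ?leey// lte_fin powR_gt0.
  have [_ b] := good x h Hx.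
  rewrite -EFinM lee_fin; apply: (le_trans (le_powR (ltW r0) (normc_ge0 _) b)).
  by rewrite powRM ?powR_ge0// -powRrM mulVf ?gt_eqF// powRr1.
rewrite ge0_integralZl//.
have -> : (2 * (D1 * D2)) `^ r = 2 `^ r * (D1 * D2) `^ r by rewrite powRM// mulr_ge0// ltW.
by rewrite EFinM; apply: lee_wpmul2l; [rewrite lee_fin powR_ge0|exact: HD].
Qed.

End Paraproducts.

(** A limit has a default value when the series diverges, so the norm inequality by itself would not
    say that the paraproduct is the sum of its series. The conclusion therefore also asserts
    convergence at almost every point. *)
Theorem theorem2p2 (R : realType) (Phi1 : R -> R[i])
    (Phi1_schwartz : schwartz Phi1)
    (Phi1_bump : bump_on (2^-1) 2 (fourier Phi1))
    (eps p1 p2 r : R)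
    (eps_gt0 : 0 < eps) (p1_gt1 : 1 < p1) (p2_gt1 : 1 < p2)
    (p1p2r : p1^-1 + p2^-1 = r^-1) :
  exists C : R,
    forall (L1 L2 M1 M2 : int) (m : nat),
      0 < L1 -> 0 < L2 ->
      (forall j : int,
          (2 : R) ^ (L1 * j + M1 + m%:Z) <= 2 ^ (L2 * j + M2)) ->
      forall f1 f2 : R -> R[i], in_Lp p1 f1 -> in_Lp p2 f2 ->
        {ae @lebesgue_measure R, forall x : R,
          czseries_cvg (paraproduct_term Phi1 L1 L2 M1 M2 m f1 f2 x)} /\
        (cLnorm r (paraproduct Phi1 L1 L2 M1 M2 m f1 f2)
           <= (C * 2 `^ (eps * m%:R))%:E * cLnorm p1 f1 * cLnorm p2 f2)%E.
Proof.
have p1_gt0 := lt_trans ltr01 p1_gt1; have p2_gt0 := lt_trans ltr01 p2_gt1.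
have r_gt0 : 0 < r by rewrite -invr_gt0 -p1p2r addr_gt0 ?invr_gt0.
have [C1 C10 hC1] := majorant_bound Phi1_bump p1_gt1.
have [C2 C20 hC2] := majorant_bound Phi1_bump p2_gt1.
pose E := (1 + 2 / (eps * ln 2)) ^+ 2.
(* The 2 comes from real and imaginary parts, [C1] and [C2] from the two majorants, each with a
   factor [m + 1], and [E] from trading [(m + 1) ^+ 2] for the exponential. *)
exists (2 * (C1 * C2) * E) => L1 L2 M1 M2 m L10 L20 _ f1 f2 fL1 fL2.
have [d1 [d10 -> F1 b1]] := in_Lp_parts p1_gt0 fL1.
have [d2 [d20 -> F2 b2]] := in_Lp_parts p2_gt0 fL2.
(* [hoelder_nint] normalizes by the norms [d1] and [d2], which may vanish. *)
have main (t : R) : 0 < t ->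
    {ae @lebesgue_measure R, forall x : R,
      czseries_cvg (paraproduct_term Phi1 L1 L2 M1 M2 m f1 f2 x)} /\
    (cLnorm r (paraproduct Phi1 L1 L2 M1 M2 m f1 f2)
      <= (2 * ((C1 * m.+1%:R * (d1 + t)) * (C2 * m.+1%:R * (d2 + t))))%:E)%E.
  move=> t0; have dt (d : R) : 0 <= d -> 0 < d + t by move=> d0; rewrite ltr_wpDl.
  have le_t (d : R) : d <= d + t by rewrite lerDl ltW.
  have m1 n := hC1 L1 M1 m n f1 (d1 + t) L10 F1 (ltW (dt _ d10))
    (fun c => b1 _ c (le_t _)).
  have m2 n := hC2 L2 M2 m n f2 (d2 + t) L20 F2 (ltW (dt _ d20))
    (fun c => b2 _ c (le_t _)).
  apply: (paraproduct_bound Phi1_bump p1_gt1 p2_gt1 r_gt0 p1p2r F1 F2 _ _ m1 m2).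
    by rewrite !mulr_gt0// dt.
  by rewrite !mulr_gt0// dt.
split; first by have [] := main 1 ltr01.
have E0 : 0 < 2 * (C1 * C2) * m.+1%:R ^+ 2 by rewrite !mulr_gt0// exprn_gt0.
apply: (@le_trans _ _ (2 * (C1 * C2) * m.+1%:R ^+ 2 * (d1 * d2))%:E); last first.
  rewrite -!EFinM lee_fin.
  have -> : 2 * (C1 * C2) * E * 2 `^ (eps * m%:R) * d1 * d2 =
      2 * (C1 * C2) * (E * 2 `^ (eps * m%:R)) * (d1 * d2) by ring.
  apply: ler_wpM2r; first exact: mulr_ge0.
  apply: ler_wpM2l; first by rewrite !mulr_ge0// ltW.
  exact: sqr_succ_le_exp.
apply/lee_addgt0Pr => e e0.
pose k := 2 * (C1 * C2) * m.+1%:R ^+ 2.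
(* Enlarging both norms by [t] costs [k * (d1 + d2 + t) * t]. As [t <= 1], this is at most
   [k * (d1 + d2 + 1) * t], hence at most [e]. *)
pose t := Num.min 1 (e / (k * (d1 + d2 + 1))).
have kd : 0 < k * (d1 + d2 + 1) by rewrite mulr_gt0// ltr_wpDl// addr_ge0.
have t0 : 0 < t by rewrite lt_min ltr01 divr_gt0.
have t1 : t <= 1 by rewrite ge_min lexx.
have te : k * (d1 + d2 + 1) * t <= e.
  by rewrite mulrC -ler_pdivlMr// ge_min lexx orbT.
have [_ h] := main t t0; apply: (le_trans h); rewrite -EFinD lee_fin.
have -> : 2 * (C1 * m.+1%:R * (d1 + t) * (C2 * m.+1%:R * (d2 + t))) =
   k * (d1 * d2) + k * (d1 + d2 + t) * t by rewrite /k; ring.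
rewrite -/k lerD2l; apply: le_trans te; rewrite ler_wpM2r ?(ltW t0)//.
by rewrite ler_wpM2l ?(ltW E0)// lerD2l.
Qed.
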